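(* Let $V$ be a finite-dimensional real vector space with a non-degenerate quadratic form $\mathcal{Q}_V$, and let $\mathcal{S}$ be the $\wedge^{\mathrm{even}}(V)$-valued meromorphic function on $\mathfrak{o}(V)$ given by $\mathcal{S}(A)=J^{1/2}(A)\exp(\mathfrak{r}(A))$ (exponential in the exterior algebra; see context for $J^{1/2}$ and $\mathfrak{r}$). Then $\mathcal{S}$ is analytic on all of $\mathfrak{o}(V)$ (i.e. it extends analytically from the complement of the poles of $\mathfrak{r}$). Moreover, let $E$ be a (real) vector space and $\phi:V\to E$ a linear map, with components $\phi^a=\phi(e^a)$, where $e_a$ is a basis of $V$ with dual basis $e^a$. Then for all $A\in\mathfrak{o}(V)$ the following identity holds in $\mathrm{Cl}(V)\otimes\wedge(E)$: $$ q\Big(\iota_{\mathcal{S}(A)}\exp\big(\lambda(A)-\textstyle\sum_a e_a\phi^a\big)\Big)=\exp\big(\gamma(A)-\textstyle\sum_a e_a\phi^a\big),$$ where the exponential on the left is taken in $\wedge(V)\otimes\wedge(E)$, the one on the right is taken in $\mathrm{Cl}(V)\otimes\wedge(E)$, and $q$ and $\iota_{\mathcal{S}(A)}$ act on the first tensor factor.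
   Context: $B(v,w)=\frac12(\mathcal{Q}_V(v+w)-\mathcal{Q}_V(v)-\mathcal{Q}_V(w))$ is the symmetric bilinear form of $\mathcal{Q}_V$; $V^*$ is identified with $V$ via $B$, so for a basis $e_a$ of $V$ the dual basis $e^a\in V$ satisfies $B(e_a,e^b)=\delta_a^b$. $\mathrm{Cl}(V)$ is the quotient of the tensor algebra by the ideal generated by $v\otimes v-\frac12\mathcal{Q}_V(v)$, $v\in V$; it is $\mathbb{Z}_2$-graded with generators $v\in V$ odd. All commutators and tensor products (e.g. $\wedge(V)\otimes\wedge(E)$, $\mathrm{Cl}(V)\otimes\wedge(E)$) are taken in the $\mathbb{Z}_2$-graded sense. The quantization map $q:\wedge V\to\mathrm{Cl}(V)$ is the linear isomorphism given by the inclusion of $\wedge V$ into the tensor algebra as anti-symmetric tensors followed by the quotient map. $\iota_v$ ($v\in V$) is the contraction on $\wedge V$, the odd derivation with $\iota_v w=B(v,w)$; $\beta\mapsto\iota_\beta$ is its extension to an algebra homomorphism $\wedge V\to\mathrm{End}(\wedge V)$, so $\iota_{v\wedge w}=\iota_v\iota_w$. $\mathfrak{o}(V)$ is the Lie algebra of the orthogonal group $\mathrm{O}(V)$ of $(V,\mathcal{Q}_V)$; $\lambda:\mathfrak{o}(V)\to\wedge^2V$, $\lambda(A)=\frac12\sum_a A(e_a)\wedge e^a$; $\gamma(A)=q(\lambda(A))\in\mathrm{Cl}(V)$. Let $j(z)=\frac{\sinh(z/2)}{z/2}$ and $f(z)=(\ln j)'(z)=\frac12\coth(\frac z2)-\frac1z$.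 Functions of $A$ are defined by functional calculus. $J(A)=\det(j(A))$ is a smooth function on $\mathfrak{o}(V)$ and $J^{1/2}$ is its unique smooth square root equal to $1$ at $A=0$. $\mathfrak{r}(A)=\lambda(f(A))\in\wedge^2V$ is a meromorphic function of $A\in\mathfrak{o}(V)$, defined when $A$ has no eigenvalue in $2\pi\sqrt{-1}\,\mathbb{Z}\setminus\{0\}$. *)

(* Defs.v *)
From HB Require Import structures.
From mathcomp Require Import all_boot all_order all_algebra perm.
From mathcomp Require Import all_classical all_reals all_analysis.
From mathcomp Require Import complex.

Set Implicit Arguments.
Unset Strict Implicit.
Unset Printing Implicit Defensive.

Import Order.TTheory GRing.Theory Num.Theory.
Import numFieldNormedType.Exports.

Local Open Scope classical_set_scope.
Local Open Scope ring_scope.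
Local Open Scope quotient_scope.

(* Tensor algebra of an R-module V, as the R-algebra presented by the         *)
(* generators V and the relations making V -> T(V) linear.                    *)
Section TensorAlgebra.
Variables (R : realType) (V : lmodType R).

Inductive texp : Type :=
  | TVar of V
  | TZero
  | TOne
  | TAdd of texp & texp
  | TMul of texp & texp
  | TScale of R & texp.

HB.instance Definition _ := gen_eqMixin texp.
HB.instance Definition _ := gen_choiceMixin texp.

Inductive teq : texp -> texp -> Prop :=
  | teq_refl a : teq a a
  | teq_sym a b : teq a b -> teq b a
  | teq_trans a b c : teq a b -> teq b c -> teq a c
  | teq_add a a' b b' : teq a a' -> teq b b' -> teq (TAdd a b) (TAdd a' b')
  | teq_mul a a' b b' : teq a a' -> teq b b' -> teq (TMul a b) (TMul a' b')
  | teq_scale c a a' : teq a a' -> teq (TScale c a) (TScale c a')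
  | teq_addA a b c : teq (TAdd a (TAdd b c)) (TAdd (TAdd a b) c)
  | teq_addC a b : teq (TAdd a b) (TAdd b a)
  | teq_add0 a : teq (TAdd TZero a) a
  | teq_addN a : teq (TAdd (TScale (-1) a) a) TZero
  | teq_mulA a b c : teq (TMul a (TMul b c)) (TMul (TMul a b) c)
  | teq_mul1l a : teq (TMul TOne a) a
  | teq_mul1r a : teq (TMul a TOne) a
  | teq_mulDl a b c : teq (TMul (TAdd a b) c) (TAdd (TMul a c) (TMul b c))
  | teq_mulDr a b c : teq (TMul a (TAdd b c)) (TAdd (TMul a b) (TMul a c))
  | teq_scaleA c d a : teq (TScale c (TScale d a)) (TScale (c * d) a)
  | teq_scale1 a : teq (TScale 1 a) a
  | teq_scaleDr c a b : teq (TScale c (TAdd a b)) (TAdd (TScale c a) (TScale c b))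
  | teq_scaleDl c d a : teq (TScale (c + d) a) (TAdd (TScale c a) (TScale d a))
  | teq_scaleAl c a b : teq (TScale c (TMul a b)) (TMul (TScale c a) b)
  | teq_scaleAr c a b : teq (TScale c (TMul a b)) (TMul a (TScale c b))
  | teq_varD v w : teq (TVar (v + w)) (TAdd (TVar v) (TVar w))
  | teq_varZ c v : teq (TVar (c *: v)) (TScale c (TVar v)).

Definition teqb (a b : texp) : bool := `[< teq a b >].

Fact teqb_refl : reflexive teqb.
Proof. by move=> a; apply/asboolP; exact: teq_refl. Qed.
Fact teqb_sym : symmetric teqb.
Proof. by move=> a b; apply/asboolP/asboolP; exact: teq_sym. Qed.
Fact teqb_trans : transitive teqb.
Proof.
by move=> a b c /asboolP ba /asboolP ac; apply/asboolP; exact: teq_trans ba ac.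
Qed.

Canonical teqb_equiv := EquivRel teqb teqb_refl teqb_sym teqb_trans.

Definition tensalg : Type := {eq_quot teqb}.
HB.instance Definition _ := Choice.on tensalg.
HB.instance Definition _ : EqQuotient _ teqb tensalg :=
  EqQuotient.on tensalg.

Lemma tpiP a b : \pi_tensalg a = \pi_tensalg b <-> teq a b.
Proof.
split=> [/eqmodP|] ab; first exact/asboolP.
by apply/eqmodP; exact/asboolP.
Qed.

Definition tadd := locked (fun x y : tensalg => \pi_tensalg (TAdd (repr x) (repr y))).
Definition tmul := locked (fun x y : tensalg => \pi_tensalg (TMul (repr x) (repr y))).
Definition tscale := locked (fun c (x : tensalg) => \pi_tensalg (TScale c (repr x))).

Lemma taddE a b : tadd (\pi_tensalg a) (\pi_tensalg b) = \pi_tensalg (TAdd a b).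
Proof. by rewrite /tadd -lock; apply/tpiP/teq_add; apply/tpiP; rewrite reprK. Qed.
Lemma tmulE a b : tmul (\pi_tensalg a) (\pi_tensalg b) = \pi_tensalg (TMul a b).
Proof. by rewrite /tmul -lock; apply/tpiP/teq_mul; apply/tpiP; rewrite reprK. Qed.
Lemma tscaleE c a : tscale c (\pi_tensalg a) = \pi_tensalg (TScale c a).
Proof. by rewrite /tscale -lock; apply/tpiP/teq_scale; apply/tpiP; rewrite reprK. Qed.

Local Ltac tax :=
  repeat (elim/quotW => ?); intros; cbv beta;
  rewrite ?(taddE, tmulE, tscaleE); apply/tpiP; by constructor.

Fact taddA : associative tadd. Proof. tax. Qed.
Fact taddC : commutative tadd. Proof. tax. Qed.
Fact tadd0 : left_id (\pi_tensalg TZero) tadd. Proof. tax. Qed.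
Fact taddN : left_inverse (\pi_tensalg TZero) (tscale (-1)) tadd.
Proof. tax. Qed.
HB.instance Definition _ :=
  GRing.isZmodule.Build tensalg taddA taddC tadd0 taddN.

Fact tscaleA c d (x : tensalg) : tscale c (tscale d x) = tscale (c * d) x.
Proof. move: x; tax. Qed.
Fact tscale1 : left_id 1 tscale. Proof. tax. Qed.
Fact tscaleDr : right_distributive tscale tadd.
Proof. move=> c; tax. Qed.
Fact tscaleDl (x : tensalg) : {morph tscale^~ x : c d / c + d >-> tadd c d}.
Proof. move: x; elim/quotW => a c d; tax. Qed.
HB.instance Definition _ :=
  GRing.Zmodule_isLmodule.Build R tensalg tscaleA tscale1 tscaleDr tscaleDl.

(* augmentation, used only for 1 != 0 *)
Fixpoint taug (a : texp) : R :=
  match a with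
  | TVar _ | TZero => 0
  | TOne => 1
  | TAdd a b => taug a + taug b
  | TMul a b => taug a * taug b
  | TScale c a => c * taug a
  end.

Lemma taugP a b : teq a b -> taug a = taug b.
Proof.
elim=> //= {a b}.
- by move=> a b c _ -> _ ->.
- by move=> a a' b b' _ -> _ ->.
- by move=> a a' b b' _ -> _ ->.
- by move=> c a a' _ ->.
- by move=> *; rewrite addrA.
- by move=> *; rewrite addrC.
- by move=> *; rewrite add0r.
- by move=> *; rewrite mulN1r addNr.
- by move=> *; rewrite mulrA.
- by move=> *; rewrite mul1r.
- by move=> *; rewrite mulr1.
- by move=> *; rewrite mulrDl.
- by move=> *; rewrite mulrDr.
- by move=> *; rewrite mulrA.
- by move=> *; rewrite mul1r.
- by move=> *; rewrite mulrDr.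
- by move=> *; rewrite mulrDl.
- by move=> *; rewrite mulrA.
- by move=> *; rewrite mulrCA.
- by rewrite addr0.
- by move=> *; rewrite mulr0.
Qed.

Fact tmulA : associative tmul. Proof. tax. Qed.
Fact tmul1l : left_id (\pi_tensalg TOne) tmul. Proof. tax. Qed.
Fact tmul1r : right_id (\pi_tensalg TOne) tmul. Proof. tax. Qed.
Fact tmulDl : left_distributive tmul tadd. Proof. tax. Qed.
Fact tmulDr : right_distributive tmul tadd. Proof. tax. Qed.
Fact tone_neq0 : \pi_tensalg TOne != 0 :> tensalg.
Proof.
apply/eqP => /tpiP/taugP /= /eqP; exact/negP/oner_neq0.
Qed.
HB.instance Definition _ := GRing.Zmodule_isNzRing.Build tensalg
  tmulA tmul1l tmul1r tmulDl tmulDr tone_neq0.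

Fact tscaleAl c (x y : tensalg) : 
  tscale c (tmul x y) = tmul (tscale c x) y.
Proof. move: x y; tax. Qed.
Fact tscaleAr c (x y : tensalg) : 
  tscale c (tmul x y) = tmul x (tscale c y).
Proof. move: x y; tax. Qed.
HB.instance Definition _ := GRing.Lmodule_isLalgebra.Build R tensalg tscaleAl.
HB.instance Definition _ := GRing.Lalgebra_isAlgebra.Build R tensalg tscaleAr.

Definition tvar (v : V) : tensalg := \pi_tensalg (TVar v).

End TensorAlgebra.

Section TensorAlgebraTheory.
Variables (R : realType) (V : lmodType R).
Local Notation T := (tensalg V).

Fact tvar_linear : linear (@tvar R V).
Proof.
move=> c v w; rewrite /tvar.
have -> : c *: \pi_T (TVar v) = \pi_T (TScale c (TVar v)) by exact: tscaleE.
have -> : forall a b, \pi_T a + \pi_T b = \pi_T (TAdd a b) by exact: taddE.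
apply/tpiP; apply: teq_trans (teq_varD _ _) _.
by apply: teq_add; [exact: teq_varZ | exact: teq_refl].
Qed.
HB.instance Definition _ :=
  GRing.isLinear.Build R V T *:%R (@tvar R V) tvar_linear.

Lemma tensalg_ind (P : T -> Prop) : (forall v, P (tvar v)) -> P 1 ->
  (forall x y, P x -> P y -> P (x + y)) ->
  (forall x y, P x -> P y -> P (x * y)) ->
  (forall c x, P x -> P (c *: x)) -> forall x, P x.
Proof.
move=> Pv P1 PD PM PZ; elim/quotW; elim=> //.
- by have := PZ 0 _ P1; rewrite scale0r.
- by move=> a Pa b Pb; rewrite -taddE; exact: PD.
- by move=> a Pa b Pb; rewrite -tmulE; exact: PM.
- by move=> c a Pa; rewrite -tscaleE; exact: PZ.
Qed.

Fixpoint teval (A : algType R) (f : V -> A) (a : texp V) : A :=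
  match a with
  | TVar v => f v
  | TZero => 0
  | TOne => 1
  | TAdd a b => teval f a + teval f b
  | TMul a b => teval f a * teval f b
  | TScale c a => c *: teval f a
  end.

Definition tlift (A : algType R) (f : V -> A) (x : T) : A := teval f (repr x).

Section Lift.
Variables (A : algType R) (f : {linear V -> A}).

Lemma teval_teq a b : teq a b -> teval f a = teval f b.
Proof.
elim=> //= {a b}.
- by move=> a b c _ -> _ ->.
- by move=> a a' b b' _ -> _ ->.
- by move=> a a' b b' _ -> _ ->.
- by move=> c a a' _ ->.
- by move=> *; rewrite addrA.
- by move=> *; rewrite addrC.
- by move=> *; rewrite add0r.
- by move=> *; rewrite scaleN1r addNr.
- by move=> *; rewrite mulrA.
- by move=> *; rewrite mul1r.
- by move=> *; rewrite mulr1.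
- by move=> *; rewrite mulrDl.
- by move=> *; rewrite mulrDr.
- by move=> *; rewrite scalerA.
- by move=> *; rewrite scale1r.
- by move=> *; rewrite scalerDr.
- by move=> *; rewrite scalerDl.
- by move=> *; rewrite scalerAl.
- by move=> *; rewrite scalerAr.
- by move=> *; rewrite linearD.
- by move=> *; rewrite linearZ.
Qed.

Lemma tliftE a : tlift f (\pi_T a) = teval f a.
Proof. by apply/teval_teq/tpiP; rewrite reprK. Qed.

Lemma tlift_var v : tlift f (tvar v) = f v.
Proof. exact: tliftE. Qed.

Fact tlift_linear : linear (tlift f).
Proof.
move=> c; elim/quotW => a; elim/quotW => b; rewrite !tliftE.
have -> : c *: \pi_T a = \pi_T (TScale c a) by exact: tscaleE.
have -> : \pi_T (TScale c a) + \pi_T b = \pi_T (TAdd (TScale c a) b).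
  exact: taddE.
by rewrite tliftE.
Qed.

Fact tlift_monoid_morphism : monoid_morphism (tlift f).
Proof.
split; first exact: tliftE.
elim/quotW => a; elim/quotW => b; rewrite !tliftE.
have -> : \pi_T a * \pi_T b = \pi_T (TMul a b) by exact: tmulE.
by rewrite tliftE.
Qed.

HB.instance Definition _ :=
  GRing.isLinear.Build R T A *:%R (tlift f) tlift_linear.
HB.instance Definition _ :=
  GRing.isMonoidMorphism.Build T A (tlift f) tlift_monoid_morphism.
End Lift.

Definition tensalg_parity : T -> T := tlift (\- @tvar R V).

End TensorAlgebraTheory.

(* Quotient of an algebra by the two-sided ideal generated by S. It is only   *)
(* a pzRingType: that 1 != 0 in the quotient depends on S.                    *)
Section AlgQuotient.
Variables (R : realType) (A : algType R) (S : set A).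

Inductive ideal : A -> Prop :=
  | ideal_gen x : S x -> ideal x
  | ideal0 : ideal 0
  | idealD x y : ideal x -> ideal y -> ideal (x + y)
  | idealMl a x : ideal x -> ideal (a * x)
  | idealMr a x : ideal x -> ideal (x * a).

Lemma idealZ c x : ideal x -> ideal (c *: x).
Proof. by move=> /(idealMl c%:A); rewrite mulr_algl. Qed.

Definition eqideal (x y : A) : bool := `[< ideal (x - y) >].

Fact eqideal_refl : reflexive eqideal.
Proof. by move=> x; apply/asboolP; rewrite subrr; exact: ideal0. Qed.
Fact eqideal_sym : symmetric eqideal.
Proof.
by move=> x y; apply/asboolP/asboolP => /(idealZ (-1)); rewrite scaleN1r opprB.
Qed.
Fact eqideal_trans : transitive eqideal.
Proof.
move=> y x z /asboolP xy /asboolP /(idealD xy) xz.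
by apply/asboolP; rewrite -[x](subrK y) -addrA.
Qed.

Canonical eqideal_equiv :=
  EquivRel eqideal eqideal_refl eqideal_sym eqideal_trans.

Definition algquot : Type := {eq_quot eqideal}.
HB.instance Definition _ := Choice.on algquot.
HB.instance Definition _ : EqQuotient _ eqideal algquot :=
  EqQuotient.on algquot.

Definition inquot (x : A) : algquot := \pi_algquot x.

Lemma inquotP x y : inquot x = inquot y <-> ideal (x - y).
Proof.
split=> [/eqmodP|] xy; first exact/asboolP.
by apply/eqmodP; exact/asboolP.
Qed.

Lemma inquotW (P : algquot -> Prop) : (forall x, P (inquot x)) -> forall x, P x.
Proof. by move=> Px; elim/quotW. Qed.

Lemma repr_inquot x : ideal (repr (inquot x) - x).
Proof. by apply/inquotP; rewrite /inquot reprK. Qed.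

Definition qadd := locked (fun x y : algquot => inquot (repr x + repr y)).
Definition qmul := locked (fun x y : algquot => inquot (repr x * repr y)).
Definition qscale :=
  locked (fun (c : R) (x : algquot) => inquot (c *: repr x)).

Lemma qaddE x y : qadd (inquot x) (inquot y) = inquot (x + y).
Proof.
rewrite /qadd -lock; apply/inquotP; rewrite opprD addrACA.
by apply: idealD; exact: repr_inquot.
Qed.
Lemma qscaleE c x : qscale c (inquot x) = inquot (c *: x).
Proof.
by rewrite /qscale -lock; apply/inquotP; rewrite -scalerBr; apply/idealZ/repr_inquot.
Qed.
Lemma qmulE x y : qmul (inquot x) (inquot y) = inquot (x * y).
Proof.
rewrite /qmul -lock; apply/inquotP.
rewrite -(subrK (x * repr (inquot y)) (_ * _)) -mulrBl -addrA -mulrBr.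
by apply: idealD; [apply/idealMr/repr_inquot | apply/idealMl/repr_inquot].
Qed.

Local Ltac qax :=
  repeat (elim/inquotW => ?); intros; cbv beta;
  rewrite ?(qaddE, qmulE, qscaleE); congr inquot.

Fact qaddA : associative qadd. Proof. by qax; rewrite addrA. Qed.
Fact qaddC : commutative qadd. Proof. by qax; rewrite addrC. Qed.
Fact qadd0 : left_id (inquot 0) qadd. Proof. by qax; rewrite add0r. Qed.
Fact qaddN : left_inverse (inquot 0) (qscale (-1)) qadd.
Proof. by qax; rewrite scaleN1r addNr. Qed.
HB.instance Definition _ :=
  GRing.isZmodule.Build algquot qaddA qaddC qadd0 qaddN.

Fact qscaleA c d (x : algquot) : qscale c (qscale d x) = qscale (c * d) x.
Proof. by move: x; qax; rewrite scalerA. Qed.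
Fact qscale1 : left_id 1 qscale. Proof. by qax; rewrite scale1r. Qed.
Fact qscaleDr : right_distributive qscale qadd.
Proof. by move=> c; qax; rewrite scalerDr. Qed.
Fact qscaleDl (x : algquot) : {morph qscale^~ x : c d / c + d >-> qadd c d}.
Proof. by move: x; elim/inquotW => x c d; qax; rewrite scalerDl. Qed.
HB.instance Definition _ :=
  GRing.Zmodule_isLmodule.Build R algquot qscaleA qscale1 qscaleDr qscaleDl.

Fact qmulA : associative qmul. Proof. by qax; rewrite mulrA. Qed.
Fact qmul1l : left_id (inquot 1) qmul. Proof. by qax; rewrite mul1r. Qed.
Fact qmul1r : right_id (inquot 1) qmul. Proof. by qax; rewrite mulr1. Qed.
Fact qmulDl : left_distributive qmul qadd. Proof. by qax; rewrite mulrDl. Qed.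
Fact qmulDr : right_distributive qmul qadd. Proof. by qax; rewrite mulrDr. Qed.
HB.instance Definition _ := GRing.Zmodule_isPzRing.Build algquot
  qmulA qmul1l qmul1r qmulDl qmulDr.

Lemma algquot_scalerAl (c : R) (x y : algquot) : c *: (x * y) = (c *: x) * y.
Proof.
suff : qscale c (qmul x y) = qmul (qscale c x) y by [].
by move: x y; qax; rewrite scalerAl.
Qed.
Lemma algquot_scalerAr (c : R) (x y : algquot) : c *: (x * y) = x * (c *: y).
Proof.
suff : qscale c (qmul x y) = qmul x (qscale c y) by [].
by move: x y; qax; rewrite scalerAr.
Qed.

Fact inquot_linear : linear inquot.
Proof. by move=> c x y; apply/esym; rewrite -qaddE -qscaleE. Qed.
HB.instance Definition _ :=
  GRing.isLinear.Build R A algquot *:%R inquot inquot_linear.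

Fact inquot_monoid_morphism : monoid_morphism inquot.
Proof. by split=> // x y; apply/esym; rewrite -qmulE. Qed.
HB.instance Definition _ :=
  GRing.isMonoidMorphism.Build A algquot inquot inquot_monoid_morphism.

End AlgQuotient.

Section Clifford.
Variables (R : realType) (V : lmodType R) (Q : V -> R).

(* normalization: v * v = Q v / 2, i.e. v * w + w * v = B(v, w) *)
Definition cliff_rel : set (tensalg V) :=
  [set tvar v * tvar v - (2^-1 * Q v)%:A | v in [set: V]].

Definition Cl : Type := algquot cliff_rel.
HB.instance Definition _ := GRing.PzRing.on Cl.
HB.instance Definition _ := GRing.Lmodule.on Cl.

Definition clvar (v : V) : Cl := inquot cliff_rel (tvar v).

HB.instance Definition _ := GRing.Linear.copy clvar
  (inquot cliff_rel \o @tvar R V).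

(* the automorphism x |-> (-1)^|x| x defining the Z/2-grading *)
Definition parity (x : Cl) : Cl :=
  inquot cliff_rel (tensalg_parity (repr (x : algquot cliff_rel))).

Lemma clvar_sqr v : clvar v * clvar v = (2^-1 * Q v) *: (1 : Cl).
Proof.
have -> : (2^-1 * Q v) *: (1 : Cl) = inquot cliff_rel ((2^-1 * Q v)%:A).
  by rewrite linearZ rmorph1.
have -> : clvar v * clvar v = inquot cliff_rel (tvar v * tvar v).
  by rewrite rmorphM.
by apply/inquotP; apply: ideal_gen; exists v.
Qed.

Lemma Cl_ind (P : Cl -> Prop) : (forall v, P (clvar v)) -> P 1 ->
  (forall x y, P x -> P y -> P (x + y)) ->
  (forall x y, P x -> P y -> P (x * y)) ->
  (forall c x, P x -> P (c *: x)) -> forall x, P x.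
Proof.
move=> Pv P1 PD PM PZ; apply: inquotW => x; move: x; apply: tensalg_ind => //.
- by move=> x y Px Py; rewrite linearD; exact: PD.
- by move=> x y Px Py; rewrite rmorphM; exact: PM.
- by move=> c x Px; rewrite linearZ; exact: PZ.
Qed.

Lemma parity_ideal x : ideal cliff_rel x -> ideal cliff_rel (tensalg_parity x).
Proof.
elim=> {x} [_ [v _ <-]||x y _ Ix _ Iy|a x _ Ix|a x _ Ix].
- rewrite /tensalg_parity linearB linearZ rmorph1 rmorphM /= !tlift_var /=.
  by rewrite mulrNN; apply: ideal_gen; exists v.
- by rewrite /tensalg_parity raddf0; exact: ideal0.
- by rewrite /tensalg_parity raddfD; exact: idealD.
- by rewrite /tensalg_parity rmorphM; exact: idealMl.
- by rewrite /tensalg_parity rmorphM; exact: idealMr.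
Qed.

Lemma parityE x : parity (inquot cliff_rel x) = inquot cliff_rel (tensalg_parity x).
Proof.
apply/inquotP; rewrite /tensalg_parity -raddfB.
exact/parity_ideal/repr_inquot.
Qed.

Fact parity_linear : linear parity.
Proof.
move=> c; apply: inquotW => x; apply: inquotW => y.
have -> : (c *: (inquot cliff_rel x : Cl) + inquot cliff_rel y) =
  inquot cliff_rel (c *: x + y) by rewrite linearP.
by rewrite !parityE /tensalg_parity !linearP.
Qed.

Fact parity_monoid_morphism : monoid_morphism parity.
Proof.
split.
  have -> : (1 : Cl) = inquot cliff_rel 1 by rewrite rmorph1.
  by rewrite parityE /tensalg_parity !rmorph1.
apply: inquotW => x; apply: inquotW => y.
have -> : (inquot cliff_rel x : Cl) * inquot cliff_rel y =
  inquot cliff_rel (x * y) by rewrite rmorphM.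
by rewrite !parityE /tensalg_parity !rmorphM.
Qed.

HB.instance Definition _ :=
  GRing.isLinear.Build R Cl Cl *:%R parity parity_linear.
HB.instance Definition _ :=
  GRing.isMonoidMorphism.Build Cl Cl parity parity_monoid_morphism.

Lemma parity_clvar v : parity (clvar v) = - clvar v.
Proof.
by rewrite /clvar parityE /tensalg_parity tlift_var [LHS]linearN.
Qed.

Lemma parityK : involutive parity.
Proof.
apply: Cl_ind => [v|||x y Px Py|c x Px].
- by rewrite parity_clvar raddfN /= parity_clvar opprK.
- by rewrite !rmorph1.
- by move=> x y Px Py; rewrite !raddfD /= Px Py.
- by rewrite !rmorphM /= Px Py.
- by rewrite !linearZ /= Px.
Qed.

End Clifford.

Definition bilinear_fun (R : realType) (M N U : lmodType R) (F : M -> N -> U) :=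
  (forall a, linear (F a)) /\ (forall b, linear (F^~ b)).

Section TensorProduct.
Variables (R : realType) (M N : lmodType R).

Inductive pexp : Type :=
  | PPure of M & N
  | PZero
  | PAdd of pexp & pexp
  | PScale of R & pexp.

HB.instance Definition _ := gen_eqMixin pexp.
HB.instance Definition _ := gen_choiceMixin pexp.

Inductive peq : pexp -> pexp -> Prop :=
  | peq_refl a : peq a a
  | peq_sym a b : peq a b -> peq b a
  | peq_trans a b c : peq a b -> peq b c -> peq a c
  | peq_add a a' b b' : peq a a' -> peq b b' -> peq (PAdd a b) (PAdd a' b')
  | peq_scale c a a' : peq a a' -> peq (PScale c a) (PScale c a')
  | peq_addA a b c : peq (PAdd a (PAdd b c)) (PAdd (PAdd a b) c)
  | peq_addC a b : peq (PAdd a b) (PAdd b a)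
  | peq_add0 a : peq (PAdd PZero a) a
  | peq_addN a : peq (PAdd (PScale (-1) a) a) PZero
  | peq_scaleA c d a : peq (PScale c (PScale d a)) (PScale (c * d) a)
  | peq_scale1 a : peq (PScale 1 a) a
  | peq_scaleDr c a b : peq (PScale c (PAdd a b)) (PAdd (PScale c a) (PScale c b))
  | peq_scaleDl c d a : peq (PScale (c + d) a) (PAdd (PScale c a) (PScale d a))
  | peq_pureDl m m' n : peq (PPure (m + m') n) (PAdd (PPure m n) (PPure m' n))
  | peq_pureDr m n n' : peq (PPure m (n + n')) (PAdd (PPure m n) (PPure m n'))
  | peq_pureZl c m n : peq (PPure (c *: m) n) (PScale c (PPure m n))
  | peq_pureZr c m n : peq (PPure m (c *: n)) (PScale c (PPure m n)).

Definition peqb (a b : pexp) : bool := `[< peq a b >].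

Fact peqb_refl : reflexive peqb.
Proof. by move=> a; apply/asboolP; exact: peq_refl. Qed.
Fact peqb_sym : symmetric peqb.
Proof. by move=> a b; apply/asboolP/asboolP; exact: peq_sym. Qed.
Fact peqb_trans : transitive peqb.
Proof.
by move=> a b c /asboolP ba /asboolP ac; apply/asboolP; exact: peq_trans ba ac.
Qed.

Canonical peqb_equiv := EquivRel peqb peqb_refl peqb_sym peqb_trans.

Definition tensor : Type := {eq_quot peqb}.
HB.instance Definition _ := Choice.on tensor.
HB.instance Definition _ : EqQuotient _ peqb tensor := EqQuotient.on tensor.

Lemma ppiP a b : \pi_tensor a = \pi_tensor b <-> peq a b.
Proof.
split=> [/eqmodP|] ab; first exact/asboolP.
by apply/eqmodP; exact/asboolP.
Qed.

Definition padd :=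
  locked (fun x y : tensor => \pi_tensor (PAdd (repr x) (repr y))).
Definition pscale :=
  locked (fun c (x : tensor) => \pi_tensor (PScale c (repr x))).

Lemma paddE a b : padd (\pi_tensor a) (\pi_tensor b) = \pi_tensor (PAdd a b).
Proof.
by rewrite /padd -lock; apply/ppiP/peq_add; apply/ppiP; rewrite reprK.
Qed.
Lemma pscaleE c a : pscale c (\pi_tensor a) = \pi_tensor (PScale c a).
Proof.
by rewrite /pscale -lock; apply/ppiP/peq_scale; apply/ppiP; rewrite reprK.
Qed.

Local Ltac pax :=
  repeat (elim/quotW => ?); intros; cbv beta;
  rewrite ?(paddE, pscaleE); apply/ppiP; by constructor.

Fact paddA : associative padd. Proof. pax. Qed.
Fact paddC : commutative padd. Proof. pax. Qed.
Fact padd0 : left_id (\pi_tensor PZero) padd. Proof. pax. Qed.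
Fact paddN : left_inverse (\pi_tensor PZero) (pscale (-1)) padd.
Proof. pax. Qed.
HB.instance Definition _ :=
  GRing.isZmodule.Build tensor paddA paddC padd0 paddN.

Fact pscaleA c d (x : tensor) : pscale c (pscale d x) = pscale (c * d) x.
Proof. move: x; pax. Qed.
Fact pscale1 : left_id 1 pscale. Proof. pax. Qed.
Fact pscaleDr : right_distributive pscale padd.
Proof. move=> c; pax. Qed.
Fact pscaleDl (x : tensor) : {morph pscale^~ x : c d / c + d >-> padd c d}.
Proof. move: x; elim/quotW => a c d; pax. Qed.
HB.instance Definition _ :=
  GRing.Zmodule_isLmodule.Build R tensor pscaleA pscale1 pscaleDr pscaleDl.

Definition pure (m : M) (n : N) : tensor := \pi_tensor (PPure m n).

Fact pure_bilinear : bilinear_fun pure.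
Proof.
suff [pD pZ] : (forall m m' n n',
    pure (m + m') n = padd (pure m n) (pure m' n) /\
    pure m (n + n') = padd (pure m n) (pure m n')) /\
  (forall c m n, pure (c *: m) n = pscale c (pure m n) /\
    pure m (c *: n) = pscale c (pure m n)).
  split=> [m c n n'|n c m m'] /=.
    by rewrite (pD m m (c *: n) n').2 (pZ c m n).2.
  by rewrite (pD (c *: m) m' n n).1 (pZ c m n).1.
by split=> *; split; rewrite ?(paddE, pscaleE); apply/ppiP; constructor.
Qed.

Lemma tensor_ind (P : tensor -> Prop) : (forall m n, P (pure m n)) ->
  (forall x y, P x -> P y -> P (x + y)) -> (forall c x, P x -> P (c *: x)) ->
  forall x, P x.
Proof.
move=> Pp PD PZ; elim/quotW; elim=> //.
- by have := PZ 0 _ (Pp 0 0); rewrite scale0r.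
- by move=> a Pa b Pb; rewrite -paddE; exact: PD.
- by move=> c a Pa; rewrite -pscaleE; exact: PZ.
Qed.

Section Lift.
Variable U : lmodType R.

Fixpoint peval (F : M -> N -> U) (a : pexp) : U :=
  match a with
  | PPure m n => F m n
  | PZero => 0
  | PAdd a b => peval F a + peval F b
  | PScale c a => c *: peval F a
  end.

(* the linear map induced by F; meaningful only if F is bilinear *)
Definition plift (F : M -> N -> U) (x : tensor) : U := peval F (repr x).

Variable F : M -> N -> U.
Hypothesis Fbil : bilinear_fun F.

Lemma bilinear_funDl m m' n : F (m + m') n = F m n + F m' n.
Proof. by have := Fbil.2 n 1 m m'; rewrite /= !scale1r. Qed.
Lemma bilinear_funDr m n n' : F m (n + n') = F m n + F m n'.
Proof. by have := Fbil.1 m 1 n n'; rewrite !scale1r. Qed.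
Lemma bilinear_fun0l n : F 0 n = 0.
Proof. by apply: (addrI (F 0 n)); rewrite -bilinear_funDl !addr0. Qed.
Lemma bilinear_fun0r m : F m 0 = 0.
Proof. by apply: (addrI (F m 0)); rewrite -bilinear_funDr !addr0. Qed.
Lemma bilinear_funZl c m n : F (c *: m) n = c *: F m n.
Proof. by have := Fbil.2 n c m 0; rewrite /= bilinear_fun0l !addr0. Qed.
Lemma bilinear_funZr c m n : F m (c *: n) = c *: F m n.
Proof. by have := Fbil.1 m c n 0; rewrite /= bilinear_fun0r !addr0. Qed.

Lemma peval_peq a b : peq a b -> peval F a = peval F b.
Proof.
elim=> //= {a b}.
- by move=> a b c _ -> _ ->.
- by move=> a a' b b' _ -> _ ->.
- by move=> c a a' _ ->.
- by move=> *; rewrite addrA.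
- by move=> *; rewrite addrC.
- by move=> *; rewrite add0r.
- by move=> *; rewrite scaleN1r addNr.
- by move=> *; rewrite scalerA.
- by move=> *; rewrite scale1r.
- by move=> *; rewrite scalerDr.
- by move=> *; rewrite scalerDl.
- by move=> *; rewrite bilinear_funDl.
- by move=> *; rewrite bilinear_funDr.
- by move=> *; rewrite bilinear_funZl.
- by move=> *; rewrite bilinear_funZr.
Qed.

Lemma plift_pi a : plift F (\pi_tensor a) = peval F a.
Proof. by apply/peval_peq/ppiP; rewrite reprK. Qed.

Lemma plift_pure m n : plift F (pure m n) = F m n.
Proof. exact: plift_pi. Qed.

Lemma plift_linear : linear (plift F).
Proof.
suff H c x y : plift F (padd (pscale c x) y) = c *: plift F x + plift F y.
  exact: H.
by move: x y; elim/quotW => a; elim/quotW => b; rewrite pscaleE paddE !plift_pi.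
Qed.

Lemma pliftD : {morph plift F : x y / x + y}.
Proof. by move=> x y; have := plift_linear 1 x y; rewrite !scale1r. Qed.

Lemma pliftZ c x : plift F (c *: x) = c *: plift F x.
Proof.
have F0 : plift F 0 = 0 by apply: (addrI (plift F 0)); rewrite -pliftD !addr0.
by have := plift_linear c x 0; rewrite F0 !addr0.
Qed.

End Lift.

End TensorProduct.

(* f (x) id *)
Definition tmap1 (R : realType) (M M' N : lmodType R) (f : M -> M') :
  tensor M N -> tensor M' N := plift (fun m n => pure (f m) n).

Lemma half_double (K : numFieldType) (U : lmodType K) (u : U) :
  2^-1 *: (u + u) = u.
Proof. by rewrite -mulr2n -(scaler_nat 2 u) scalerA mulVf ?scale1r// pnatr_eq0. Qed.

Section GradedTensorProduct.
Variables (R : realType) (V W : lmodType R) (QV : V -> R) (QW : W -> R).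
Local Notation A := (Cl QV).
Local Notation B := (Cl QW).

Definition gtensor : Type := tensor A B.
HB.instance Definition _ := GRing.Lmodule.on gtensor.

Definition ClEven (b : B) : B := (2^-1 : R) *: (b + parity b).
Definition ClOdd (b : B) : B := (2^-1 : R) *: (b - parity b).

(* (a (x) b) (a' (x) b') = (-1)^(|b| |a'|) a a' (x) b b' for homogeneous b, a' *)
Definition gmul_pure (a : A) (b : B) (a' : A) (b' : B) : gtensor :=
  pure (a * a') (ClEven b * b') + pure (a * parity a') (ClOdd b * b').

Definition gmul (x y : gtensor) : gtensor :=
  plift (fun a b => plift (gmul_pure a b) y) x.

HB.instance Definition _ := GRing.Linear.copy ClEven
  ((2^-1 : R) \*: ((@idfun B) \+ @parity _ _ QW)).
HB.instance Definition _ := GRing.Linear.copy ClOdd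
  ((2^-1 : R) \*: ((@idfun B) \- @parity _ _ QW)).

Lemma ClEvenDOdd b : ClEven b + ClOdd b = b.
Proof.
rewrite /ClEven /ClOdd -scalerDr addrACA subrr addr0.
exact: half_double.
Qed.
Lemma parity_ClEven b : parity (ClEven b) = ClEven b.
Proof. by rewrite /ClEven linearZ linearD /= parityK addrC. Qed.
Lemma parity_ClOdd b : parity (ClOdd b) = - ClOdd b.
Proof. by rewrite /ClOdd linearZ linearB /= parityK -scalerN opprB. Qed.
Lemma ClEven_id b : parity b = b -> ClEven b = b /\ ClOdd b = 0.
Proof. move=> pb; rewrite /ClEven /ClOdd pb subrr scaler0; split=> //; exact: half_double. Qed.
Lemma ClOdd_id b : parity b = - b -> ClEven b = 0 /\ ClOdd b = b.
Proof. move=> pb; rewrite /ClEven /ClOdd pb subrr opprK scaler0; split=> //; exact: half_double. Qed.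
Lemma ClEven_mul b b' :
  ClEven (ClEven b * b') = ClEven b * ClEven b' /\
  ClOdd (ClEven b * b') = ClEven b * ClOdd b'.
Proof.
rewrite -{1 3}(ClEvenDOdd b') mulrDr !linearD /=.
have [-> ->] := @ClEven_id (ClEven b * ClEven b')
  ltac:(by rewrite rmorphM /= !parity_ClEven).
have [-> ->] := @ClOdd_id (ClEven b * ClOdd b')
  ltac:(by rewrite rmorphM /= parity_ClEven parity_ClOdd mulrN).
by rewrite addr0 add0r.
Qed.
Lemma ClOdd_mul b b' :
  ClEven (ClOdd b * b') = ClOdd b * ClOdd b' /\
  ClOdd (ClOdd b * b') = ClOdd b * ClEven b'.
Proof.
rewrite -{1 3}(ClEvenDOdd b') mulrDr !linearD /=.
have [-> ->] := @ClOdd_id (ClOdd b * ClEven b')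
  ltac:(by rewrite rmorphM /= parity_ClEven parity_ClOdd mulNr).
have [-> ->] := @ClEven_id (ClOdd b * ClOdd b')
  ltac:(by rewrite rmorphM /= !parity_ClOdd mulrNN).
by rewrite addr0 add0r.
Qed.

Let pDl := bilinear_funDl (pure_bilinear A B).
Let pDr := bilinear_funDr (pure_bilinear A B).
Let pZl := bilinear_funZl (pure_bilinear A B).
Let pZr := bilinear_funZr (pure_bilinear A B).

Lemma gmul_pure_bilinear a b : bilinear_fun (gmul_pure a b).
Proof.
split=> [a' c x y|b' c x y] /=; rewrite /gmul_pure.
  rewrite !mulrDr -!algquot_scalerAr !pDr !pZr scalerDr.
  by rewrite addrACA.
rewrite linearP !mulrDr -!algquot_scalerAr !pDl !pZl scalerDr.
by rewrite addrACA.
Qed.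

Lemma gmul_pure_bilinear2 a' b' :
  bilinear_fun (fun a b => gmul_pure a b a' b').
Proof.
split=> [a c x y|b c x y] /=; rewrite /gmul_pure.
  rewrite !linearP /= !mulrDl -!algquot_scalerAl !pDr !pZr scalerDr.
  by rewrite addrACA.
rewrite !mulrDl -!algquot_scalerAl !pDl !pZl scalerDr.
by rewrite addrACA.
Qed.

Lemma gmul_bilinear1 (y : gtensor) :
  bilinear_fun (fun a b => plift (gmul_pure a b) y).
Proof.
have bl := gmul_pure_bilinear; have bl2 := gmul_pure_bilinear2.
split=> [a c b b'|b c a a'] /=; move: y; apply: tensor_ind.
- by move=> m n; rewrite !plift_pure // (bl2 m n).1.
- by move=> x y Px Py; rewrite !pliftD // Px Py scalerDr addrACA.
- by move=> d x Px; rewrite !pliftZ // Px scalerDr !scalerA mulrC.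
- by move=> m n; rewrite !plift_pure // ((bl2 m n).2 b c a a').
- by move=> x y Px Py; rewrite !pliftD // Px Py scalerDr addrACA.
- by move=> d x Px; rewrite !pliftZ // Px scalerDr !scalerA mulrC.
Qed.

Lemma gmulE a b a' b' : gmul (pure a b) (pure a' b') = gmul_pure a b a' b'.
Proof.
rewrite /gmul plift_pure; last exact: gmul_bilinear1.
by rewrite plift_pure //; exact: gmul_pure_bilinear.
Qed.

Fact gmulDl : left_distributive gmul +%R.
Proof. by move=> x y z; rewrite /gmul pliftD //; exact: gmul_bilinear1. Qed.

Lemma gmulZl c x y : gmul (c *: x) y = c *: gmul x y.
Proof. by rewrite /gmul pliftZ //; exact: gmul_bilinear1. Qed.

Fact gmulDr : right_distributive gmul +%R.
Proof.
move=> x y z; move: x; apply: tensor_ind => [m n|x x' Px Px'|c x Px].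
- rewrite /gmul !plift_pure; try exact: gmul_bilinear1.
  by rewrite pliftD //; exact: gmul_pure_bilinear.
- by rewrite !gmulDl Px Px' addrACA.
- by rewrite !gmulZl Px scalerDr.
Qed.

Lemma gmulZr c x y : gmul x (c *: y) = c *: gmul x y.
Proof.
move: x; apply: tensor_ind => [m n|x x' Px Px'|d x Px].
- rewrite /gmul !plift_pure; try exact: gmul_bilinear1.
  by rewrite pliftZ //; exact: gmul_pure_bilinear.
- by rewrite !gmulDl Px Px' scalerDr.
- by rewrite !gmulZl Px !scalerA mulrC.
Qed.

Definition gone : gtensor := pure (1 : A) (1 : B).

Fact gmul1l : left_id gone gmul.
Proof.
apply: tensor_ind => [m n|x y Px Py|c x Px].
- rewrite gmulE /gmul_pure !mul1r.
  have [-> ->] := @ClEven_id 1 (rmorph1 (@parity R W QW)).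
  by rewrite mul0r mul1r (bilinear_fun0r (pure_bilinear _ _)) addr0.
- by rewrite gmulDr Px Py.
- by rewrite gmulZr Px.
Qed.

Fact gmul1r : right_id gone gmul.
Proof.
apply: tensor_ind => [m n|x y Px Py|c x Px].
- by rewrite gmulE /gmul_pure rmorph1 !mulr1 -pDr ClEvenDOdd.
- by rewrite gmulDl Px Py.
- by rewrite gmulZl Px.
Qed.

Fact gmulA : associative gmul.
Proof.
move=> x y z; move: x; apply: tensor_ind => [m n|x x' Px Px'|c x Px].
- move: y; apply: tensor_ind => [m' n'|y y' Py Py'|c y Py].
  + move: z; apply: tensor_ind => [m'' n''|z z' Pz Pz'|c z Pz].
    * rewrite !gmulE /gmul_pure gmulDr gmulDl !gmulE /gmul_pure.
      have [-> ->] := ClEven_mul n n'; have [-> ->] := ClOdd_mul n n'.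
      by rewrite !rmorphM /= parityK !mulrA addrACA; congr (_ + _); rewrite addrC.
    * by rewrite !gmulDr Pz Pz'.
    * by rewrite !gmulZr Pz.
  + by rewrite !(gmulDl, gmulDr) Py Py'.
  + by rewrite !(gmulZl, gmulZr) Py.
- by rewrite !gmulDl Px Px'.
- by rewrite !gmulZl Px.
Qed.

HB.instance Definition _ := GRing.Zmodule_isPzRing.Build gtensor
  gmulA gmul1l gmul1r gmulDl gmulDr.

End GradedTensorProduct.

Definition gtl (R : realType) (V W : lmodType R) (QV : V -> R) (QW : W -> R)
  (x : Cl QV) : gtensor QV QW := pure x (1 : Cl QW).
Definition gtr (R : realType) (V W : lmodType R) (QV : V -> R) (QW : W -> R)
  (y : Cl QW) : gtensor QV QW := pure (1 : Cl QV) y.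

(* The exterior algebra is the Clifford algebra of the zero form: the ideal   *)
(* is then generated by the v (x) v.                                          *)
Definition zero_form (R : realType) (V : lmodType R) : V -> R := fun=> 0.
Notation ext V := (Cl (@zero_form _ V)).

(* Sum of a series in a real vector space without reference topology, tested  *)
(* against all linear forms. Linear forms separate points, and on a           *)
(* finite-dimensional space this is the usual convergence.                    *)
Definition vsum (R : realType) (U : lmodType R) (u : nat -> U) : U :=
  xget 0 [set y | forall l : {scalar U},
    (fun N => \sum_(k < N) l (u k)) @ \oo --> l y].

Definition Cl_exp (R : realType) (V : lmodType R) (Q : V -> R) (x : Cl Q) :
  Cl Q := vsum (fun k => (k`!%:R^-1 : R) *: x ^+ k).

Definition gtensor_exp (R : realType) (V W : lmodType R) (QV : V -> R)
    (QW : W -> R) (x : gtensor QV QW) : gtensor QV QW :=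
  vsum (fun k => (k`!%:R^-1 : R) *: x ^+ k).

Section SmoothAnalytic.
Variable R : realType.

Fixpoint Cn (k m : nat) (g : 'rV[R]_m -> R^o) : Prop :=
  match k with
  | 0 => continuous g
  | k'.+1 => (forall x v, derivable g x v) /\ (forall v, Cn k' (fun x => 'D_v g x))
  end.

Definition smooth (m : nat) (g : 'rV[R]_m -> R) : Prop := forall k, Cn k g.

(* near every point a, g is the sum of an absolutely convergent power series  *)
(* sum_alpha c_alpha (x - a)^alpha over multi-indices alpha                   *)
Definition real_analytic (m : nat) (g : 'rV[R]_m -> R) : Prop :=
  forall a, exists (r : R) (c : ('I_m -> nat) -> R),
  [/\ 0 < r,
      exists M : R, forall N : nat,
        \sum_(al : {ffun 'I_m -> 'I_N})
          `|c (fun i => al i)| * \prod_(i < m) r ^+ al i <= M &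
      forall h : 'rV[R]_m, (forall i, `|h ord0 i| < r) ->
        (fun N : nat => \sum_(al : {ffun 'I_m -> 'I_N})
          c (fun i => al i) * \prod_(i < m) h ord0 i ^+ al i) @ \oo
        --> g (a + h)].

(* Regularity on a linear subspace D of a vector space X, tested through all  *)
(* linear maps R^m -> D (linear coordinates on D being one of them); for      *)
(* vector-valued maps, through all linear forms on the target.                *)
Definition smooth_on (X : lmodType R) (D : set X) (g : X -> R) : Prop :=
  forall (m : nat) (L : {linear 'rV[R]_m -> X}), (forall x, D (L x)) ->
    smooth (g \o L).

Definition analytic_on (X U : lmodType R) (D : set X) (g : X -> U) : Prop :=
  forall (m : nat) (L : {linear 'rV[R]_m -> X}), (forall x, D (L x)) ->
  forall l : {scalar U}, real_analytic (l \o g \o L).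

End SmoothAnalytic.

Section FunctionalCalculus.
Variable R : realType.

(* Taylor coefficients at 0 of j(z) = sinh(z/2)/(z/2) and of j'(z) *)
Definition j_coef (k : nat) : R :=
  if odd k then 0 else (2 ^+ k * k.+1`!%:R)^-1.
Definition dj_coef : nat -> R := pseries_diffs j_coef.

Lemma j_coefE (z : R) : z != 0 ->
  pseries j_coef z @ \oo --> (expR (z / 2) - expR (- (z / 2))) / 2 / (z / 2).
Proof.
move=> z0; set w := z / 2.
have w0 : w != 0 by rewrite mulf_neq0 // invr_eq0 pnatr_eq0.
have zw : z = w * 2 by rewrite divfK // pnatr_eq0.
have -> : pseries j_coef z = (fun n => (series (exp_coeff w) n.+1 -
    series (exp_coeff (- w)) n.+1) / 2 / w).
  apply/funext; elim=> [|n IH].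
    rewrite /pseries /series /= big_geq // !big_nat1 /exp_coeff /= !expr0 subrr.
    by rewrite !mul0r.
  rewrite /pseries /series /= big_nat_recr //=.
  move: IH; rewrite /pseries /series /= => ->.
  rewrite [in RHS]big_nat_recr //= [in X in _ = (_ - X) / _ / _]big_nat_recr //=.
  rewrite opprD addrACA !mulrDl; congr (_ + _).
  rewrite /exp_coeff /= /j_coef exprNn zw exprMn [(n.+1)`!]factS.
  have f0 : n.+1%:R * n`!%:R != 0 :> R.
    by rewrite mulf_neq0 // pnatr_eq0 // -lt0n fact_gt0.
  have p0 : 2 ^+ n != 0 :> R by rewrite expf_neq0 // pnatr_eq0.
  have t0 : (2 : R) != 0 by rewrite pnatr_eq0.
  rewrite -signr_odd /= natrM; case: (odd n) => /=.
    by rewrite !mul0r expr0 mul1r !mulNr subrr.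
  rewrite expr1 mulN1r !mulNr opprK -!mulrDl -mulr2n -[w ^+ n.+1 *+ 2]mulr_natr.
  rewrite [w ^+ n.+1 * 2 / _]mulrAC mulfK // exprSr [w ^+ n * w / _]mulrAC mulfK //.
  by rewrite invfM mulrC -mulrA mulVKf.
apply: cvgM; last exact: cvg_cst.
apply: cvgM; last exact: cvg_cst.
apply: cvgB.
  by rewrite (cvg_shiftS (series (exp_coeff w))); exact: is_cvg_series_exp_coeff.
by rewrite (cvg_shiftS (series (exp_coeff (- w)))); exact: is_cvg_series_exp_coeff.
Qed.

Variable V : vectType R.
Implicit Types A : 'End(V).

Definition power_series (c : nat -> R) A : 'End(V) :=
  vsum (fun k => c k *: iter k (comp_lfun A) \1%VF).

Definition j_of A := power_series j_coef A.
Definition dj_of A := power_series dj_coef A.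

(* f(A), for f = (ln j)' = j'/j; meaningful when j(A) is invertible *)
Definition f_of A : 'End(V) := (dj_of A \o (j_of A)^-1)%VF.

Definition endmx A := passmx.mxof (vbasis {:V}) (vbasis {:V}) A.

Definition J_fun A : R := \det (endmx (j_of A)).

Definition complex_eigenvalue A (z : R[i]) : bool :=
  eigenvalue (map_mx (real_complex R) (endmx A)) z.

(* A has no eigenvalue in 2 pi i Z \ {0}: the domain of definition of f(A) *)
Definition pole_free A : Prop :=
  forall k : int, k != 0 -> ~~ complex_eigenvalue A (0 +i* (2 * pi * k%:~R))%C.

End FunctionalCalculus.

Section QuadraticForms.
Variables (R : realType) (V : lmodType R) (Q : V -> R).

Definition polar (v w : V) : R := 2^-1 * (Q (v + w) - Q v - Q w).

Definition is_qform : Prop :=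
  (forall c v, Q (c *: v) = c ^+ 2 * Q v) /\ (forall v, scalar (polar v)).

Definition nondegenerate_qform : Prop :=
  forall v, (forall w, polar v w = 0) -> v = 0.

(* contraction, contr and quant are selected by the properties that            *)
(* characterize them: each of these maps is unique because V generates the     *)
(* exterior algebra.                                                           *)

(* the odd derivation iota_v with w |-> B(v, w) *)
Definition is_contraction (v : V) (D : ext V -> ext V) : Prop :=
  [/\ linear D,
      forall x y, D (x * y) = D x * y + parity x * D y &
      forall w, D (clvar _ w) = polar v w *: (1 : ext V)].

Definition contraction (v : V) : ext V -> ext V :=
  xget (fun=> 0) [set D | is_contraction v D].

(* beta |-> iota_beta, an algebra homomorphism to the linear endomorphisms *)
Definition is_contraction_morphism (F : ext V -> ext V -> ext V) : Prop :=
  [/\ bilinear_fun F, F 1 = id, forall b b', F (b * b') = F b \o F b' &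
      forall v, F (clvar _ v) = contraction v].

Definition contr : ext V -> ext V -> ext V :=
  xget (fun=> fun=> 0) [set F | is_contraction_morphism F].

(* the inclusion of the exterior algebra as antisymmetric tensors,             *)
(*   v_1 ^ ... ^ v_k |-> 1/k! sum_s sgn(s) v_s(1) (x) ... (x) v_s(k),          *)
(* followed by the projection T(V) -> Cl(V)                                    *)
Definition is_quantization (g : ext V -> Cl Q) : Prop :=
  linear g /\ forall (k : nat) (v : 'I_k -> V),
    g (\prod_(i < k) clvar _ (v i)) =
    (k`!%:R^-1 : R) *: \sum_(s : 'S_k)
      ((-1) ^+ s : R) *: \prod_(i < k) clvar Q (v (s i)).

Definition quant : ext V -> Cl Q := xget (fun=> 0) [set g | is_quantization g].

End QuadraticForms.

Section Orthogonal.
Variables (R : realType) (V : vectType R) (Q : V -> R).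

(* the tangent space of O(V, Q) at the identity *)
Definition orthogonal_lie : set 'End(V) :=
  [set A | forall v w, polar Q (A v) w + polar Q v (A w) = 0].

(* only its values on o(V) are determined *)
Definition J_half : 'End(V) -> R :=
  xget (fun=> 0) [set g | [/\ smooth_on orthogonal_lie g,
    forall A, orthogonal_lie A -> g A ^+ 2 = J_fun A & g 0 = 1]].

Definition dual_bases (n : nat) (e e' : n.-tuple V) : Prop :=
  basis_of {:V} e /\
  forall a b : 'I_n, polar Q (tnth e a) (tnth e' b) = (a == b)%:R.

Variables (n : nat) (e e' : n.-tuple V).

Definition lambda (A : 'End(V)) : ext V :=
  (2^-1 : R) *: \sum_(a < n) clvar _ (A (tnth e a)) * clvar _ (tnth e' a).

Definition gamma (A : 'End(V)) : Cl Q := quant Q (lambda A).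

Definition frak_r (A : 'End(V)) : ext V := lambda (f_of A).

(* sum_a e_a phi^a, in Cl(V, Q0) (x) ext(E) *)
Definition ephi (Q0 : V -> R) (E : lmodType R) (phi : {linear V -> E}) :
    gtensor Q0 (@zero_form R E) :=
  \sum_(a < n) gtl _ (clvar Q0 (tnth e a)) * gtr _ (clvar _ (phi (tnth e' a))).

End Orthogonal.

(* Main.v *)
From HB Require Import structures.
Require Import Defs.
From mathcomp Require Import all_boot all_order all_algebra perm.
From mathcomp Require Import all_classical all_reals all_analysis.
From mathcomp Require Import complex spectral ring lra.

(* Let N be the degree operator of the exterior algebra, lam = lambda(A) and
   D = iota_lam + lam / 4. The function S is the entire series S(tA) = sum_k t^k s_k
   with s_0 = 1 and (k + N) s_k = D s_(k-1).

   Identity in Cl(V) (x) ext(E): put m = lam - sum_a e_a phi^a. Half the sum of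
   the left and right multiplications by q(m) is transported by q to
   m + iota_lam / 4. Commuting this operator past iota_{s_i} turns the recursion
   for s into q(m)^k / k! = q(sum_(i+j=k) iota_{s_i} m^j / j!) by induction on k,
   and summation over k gives the identity for every A.

   Closed form: the recursion also implies (iota_{j(A)u} + j'(A)u) S(A) = 0 for
   all u. When j(A) is invertible, which is the case away from the poles of r(A),
   this says N S = 2 r S, so S = h exp(r) with h the scalar part of S.

   Square root: along t |-> tA, the scalar part of the recursion and Jacobi's
   formula give 2 J h' = h J', hence h^2 = J. A second smooth square root of J that
   agrees with h at 0 agrees with h everywhere: they could only separate at a zero
   of h, where the difference would be flat whereas 2h vanishes to finite order. *)

Set Implicit Arguments.
Unset Strict Implicit.
Unset Printing Implicit Defensive.

Import Order.TTheory GRing.Theory Num.Theory.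
Import numFieldNormedType.Exports.

Local Open Scope classical_set_scope.
Local Open Scope ring_scope.
Local Open Scope quotient_scope.

(** * Modules over Clifford algebras *)

(** At a pole of r the product J^(1/2) exp(r) has no value, so S is defined by a series that
    converges everywhere: analyticity and the identity at the poles then require no limit argument.
    The recursion is forced by differentiating q(iota_{S(tA)} exp(t m)) = exp(t q(m)) in t. Since
    q(m) commutes with its powers, multiplication by q(m) may be symmetrized; this cancels the terms
    with a single contraction, and the remaining iota_lam / 4 becomes lam / 4 in D. Moving m across
    iota_S leaves iota_lam S and a sum of contractions of S paired with contractions of m; as iota_v
    exp(m) is exp(m) times the contraction of m by v, that sum turns into N S.

    The recursion inverts k + N, so s_k is O(C^k / k!). Smoothness and analyticity are therefore
    proved once, for sums of linear recursions whose matrices are O(1/k) and depend affinely on A.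

    The algebras are quotients without a given basis. Contraction, degree and q are all obtained by
    letting the generators act on a suitable space, and equalities of linear maps are checked by
    left multiplication with generators. *)

Section LinearFun.
Variables (R : realType) (U W : lmodType R) (f : U -> W).
Hypothesis f_lin : linear f.

Lemma lin_funD x y : f (x + y) = f x + f y.
Proof. by have := f_lin 1 x y; rewrite !scale1r. Qed.
Lemma lin_fun0 : f 0 = 0.
Proof. by apply: (addrI (f 0)); rewrite -lin_funD !addr0. Qed.
Lemma lin_funZ c x : f (c *: x) = c *: f x.
Proof. by have := f_lin c x 0; rewrite lin_fun0 !addr0. Qed.
Lemma lin_funN x : f (- x) = - f x.
Proof. by rewrite -scaleN1r lin_funZ scaleN1r. Qed.
Lemma lin_funB x y : f (x - y) = f x - f y.
Proof. by rewrite lin_funD lin_funN. Qed.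
Lemma lin_fun_sum (I : Type) (r : seq I) (P : pred I) (F : I -> U) :
  f (\sum_(i <- r | P i) F i) = \sum_(i <- r | P i) f (F i).
Proof. exact: (big_morph f lin_funD lin_fun0). Qed.
End LinearFun.

Lemma linear_of (R : realType) (U W : lmodType R) (f : {linear U -> W}) :
  linear f.
Proof. by move=> c x y; rewrite linearP. Qed.

Lemma linear_comp (R : realType) (U V W : lmodType R) (f : V -> W) (g : U -> V) :
  linear f -> linear g -> linear (fun x => f (g x)).
Proof. by move=> lf lg c x y; rewrite lg lf. Qed.

Section LinearOps.
Variables (R : realType) (U W : lmodType R).
Implicit Types f g : U -> W.
Lemma linear_addf f g : linear f -> linear g -> linear (fun x => f x + g x).
Proof. by move=> lf lg c x y; rewrite lf lg addrACA -scalerDr. Qed.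
Lemma linear_oppf f : linear f -> linear (fun x => - f x).
Proof. by move=> lf c x y; rewrite lf opprD scalerN. Qed.
Lemma linear_subf f g : linear f -> linear g -> linear (fun x => f x - g x).
Proof. by move=> lf lg; apply: linear_addf => //; apply: linear_oppf. Qed.
Lemma linear_scalef k f : linear f -> linear (fun x => k *: f x).
Proof. by move=> lf c x y; rewrite lf scalerDr !scalerA mulrC. Qed.
Lemma linear_sumf (I : Type) (r : seq I) (P : pred I) (F : I -> U -> W) :
  (forall i, linear (F i)) -> linear (fun x => \sum_(i <- r | P i) F i x).
Proof.
move=> lF c x y; rewrite scaler_sumr -big_split; apply: eq_bigr => i _ /=.
by rewrite lF.
Qed.
End LinearOps.

Section CliffordModule.
Variables (R : realType) (V : lmodType R) (Q : V -> R) (U : lmodType R).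

Definition clifford_module (f : V -> U -> U) :=
  bilinear_fun f /\ forall v u, f v (f v u) = (2^-1 * Q v) *: u.

Fixpoint texp_act (f : V -> U -> U) (a : texp V) : U -> U :=
  match a with
  | TVar v => f v
  | TZero => fun=> 0
  | TOne => id
  | TAdd a b => fun u => texp_act f a u + texp_act f b u
  | TMul a b => fun u => texp_act f a (texp_act f b u)
  | TScale c a => fun u => c *: texp_act f a u
  end.

(** Evaluates the term picked by [repr]. The choice is immaterial once f is a Clifford module:
    [texp_act_teq] handles the tensor algebra and [tact_ideal] the Clifford relation. *)
Definition Cl_act (f : V -> U -> U) (x : Cl Q) (u : U) : U :=
  texp_act f (repr (repr (x : algquot (cliff_rel Q)))) u.

Variable f : V -> U -> U.
Hypothesis fP : clifford_module f.

Lemma texp_act_linear a : linear (texp_act f a).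
Proof.
elim: a => /= [v|||a IHa b IHb|a IHa b IHb|c a IHa] d x y //.
- by rewrite (fP.1.1 v).
- by rewrite scaler0 addr0.
- by rewrite IHa IHb scalerDr addrACA.
- by rewrite IHb IHa.
- by rewrite IHa scalerDr !scalerA mulrC.
Qed.

Lemma texp_act_teq a b : teq a b -> texp_act f a = texp_act f b.
Proof.
elim=> //= {a b}.
- by move=> a b c _ -> _ ->.
- by move=> a a' b b' _ -> _ ->.
- by move=> a a' b b' _ -> _ ->.
- by move=> c a a' _ ->.
- by move=> *; apply/funext => u; rewrite addrA.
- by move=> *; apply/funext => u; rewrite addrC.
- by move=> *; apply/funext => u; rewrite add0r.
- by move=> *; apply/funext => u; rewrite scaleN1r addNr.
- by move=> a b c; apply/funext => u; rewrite (lin_funD (@texp_act_linear a)).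
- by move=> *; apply/funext => u; rewrite scalerA.
- by move=> *; apply/funext => u; rewrite scale1r.
- by move=> *; apply/funext => u; rewrite scalerDr.
- by move=> *; apply/funext => u; rewrite scalerDl.
- by move=> c a b; apply/funext => u; rewrite (lin_funZ (@texp_act_linear a)).
- by move=> v w; apply/funext => u; rewrite (bilinear_funDl fP.1).
- by move=> c v; apply/funext => u; rewrite (bilinear_funZl fP.1).
Qed.

Local Notation tact x := (texp_act f (repr x)).

Lemma tactE a : tact (\pi_(tensalg V) a) = texp_act f a.
Proof. by apply/texp_act_teq/tpiP; rewrite reprK. Qed.

Lemma tactD x y u : tact (x + y : tensalg V) u = tact x u + tact y u.
Proof.
have -> : x + y = tadd x y by [].
by elim/quotW: x => a; elim/quotW: y => b; rewrite taddE !tactE.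
Qed.
Lemma tactM x y u : tact (x * y : tensalg V) u = tact x (tact y u).
Proof.
have -> : x * y = tmul x y by [].
by elim/quotW: x => a; elim/quotW: y => b; rewrite tmulE !tactE.
Qed.
Lemma tactZ c x u : tact (c *: x : tensalg V) u = c *: tact x u.
Proof.
have -> : c *: x = tscale c x by [].
by elim/quotW: x => a; rewrite tscaleE !tactE.
Qed.
Lemma tact1 u : tact (1 : tensalg V) u = u.
Proof.
have -> : (1 : tensalg V) = \pi_(tensalg V) (@TOne R V) by [].
by rewrite tactE.
Qed.
Lemma tact_var v u : tact (tvar v) u = f v u.
Proof. by rewrite /tvar tactE. Qed.

Lemma tact_ideal x u : ideal (cliff_rel Q) x -> tact x u = 0.
Proof.
move=> Ix; elim: Ix u => {x} [_ [v _ <-] u||x y _ Ix _ Iy u|a x _ Ix u|a x _ Ix u].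
- rewrite tactD -scaleN1r !tactZ tactM !tact_var tact1 fP.2 scaleN1r.
  by rewrite subrr.
- by move=> u; rewrite -(scale0r 0) tactZ scale0r.
- by rewrite tactD Ix Iy addr0.
- by rewrite tactM Ix (lin_fun0 (@texp_act_linear _)).
- by rewrite tactM Ix.
Qed.

Lemma Cl_act_inquot x u : Cl_act f (inquot (cliff_rel Q) x) u = tact x u.
Proof.
apply/eqP; rewrite -subr_eq0; apply/eqP.
rewrite -scaleN1r -tactZ scaleN1r -tactD; apply: tact_ideal.
exact: repr_inquot.
Qed.

Lemma Cl_act_linear x : linear (Cl_act f x).
Proof. exact: texp_act_linear. Qed.

Lemma Cl_actD x y u : Cl_act f (x + y) u = Cl_act f x u + Cl_act f y u.
Proof.
move: x y; apply: inquotW => x; apply: inquotW => y.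
have -> : (inquot (cliff_rel Q) x : Cl Q) + inquot (cliff_rel Q) y =
  inquot (cliff_rel Q) (x + y) by rewrite linearD.
by rewrite !Cl_act_inquot tactD.
Qed.
Lemma Cl_actM x y u : Cl_act f (x * y) u = Cl_act f x (Cl_act f y u).
Proof.
move: x y; apply: inquotW => x; apply: inquotW => y.
have -> : (inquot (cliff_rel Q) x : Cl Q) * inquot (cliff_rel Q) y =
  inquot (cliff_rel Q) (x * y) by rewrite rmorphM.
by rewrite !Cl_act_inquot tactM.
Qed.
Lemma Cl_actZ c x u : Cl_act f (c *: x) u = c *: Cl_act f x u.
Proof.
move: x; apply: inquotW => x.
have -> : c *: (inquot (cliff_rel Q) x : Cl Q) =
  inquot (cliff_rel Q) (c *: x) by rewrite linearZ.
by rewrite !Cl_act_inquot tactZ.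
Qed.
Lemma Cl_act1 u : Cl_act f (1 : Cl Q) u = u.
Proof.
have -> : (1 : Cl Q) = inquot (cliff_rel Q) 1 by rewrite rmorph1.
by rewrite Cl_act_inquot tact1.
Qed.
Lemma Cl_act_var v u : Cl_act f (clvar Q v) u = f v u.
Proof. by rewrite Cl_act_inquot tact_var. Qed.

Lemma Cl_act_bilinear : bilinear_fun (Cl_act f).
Proof.
by split=> [x|u c x y]; [exact: Cl_act_linear | rewrite Cl_actD Cl_actZ].
Qed.

End CliffordModule.

Section ClTheory.
Variables (R : realType) (V : lmodType R) (Q : V -> R).
Implicit Types (x y : Cl Q) (v w : V).

Lemma mulZl c x y : (c *: x) * y = c *: (x * y).
Proof. by rewrite -algquot_scalerAl. Qed.
Lemma mulZr c x y : x * (c *: y) = c *: (x * y).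
Proof. by rewrite -algquot_scalerAr. Qed.

(** Applied to x * z for all z with P z, the induction of [Cl_ind] turns products into compositions,
    so only left multiplication by a generator has to be checked. *)
Lemma Cl_lind (P : Cl Q -> Prop) : P 1 -> (forall x y, P x -> P y -> P (x + y)) ->
  (forall c x, P x -> P (c *: x)) -> (forall v x, P x -> P (clvar Q v * x)) ->
  forall x, P x.
Proof.
move=> P1 PD PZ PM x; rewrite -[x]mulr1; move: (1 : Cl Q) P1.
move: x; apply: Cl_ind => [v y|y|x y IHx IHy z Pz|x y IHx IHy z Pz|c x IHx z Pz].
- exact: PM.
- by rewrite mul1r.
- by rewrite mulrDl; apply: PD; [exact: IHx | exact: IHy].
- by rewrite -mulrA; apply/IHx/IHy.
- by rewrite mulZl; apply/PZ/IHx.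
Qed.

Lemma Cl_lin_ext (U : lmodType R) (f g : Cl Q -> U) : linear f -> linear g ->
  f 1 = g 1 -> (forall v x, f x = g x -> f (clvar Q v * x) = g (clvar Q v * x)) ->
  f =1 g.
Proof.
move=> lf lg fg1 fgv; apply: Cl_lind => //.
- by move=> x y; rewrite (lin_funD lf) (lin_funD lg) => -> ->.
- by move=> c x; rewrite (lin_funZ lf) (lin_funZ lg) => ->.
Qed.

Lemma mul_linear x : linear (fun y => x * y).
Proof. by move=> c y z; rewrite mulrDr mulZr. Qed.
Lemma mulr_linear x : linear (fun y => y * x).
Proof. by move=> c y z; rewrite mulrDl mulZl. Qed.

End ClTheory.

Section Parity.
Variables (R : realType) (V : lmodType R) (Q : V -> R).
Implicit Types x y : Cl Q.
Lemma parityD x y : parity (x + y) = parity x + parity y.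
Proof. exact: raddfD. Qed.
Lemma parityN x : parity (- x) = - parity x.
Proof. exact: raddfN. Qed.
Lemma parityB x y : parity (x - y) = parity x - parity y.
Proof. exact: raddfB. Qed.
Lemma parityZ c x : parity (c *: x) = c *: parity x.
Proof. exact: linearZ. Qed.
Lemma parityM x y : parity (x * y) = parity x * parity y.
Proof. exact: rmorphM. Qed.
Lemma parity1 : parity (1 : Cl Q) = 1.
Proof. exact: rmorph1. Qed.
Lemma parity_varM v x : parity (clvar Q v * x) = - (clvar Q v * parity x).
Proof. by rewrite parityM parity_clvar mulNr. Qed.
End Parity.

Section Polar.
Variables (R : realType) (V : lmodType R) (Q : V -> R).
Hypothesis HQ : is_qform Q.
Implicit Types v w : V.

Lemma polarC v w : polar Q v w = polar Q w v.
Proof. by rewrite /polar [v + w]addrC addrAC. Qed.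
Lemma polarDr v x y : polar Q v (x + y) = polar Q v x + polar Q v y.
Proof. by have := HQ.2 v 1 x y; rewrite scale1r mul1r. Qed.
Lemma polar0r v : polar Q v 0 = 0.
Proof. by apply: (addrI (polar Q v 0)); rewrite -polarDr !addr0. Qed.
Lemma polarZr c v x : polar Q v (c *: x) = c * polar Q v x.
Proof. by have := HQ.2 v c x 0; rewrite polar0r !addr0. Qed.
Lemma polarDl v x y : polar Q (x + y) v = polar Q x v + polar Q y v.
Proof. by rewrite ![polar Q _ v]polarC polarDr. Qed.
Lemma polarZl c v x : polar Q (c *: x) v = c * polar Q x v.
Proof. by rewrite ![polar Q _ v]polarC polarZr. Qed.
Lemma polarNr v x : polar Q v (- x) = - polar Q v x.
Proof. by rewrite -scaleN1r polarZr mulN1r. Qed.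
Lemma polarNl v x : polar Q (- x) v = - polar Q x v.
Proof. by rewrite ![polar Q _ v]polarC polarNr. Qed.
Lemma polar_sumr v (I : Type) (r : seq I) (P : pred I) (F : I -> V) :
  polar Q v (\sum_(i <- r | P i) F i) = \sum_(i <- r | P i) polar Q v (F i).
Proof. exact: (big_morph _ (polarDr v) (polar0r v)). Qed.
Lemma polar_suml v (I : Type) (r : seq I) (P : pred I) (F : I -> V) :
  polar Q (\sum_(i <- r | P i) F i) v = \sum_(i <- r | P i) polar Q (F i) v.
Proof. by rewrite polarC polar_sumr; apply: eq_bigr => i _; rewrite polarC. Qed.

Lemma clvar_anticomm v w :
  clvar Q v * clvar Q w + clvar Q w * clvar Q v = polar Q v w *: (1 : Cl Q).
Proof.
have := clvar_sqr Q (v + w); rewrite linearD mulrDl !mulrDr !clvar_sqr.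
have -> : Q (v + w) = 2 * polar Q v w + Q v + Q w by rewrite /polar; field.
rewrite !mulrDr mulrA mulVf ?pnatr_eq0// mul1r !scalerDl.
rewrite -!addrA [polar Q v w *: _ + _]addrC -!addrA => /addrI.
rewrite !addrA => H.
by apply: (addIr ((2^-1 * Q w) *: (1 : Cl Q))); rewrite H addrC.
Qed.
End Polar.

(** * Contractions on the exterior algebra *)

Section ExtTheory.
Variables (R : realType) (V : lmodType R).
Implicit Types (v w : V) (x y : ext V).

Lemma ext_sq v : clvar (@zero_form R V) v * clvar _ v = 0.
Proof. by rewrite clvar_sqr mulr0 scale0r. Qed.

Lemma ext_anticomm v w :
  clvar (@zero_form R V) v * clvar _ w = - (clvar _ w * clvar _ v).
Proof.
apply/eqP; rewrite -addr_eq0; apply/eqP.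
rewrite clvar_anticomm /polar /zero_form !subr0 mulr0.
by rewrite scale0r.
Qed.

Lemma ext_parityE v x : clvar _ v * x = parity x * clvar (@zero_form R V) v.
Proof.
move: x; apply: Cl_lin_ext => [||| w x IH] /=.
- exact: mul_linear.
- by apply: (@linear_comp _ _ _ _ (fun x => x * _)); [exact: mulr_linear | exact: linear_of].
- by rewrite rmorph1 mulr1 mul1r.
- rewrite rmorphM /= parity_clvar mulrA ext_anticomm !mulNr -!mulrA IH.
  by [].
Qed.

(* The action of w on (a, b) is (- w a + B(v, w) b, w b), so x sends (0, 1) to *)
(* (iota_v x, x).                                                              *)
Definition contr_step (B : V -> R) (w : V) (u : ext V * ext V) :
    ext V * ext V :=
  (- (clvar _ w * u.1) + B w *: u.2, clvar _ w * u.2).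

Definition contr_by (B : V -> R) x : ext V :=
  (Cl_act (contr_step B) x (0, 1)).1.

Section ContrBy.
Variable B : V -> R.
Hypothesis B_lin : scalar B.

Let BD v w : B (v + w) = B v + B w.
Proof. by have := B_lin 1 v w; rewrite scale1r mul1r. Qed.
Let BZ c v : B (c *: v) = c * B v.
Proof.
have B0 : B 0 = 0 by apply: (addrI (B 0)); rewrite -BD !addr0.
by have := B_lin c v 0; rewrite B0 !addr0.
Qed.

Lemma contr_step_module : clifford_module (@zero_form R V) (contr_step B).
Proof.
split; first split=> [w c [a b] [a' b']|[a b] c w w'].
- congr pair => /=; rewrite mulrDr mulZr //.
  by rewrite opprD scalerDr addrACA scalerDr scalerN !scalerA [B w * c]mulrC.
- congr pair => /=; rewrite linearP ?mulrDl ?mulZl //.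
  by rewrite opprD BD BZ scalerDl addrACA scalerDr scalerN scalerA.
- move=> w [a b]; rewrite /zero_form mulr0 scale0r /contr_step /=.
  congr pair; last by rewrite mulrA ext_sq mul0r.
  rewrite mulrDr mulrN mulrA ext_sq mul0r oppr0 add0r mulZr.
  by rewrite addNr.
Qed.
Let M := contr_step_module.

Lemma contr_by_linear : linear (contr_by B).
Proof. by move=> c x y; rewrite /contr_by (Cl_actD M) (Cl_actZ M). Qed.

(** Identifies the action of x with the triangular matrix of diagonal entries [parity x], x and
    corner [contr_by B x]. The corner of a product of two such matrices is the graded Leibniz
    rule. *)
Lemma contr_by_act x a b :
  Cl_act (contr_step B) x (a, b) = (parity x * a + contr_by B x * b, x * b).
Proof.
suff [E1 E2] : (Cl_act (contr_step B) x (a, b)).1 = parity x * a + contr_by B x * b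
   /\ (Cl_act (contr_step B) x (a, b)).2 = x * b /\
      (Cl_act (contr_step B) x (0, 1)).2 = x.
  by rewrite [LHS]surjective_pairing E1 E2.1.
move: x; apply: Cl_lind => [|x y [E1 [E2 E3]] [F1 [F2 F3]]|c x [E1 [E2 E3]]|v x [E1 [E2 E3]]].
- by rewrite /contr_by !(Cl_act1 M) rmorph1 !mul1r mul0r addr0.
- rewrite !(Cl_actD M) /= E1 E2 E3 F1 F2 F3 raddfD (lin_funD contr_by_linear) !mulrDl.
  by rewrite addrACA.
- rewrite !(Cl_actZ M) /= E1 E2 E3 linearZ (lin_funZ contr_by_linear) !mulZl.
  by rewrite scalerDr.
- rewrite {1}/contr_by !(Cl_actM M) !(Cl_act_var M) /= E1 E2 E3.
  rewrite rmorphM /= parity_clvar !mulNr -!mulrA; split=> //.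
  rewrite mulrDr opprD -addrA; congr (_ + _).
  by rewrite mulrDl mulNr -mulrA mulZl.
Qed.

Lemma contr_byM x y :
  contr_by B (x * y) = contr_by B x * y + parity x * contr_by B y.
Proof.
rewrite {1}/contr_by (Cl_actM M).
by rewrite (contr_by_act y) contr_by_act /= mulr0 add0r !mulr1 addrC.
Qed.

Lemma contr_by_var v : contr_by B (clvar _ v) = B v *: (1 : ext V).
Proof. by rewrite /contr_by (Cl_act_var M) /= mulr0 oppr0 add0r. Qed.

End ContrBy.
End ExtTheory.

Section Contraction.
Variables (R : realType) (V : lmodType R) (Q : V -> R).
Hypothesis HQ : is_qform Q.
Implicit Types (v w : V) (x y b : ext V).
Local Notation iv := (Defs.contraction Q).

Lemma contractionP v : Defs.is_contraction Q v (Defs.contraction Q v).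
Proof.
rewrite /Defs.contraction; case: xgetP => [D -> //|]; case/(_ (contr_by (polar Q v))).
split.
- exact: (contr_by_linear (HQ.2 v)).
- exact: (contr_byM (HQ.2 v)).
- exact: (contr_by_var (HQ.2 v)).
Qed.

Lemma iv_linear v : linear (iv v).
Proof. by case: (contractionP v). Qed.
Lemma ivM v x y : iv v (x * y) = iv v x * y + parity x * iv v y.
Proof. by case: (contractionP v). Qed.
Lemma iv_var v w : iv v (clvar _ w) = polar Q v w *: (1 : ext V).
Proof. by case: (contractionP v). Qed.
Lemma iv1 v : iv v 1 = 0.
Proof.
have := ivM v 1 1; rewrite !mulr1 rmorph1 mul1r => H.
by apply: (addrI (iv v 1)); rewrite -H addr0.
Qed.
Lemma iv_varM v w x :
  iv v (clvar _ w * x) = polar Q v w *: x - clvar _ w * iv v x.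
Proof. by rewrite ivM iv_var mulZl mul1r parity_clvar mulNr. Qed.

Lemma iv_bilinear : bilinear_fun iv.
Proof.
split=> [v|x c v w]; first exact: iv_linear.
move: x; apply: Cl_lin_ext => [||| u x IH].
- exact: iv_linear.
- move=> d x y; rewrite !(iv_linear _ d) !scalerDr !scalerA mulrC.
  by rewrite addrACA.
- by rewrite !iv1 scaler0 addr0.
- rewrite !iv_varM IH (polarDl HQ) (polarZl HQ) scalerBr mulrDr mulZr scalerDl scalerA.
  by rewrite opprD addrACA.
Qed.

Lemma iv_parity v x : iv v (parity x) = - parity (iv v x).
Proof.
move: x; apply: Cl_lin_ext => [||| u x IH].
- by apply: (@linear_comp _ _ _ _ (iv v)); [exact: iv_linear | exact: linear_of].
- by move=> c x y; rewrite (iv_linear v) parityD parityZ opprD scalerN.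
- by rewrite parity1 iv1 raddf0 oppr0.
- rewrite parity_varM (lin_funN (@iv_linear v)) !iv_varM IH.
  by rewrite parityB parityZ parity_varM mulrN.
Qed.

Lemma iv_sq v x : iv v (iv v x) = 0.
Proof.
move: x; apply: Cl_lin_ext => [||| u x IH].
- by apply: (@linear_comp _ _ _ _ (iv v)); exact: iv_linear.
- by move=> c x y; rewrite scaler0 addr0.
- by rewrite !iv1 (lin_fun0 (@iv_linear v)).
- by rewrite iv_varM (lin_funB (@iv_linear v)) (lin_funZ (@iv_linear v)) iv_varM IH mulr0 subr0 subrr.
Qed.

Lemma iv_module : clifford_module (@zero_form R V) iv.
Proof.
by split=> [|v u]; [exact: iv_bilinear | rewrite iv_sq mulr0 scale0r].
Qed.

Lemma contrP : is_contraction_morphism Q (contr Q).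
Proof.
rewrite /contr; case: xgetP => [F -> //|]; case/(_ (Cl_act iv)); split.
- exact: (Cl_act_bilinear iv_module).
- by apply/funext => x; rewrite (Cl_act1 iv_module).
- by move=> b b'; apply/funext => x /=; rewrite (Cl_actM iv_module).
- by move=> v; apply/funext => x; rewrite (Cl_act_var iv_module).
Qed.

Lemma contr_bilinear : bilinear_fun (contr Q).
Proof. by case: contrP. Qed.
Lemma contr1 x : contr Q 1 x = x.
Proof. by case: contrP => _ -> _ _. Qed.
Lemma contrM b b' x : contr Q (b * b') x = contr Q b (contr Q b' x).
Proof. by case: contrP => _ _ -> _. Qed.
Lemma contr_var v x : contr Q (clvar _ v) x = iv v x.
Proof. by case: contrP => _ _ _ ->. Qed.
Lemma contr_linear b : linear (contr Q b).
Proof. exact: contr_bilinear.1. Qed.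
Lemma contr_linearl x : linear (fun b => contr Q b x).
Proof. exact: (contr_bilinear.2 x). Qed.

Lemma contr_parity b x :
  contr Q (parity b) (parity x) = parity (contr Q b x).
Proof.
move: b x; apply: Cl_lind => [x|b b' IH IH' x|c b IH x|v b IH x].
- by rewrite parity1 !contr1.
- by rewrite parityD !(lin_funD (@contr_linearl _)) IH IH' parityD.
- by rewrite parityZ !(lin_funZ (@contr_linearl _)) IH parityZ.
- rewrite parity_varM (lin_funN (@contr_linearl _)) !contrM !contr_var IH.
  by rewrite iv_parity opprK.
Qed.

(* for b even this reads [iota_b, w] = - iota_{iota_w b}, for b odd            *)
(* iota_b w + w iota_b = iota_{iota_w b}                                       *)
Lemma contr_mul_var w b x : contr Q b (clvar _ w * x) =
  clvar _ w * contr Q (parity b) x - contr Q (iv w (parity b)) x.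
Proof.
move: b x; apply: Cl_lind => [x|b b' IH IH' x|c b IH x|v b IH x].
- by rewrite parity1 iv1 !contr1 (lin_fun0 (@contr_linearl _)) subr0.
- rewrite parityD (lin_funD (@iv_linear w)) !(lin_funD (@contr_linearl _)) IH IH'.
  by rewrite mulrDr opprD addrACA.
- rewrite parityZ (lin_funZ (@iv_linear w)) !(lin_funZ (@contr_linearl _)) IH.
  by rewrite mulZr scalerBr.
- rewrite contrM IH parity_varM (lin_funN (@iv_linear w)).
  rewrite !(lin_funN (@contr_linearl _)) !contrM iv_varM !contr_var.
  rewrite (lin_funB (@contr_linearl _)) (lin_funZ (@contr_linearl _)) contrM !contr_var.
  rewrite (lin_funB (@iv_linear v)) iv_varM polarC.
  by rewrite !opprK mulrN addrAC [RHS]addrC.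
Qed.

End Contraction.

(** * Degree components and finite generating lists *)

Section Grading.
Variables (R : realType) (V : lmodType R).
Implicit Types (v w : V) (x y : ext V).

(** Sequences of exterior elements form a module in which a generator multiplies and shifts by one
    place. Acting on (1, 0, 0, ...) therefore lists the components of an element by degree. *)
Definition grade_step v (F : nat -> ext V) : nat -> ext V :=
  fun d => if d is d'.+1 then clvar _ v * F d' else 0.

Lemma grade_step_module : clifford_module (@zero_form R V) grade_step.
Proof.
split; first split=> [v c F G|F c v w].
- apply/funext; case=> [|d] /=; last exact: (mul_linear _ c (F d) (G d)).
  by change (0 = c *: (0 : ext V) + 0); rewrite scaler0 addr0.
- apply/funext; case=> [|d] /=; last by rewrite linearP; exact: (mulr_linear (F d) c).
  by change (0 = c *: (0 : ext V) + 0); rewrite scaler0 addr0.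
- move=> v F; apply/funext; rewrite mulr0 scale0r.
  by case=> [|[|d]] //=; rewrite ?mulr0// mulrA ext_sq mul0r.
Qed.
Let M := grade_step_module.

Definition grade x : nat -> ext V :=
  Cl_act grade_step x (fun d => if d is 0 then 1 else 0).

Lemma gradeD x y d : grade (x + y) d = grade x d + grade y d.
Proof. by rewrite /grade (Cl_actD M). Qed.
Lemma gradeZ c x d : grade (c *: x) d = c *: grade x d.
Proof. by rewrite /grade (Cl_actZ M). Qed.
Lemma grade_linear d : linear (fun x => grade x d).
Proof. by move=> c x y; rewrite gradeD gradeZ. Qed.
Lemma grade1 d : grade 1 d = if d is 0 then 1 else 0.
Proof. by rewrite /grade (Cl_act1 M). Qed.
Lemma grade_varM0 v x : grade (clvar _ v * x) 0 = 0.
Proof. by rewrite /grade (Cl_actM M) (Cl_act_var M). Qed.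
Lemma grade_varMS v x d : grade (clvar _ v * x) d.+1 = clvar _ v * grade x d.
Proof. by rewrite /grade (Cl_actM M) (Cl_act_var M). Qed.

Lemma grade_parity x d : parity (grade x d) = grade (parity x) d.
Proof.
move: x d; apply: Cl_lind => [d|x y IHx IHy d|c x IH d|v x IH [|d]].
- by rewrite parity1 grade1; case: d => [|d]; rewrite ?parity1 // raddf0.
- by rewrite parityD !gradeD parityD IHx IHy.
- by rewrite parityZ !gradeZ parityZ IH.
- by rewrite parity_varM (lin_funN (@grade_linear _)) !grade_varM0 raddf0 oppr0.
- by rewrite parity_varM (lin_funN (@grade_linear _)) !grade_varMS parity_varM IH.
Qed.

Lemma null_module : clifford_module (@zero_form R V) (fun _ (_ : R^o) => 0 : R^o).
Proof.
by split=> [|v u]; [split=> [v|u] c x y /= | rewrite mulr0]; rewrite ?scaler0 ?addr0 ?scale0r.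
Qed.

(** The augmentation: every generator acts by 0 on the line, so what remains is the scalar part
    ([grade0E]). *)
Definition eps x : R := Cl_act (fun _ (_ : R^o) => 0 : R^o) x 1.

Lemma eps1 : eps 1 = 1.
Proof. by rewrite /eps (Cl_act1 null_module). Qed.
Lemma epsD x y : eps (x + y) = eps x + eps y.
Proof. by rewrite /eps (Cl_actD null_module). Qed.
Lemma epsZ c x : eps (c *: x) = c * eps x.
Proof. by rewrite /eps (Cl_actZ null_module). Qed.
Lemma eps_scalar : scalar eps.
Proof. by move=> c x y; rewrite epsD epsZ. Qed.
Lemma eps_varM v x : eps (clvar _ v * x) = 0.
Proof. by rewrite /eps (Cl_actM null_module) (Cl_act_var null_module). Qed.
HB.instance Definition _ := GRing.isLinear.Build R (ext V) R *%R eps eps_scalar.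

Lemma grade0E x : grade x 0 = eps x *: (1 : ext V).
Proof.
move: x; apply: Cl_lind => [|x y|c x|v x _].
- by rewrite grade1 eps1 scale1r.
- by rewrite gradeD epsD scalerDl => -> ->.
- by rewrite gradeZ epsZ -scalerA => ->.
- by rewrite grade_varM0 eps_varM scale0r.
Qed.

End Grading.

Section Span.
Variables (R : realType) (U : lmodType R).
Implicit Types (b : seq U) (x y : U).

(** Exterior algebras and their tensor products are only [lmodType]s; a generating list, possibly
    redundant, takes the place of a finite basis. *)
Definition in_span b x :=
  exists c : nat -> R, x = \sum_(i < size b) c i *: b`_i.

Lemma in_span0 b : in_span b 0.
Proof. by exists (fun=> 0); rewrite big1 // => i _; rewrite scale0r. Qed.
Lemma in_spanD b x y : in_span b x -> in_span b y -> in_span b (x + y).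
Proof.
move=> [c ->] [d ->]; exists (fun i => c i + d i); rewrite -big_split /=.
by apply: eq_bigr => i _; rewrite scalerDl.
Qed.
Lemma in_spanZ b k x : in_span b x -> in_span b (k *: x).
Proof.
move=> [c ->]; exists (fun i => k * c i); rewrite scaler_sumr.
by apply: eq_bigr => i _; rewrite scalerA.
Qed.
Lemma in_spanN b x : in_span b x -> in_span b (- x).
Proof. by move=> bx; rewrite -scaleN1r; apply: in_spanZ. Qed.
Lemma in_span_sum b (I : Type) (r : seq I) (P : pred I) (F : I -> U) :
  (forall i, P i -> in_span b (F i)) -> in_span b (\sum_(i <- r | P i) F i).
Proof.
by move=> bF; apply: (big_ind (in_span b)) => //; [exact: in_span0 | exact: in_spanD].
Qed.
Lemma in_span_mem b x : x \in b -> in_span b x.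
Proof.
move=> bx; exists (fun i => (i == index x b)%:R).
have ib : (index x b < size b)%N by rewrite index_mem.
rewrite (bigD1 (Ordinal ib)) //= eqxx scale1r nth_index // big1 ?addr0 // => i.
by rewrite -val_eqE /= => /negbTE ->; rewrite scale0r.
Qed.
Lemma in_span_trans b b' x :
  {in b, forall y, in_span b' y} -> in_span b x -> in_span b' x.
Proof.
move=> bb' [c ->]; apply: in_span_sum => i _; apply/in_spanZ/bb'.
by rewrite mem_nth.
Qed.
Lemma in_span_sub b b' x : {subset b <= b'} -> in_span b x -> in_span b' x.
Proof. by move=> bb'; apply: in_span_trans => y /bb'; exact: in_span_mem. Qed.
End Span.

Lemma in_span_lin (R : realType) (U W : lmodType R) (f : U -> W) (b : seq U)
    (b' : seq W) x : linear f -> {in b, forall y, in_span b' (f y)} ->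
  in_span b x -> in_span b' (f x).
Proof.
move=> lf bb' [c ->]; rewrite (lin_fun_sum lf); apply: in_span_sum => i _.
by rewrite (lin_funZ lf); apply/in_spanZ/bb'; rewrite mem_nth.
Qed.

(** Adjoining a vector a replaces the list b by b followed by a * b; the anticommutation relation
    keeps the span stable under the earlier vectors. The predicate P carries information indexed by
    the number of vectors used, such as a bound on the degree. *)
Lemma Cl_span (R : realType) (V : lmodType R) (Q : V -> R) (f : seq V)
    (P : nat -> Cl Q -> Prop) : P 0 1 ->
    (forall k v y, P k y -> P k.+1 y /\ P k.+1 (clvar Q v * y)) ->
  exists b : seq (Cl Q), [/\ in_span b 1,
    {in f, forall a x, in_span b x -> in_span b (clvar Q a * x)} &
    {in b, forall y, P (size f) y}].
Proof.
move=> P0 PS; elim: f => [|a f [b [b1 bM bP]]].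
  exists [:: 1]; split=> // [|y].
    by apply: in_span_mem; rewrite inE.
  by rewrite inE => /eqP ->.
set b' := b ++ [seq clvar Q a * y | y <- b].
have bb' x : in_span b x -> in_span b' x.
  by apply: in_span_sub => y yb; rewrite mem_cat yb.
have abb' x : in_span b x -> in_span b' (clvar Q a * x).
  apply: in_span_lin; first exact: mul_linear.
  by move=> y yb; apply: in_span_mem; rewrite mem_cat map_f ?orbT.
exists b'; split; first exact: bb'.
- move=> c cf x; apply: in_span_lin; first exact: mul_linear.
  move=> y; rewrite mem_cat => /orP[yb|/mapP[z zb ->]].
    move: cf; rewrite inE => /orP[/eqP ->|cf]; first exact/abb'/in_span_mem.
    by apply/bb'/(bM c cf)/in_span_mem.
  move: cf; rewrite inE => /orP[/eqP ->|cf].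
    rewrite mulrA clvar_sqr mulZl mul1r; apply/in_spanZ/bb'.
    exact: in_span_mem.
  have -> : clvar Q c * (clvar Q a * z) =
      polar Q c a *: z - clvar Q a * (clvar Q c * z).
    apply/eqP; rewrite eq_sym subr_eq !mulrA -mulrDl clvar_anticomm mulZl.
    by rewrite mul1r.
  apply: in_spanD; first by apply/in_spanZ/bb'; exact: in_span_mem.
  by apply/in_spanN/abb'/(bM c cf)/in_span_mem.
- move=> y; rewrite mem_cat => /orP[yb|/mapP[z zb ->]] /=.
    by have [] := PS _ a _ (bP y yb).
  by have [] := PS _ a _ (bP z zb).
Qed.

(** * Dual bases and the degree operator *)

Section DualBases.
Variables (R : realType) (V : vectType R) (Q : V -> R).
Hypotheses (HQ : is_qform Q) (Qnd : nondegenerate_qform Q).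
Variables (n : nat) (e e' : n.-tuple V).
Hypothesis ee' : dual_bases Q e e'.
Implicit Types (v w : V) (x y b : ext V).
Local Notation B := (polar Q).
Local Notation iv := (Defs.contraction Q).
Local Notation cv := (clvar (@zero_form R V)).

Lemma dual_expand v : v = \sum_a B v (tnth e' a) *: tnth e a.
Proof.
have := coord_basis ee'.1 (memvf v) => vE.
have cE a : coord e a v = B v (tnth e' a).
  rewrite {2}vE (polar_suml HQ) (bigD1 a) //= (polarZl HQ) -tnth_nth.
  rewrite ee'.2 eqxx mulr1 big1 ?addr0 // => i /negbTE ia.
  by rewrite (polarZl HQ) -tnth_nth ee'.2 ia mulr0.
by rewrite {1}vE; apply: eq_bigr => a _; rewrite cE -tnth_nth.
Qed.

(** The difference of the two sides is orthogonal to every e_a, hence to all of V, and nondegeneracy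
    applies. *)
Lemma dual_expand' v : v = \sum_a B v (tnth e a) *: tnth e' a.
Proof.
apply/eqP; rewrite -subr_eq0; apply/eqP/Qnd => w.
rewrite [w]dual_expand (polar_sumr HQ) big1 // => a _.
rewrite (polarZr HQ) (polarDl HQ) (polarNl HQ) (polar_suml HQ).
rewrite (bigD1 a) //= (polarZl HQ) [B (tnth e' a) _]polarC ee'.2 eqxx mulr1.
rewrite big1 ?addr0 => [|i /negbTE ia]; first by rewrite subrr mulr0.
by rewrite (polarZl HQ) [B (tnth e' i) _]polarC ee'.2 eq_sym ia mulr0.
Qed.

(** The element sum_a e_a (x) e^a of V (x) V is canonical. This is what allows S to be built from
    one fixed pair of dual bases and then used with any other. *)
Lemma dual_change (U : lmodType R) (F : V -> V -> U) (m : nat) (g g' : m.-tuple V) :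
  bilinear_fun F -> dual_bases Q g g' ->
  \sum_a F (tnth e a) (tnth e' a) = \sum_b F (tnth g b) (tnth g' b).
Proof.
move=> Fb gg'; transitivity (\sum_a \sum_b
    B (tnth e a) (tnth g' b) *: F (tnth g b) (tnth e' a)); last first.
  rewrite exchange_big; apply: eq_bigr => b _ /=.
  rewrite [in RHS](dual_expand' (tnth g' b)) (lin_fun_sum (Fb.1 _)).
  by apply: eq_bigr => a _; rewrite (lin_funZ (Fb.1 _)) polarC.
apply: eq_bigr => a _; have -> : tnth e a = \sum_b B (tnth e a) (tnth g' b) *: tnth g b.
  have := coord_basis gg'.1 (memvf (tnth e a)) => vE.
  rewrite [LHS]vE; apply: eq_bigr => c _; rewrite -tnth_nth; congr (_ *: _).
  rewrite [in RHS]vE (polar_suml HQ) (bigD1 c) //= (polarZl HQ) -tnth_nth.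
  rewrite gg'.2 eqxx mulr1 big1 ?addr0 // => i /negbTE ia.
  by rewrite (polarZl HQ) -tnth_nth gg'.2 ia mulr0.
rewrite (lin_fun_sum (Fb.2 _)); apply: eq_bigr => b _.
rewrite (lin_funZ (Fb.2 _)); congr (_ *: _).
rewrite (polar_suml HQ) (bigD1 b) //= (polarZl HQ) gg'.2 eqxx mulr1 big1 ?addr0 //.
by move=> i /negbTE ia; rewrite (polarZl HQ) gg'.2 ia mulr0.
Qed.

Lemma dual_swap (U : lmodType R) (F : V -> V -> U) : bilinear_fun F ->
  \sum_a F (tnth e a) (tnth e' a) = \sum_a F (tnth e' a) (tnth e a).
Proof.
move=> Fb; transitivity (\sum_a \sum_b
    B (tnth e a) (tnth e b) *: F (tnth e' b) (tnth e' a)).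
  apply: eq_bigr => a _; rewrite {1}[tnth e a]dual_expand' (lin_fun_sum (Fb.2 _)).
  by apply: eq_bigr => b _; rewrite (lin_funZ (Fb.2 _)).
rewrite exchange_big; apply: eq_bigr => b _ /=.
rewrite [in RHS](dual_expand' (tnth e b)) (lin_fun_sum (Fb.1 _)).
by apply: eq_bigr => a _; rewrite (lin_funZ (Fb.1 _)) polarC.
Qed.

(** The operator N of the overview; [euler_grade] shows that it multiplies the component of degree d
    by d. *)
Definition euler x := \sum_a cv (tnth e a) * iv (tnth e' a) x.

Lemma euler_linear : linear euler.
Proof.
move=> c x y; rewrite /euler scaler_sumr -big_split; apply: eq_bigr => a _ /=.
by rewrite (iv_linear HQ) mul_linear.
Qed.
Lemma euler1 : euler 1 = 0.
Proof. by rewrite /euler big1 // => a _; rewrite (iv1 HQ) mulr0. Qed.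
Lemma euler_varM v x : euler (cv v * x) = cv v * x + cv v * euler x.
Proof.
rewrite /euler mulr_sumr {2}[v]dual_expand (linear_sum (cv)) /= mulr_suml.
rewrite -big_split /=; apply: eq_bigr => a _.
rewrite (iv_varM HQ) mulrBr !mulrA [cv (tnth e a) * cv v]ext_anticomm mulNr opprK.
by rewrite mulZr linearZ /= mulZl polarC.
Qed.

Lemma euler_iv v x : euler (iv v x) = iv v (euler x) - iv v x.
Proof.
move: x; apply: Cl_lin_ext => [|||w x IH].
- by apply: linear_comp euler_linear (iv_linear HQ v).
- move=> c x y; rewrite euler_linear (iv_linear HQ) (iv_linear HQ).
  by rewrite scalerBr opprD addrACA.
- by rewrite euler1 (iv1 HQ) (lin_fun0 euler_linear) (lin_fun0 (iv_linear HQ v)) subr0.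
- rewrite euler_varM (lin_funD (iv_linear HQ v)) !(iv_varM HQ).
  rewrite (lin_funB euler_linear) (lin_funZ euler_linear) euler_varM IH.
  rewrite mulrBr [cv w * iv v x + _]addrC subrK.
  by rewrite addrAC subrr add0r.
Qed.

Lemma euler_grade x d : euler (grade x d) = d%:R *: grade x d.
Proof.
move: x d; apply: Cl_lind => [d|x y IHx IHy d|c x IH d|v x IH [|d]].
- by rewrite grade1; case: d => [|d]; rewrite ?euler1 ?scale0r // (lin_fun0 euler_linear) scaler0.
- by rewrite !gradeD (lin_funD euler_linear) IHx IHy scalerDr.
- by rewrite !gradeZ (lin_funZ euler_linear) IH !scalerA mulrC.
- by rewrite grade_varM0 (lin_fun0 euler_linear) scaler0.
- by rewrite !grade_varMS euler_varM IH mulZr -{1}[cv v * _]scale1r -scalerDl -natr1 addrC.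
Qed.

Lemma grade_euler x d : grade (euler x) d = d%:R *: grade x d.
Proof.
move: x d; apply: Cl_lind => [d|x y IHx IHy d|c x IH d|v x IH [|d]].
- rewrite euler1 (lin_fun0 (@grade_linear _ _ _)) grade1.
  by case: d => [|d]; rewrite ?scale0r ?scaler0.
- by rewrite (lin_funD euler_linear) !gradeD IHx IHy scalerDr.
- by rewrite (lin_funZ euler_linear) !gradeZ IH !scalerA mulrC.
- by rewrite euler_varM gradeD !grade_varM0 scaler0 addr0.
- by rewrite euler_varM gradeD !grade_varMS IH mulZr -{1}[cv v * _]scale1r -scalerDl -natr1 addrC.
Qed.

Lemma ext_span : exists b : seq (ext V), (forall x, in_span b x) /\
  {in b, forall y d, (n < d)%N -> grade y d = 0}.
Proof.
have [||b [b1 bM bP]] := @Cl_span R V (@zero_form R V) e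
  (fun k y => forall d, (k < d)%N -> grade y d = 0).
- by case=> // d _; rewrite grade1.
- move=> k v y Py; split=> [d /ltnW kd|[|d] kd]; first exact: Py.
    by rewrite grade_varM0.
  by rewrite grade_varMS Py ?mulr0.
exists b; split=> [|y yb d nd]; last by apply: bP => //; rewrite size_tuple.
apply: Cl_lind => // [x y|c x|v x bx]; [exact: in_spanD|exact: in_spanZ|].
rewrite [v]dual_expand linear_sum mulr_suml; apply: in_span_sum => a _ /=.
by rewrite linearZ /= mulZl; apply/in_spanZ/bM => //; exact: mem_tnth.
Qed.

Lemma grade_big x d : (n < d)%N -> grade x d = 0.
Proof.
move=> nd; have [b [bx bP]] := ext_span; have [c ->] := bx x.
rewrite (lin_fun_sum (@grade_linear _ _ d)) big1 // => i _.
by rewrite gradeZ bP ?scaler0 // mem_nth.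
Qed.

Lemma sum_grade x : \sum_(d < n.+1) grade x d = x.
Proof.
suff H k : (n < k)%N -> \sum_(d < k) grade x d = x by exact: H.
move: x k; apply: Cl_lind => [k|x y IHx IHy k nk|c x IH k nk|v x IH k].
- by case: k => // k _; rewrite big_ord_recl grade1 big1 ?addr0 // => i _; rewrite grade1.
- by under eq_bigr do rewrite gradeD; rewrite big_split /= IHx // IHy.
- by under eq_bigr do rewrite gradeZ; rewrite -scaler_sumr IH.
- move=> nk; transitivity (\sum_(d < k.+1) grade (cv v * x) d).
    by rewrite big_ord_recr /= grade_big ?addr0.
  rewrite big_ord_recl grade_varM0 add0r.
  by under eq_bigr do rewrite lift0 grade_varMS; rewrite -mulr_sumr IH.
Qed.

Lemma grade_inj x y : (forall d, grade x d = grade y d) -> x = y.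
Proof.
by move=> xy; rewrite -[x]sum_grade -[y]sum_grade; apply: eq_bigr => d _.
Qed.

End DualBases.

Section Resolvent.
Variables (R : realType) (V : vectType R) (Q : V -> R) (n : nat).
(* inverse of k + (degree operator) on the exterior algebra of an              *)
(* n-dimensional space, for k > 0                                              *)
Definition resolv (k : nat) (x : ext V) : ext V :=
  \sum_(d < n.+1) (k + d)%:R^-1 *: grade x d.

Lemma resolv_linear k : linear (resolv k).
Proof.
move=> c x y; rewrite /resolv scaler_sumr -big_split; apply: eq_bigr => a _ /=.
by rewrite gradeD gradeZ scalerDr !scalerA mulrC.
Qed.

Lemma resolv_parity k x : parity (resolv k x) = resolv k (parity x).
Proof.
rewrite /resolv raddf_sum; apply: eq_bigr => d _ /=.
by rewrite parityZ grade_parity.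
Qed.

Hypotheses (HQ : is_qform Q) (Qnd : nondegenerate_qform Q).
Variables e e' : n.-tuple V.
Hypothesis ee' : dual_bases Q e e'.

Lemma resolvK k x : (0 < k)%N ->
  k%:R *: resolv k x + euler Q e e' (resolv k x) = x.
Proof.
move=> k0; rewrite -[RHS](sum_grade HQ ee') /resolv scaler_sumr.
rewrite (lin_fun_sum (euler_linear HQ e e')) -big_split /=; apply: eq_bigr => d _.
rewrite (lin_funZ (euler_linear HQ e e')) (euler_grade HQ ee') !scalerA mulrC -scalerDl.
by rewrite -mulrDr -natrD mulVf ?scale1r // pnatr_eq0 -lt0n addn_gt0 k0.
Qed.

Lemma resolvK' k x : (0 < k)%N ->
  resolv k (k%:R *: x + euler Q e e' x) = x.
Proof.
move=> k0; rewrite -[RHS](sum_grade HQ ee') /resolv; apply: eq_bigr => d _.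
rewrite gradeD gradeZ (grade_euler HQ ee') -scalerDl scalerA -natrD.
by rewrite mulVf ?scale1r // pnatr_eq0 -lt0n addn_gt0 k0.
Qed.

End Resolvent.

(** * Quantization by antisymmetrization of words *)

Section ExtWords.
Variables (R : realType) (V : lmodType R).
Local Notation cv := (clvar (@zero_form R V)).

Lemma ext_parityE' (x : ext V) v : x * cv v = cv v * parity x.
Proof. by rewrite ext_parityE parityK. Qed.

(** Bringing u or w across m yields the same [parity m], so only the sign of exchanging u and w
    remains, whatever the degrees occurring in m. It serves to transpose two distant factors of a
    word. *)
Lemma ext_swap u w (m : ext V) : cv u * (m * cv w) = - (cv w * (m * cv u)).
Proof.
by rewrite !ext_parityE' !mulrA [cv u * cv w]ext_anticomm mulNr.
Qed.

End ExtWords.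

Lemma prod_nat_split2 (A : pzRingType) (F : nat -> A) (i j k : nat) :
  (i < j)%N -> (j < k)%N ->
  \prod_(0 <= l < k) F l = \prod_(0 <= l < i) F l *
    (F i * (\prod_(i.+1 <= l < j) F l * F j)) * \prod_(j.+1 <= l < k) F l.
Proof.
move=> ij jk; have ik := ltn_trans ij jk.
rewrite (big_cat_nat (n := i)) ?(ltnW ik) //= [X in _ * X]big_ltn //.
rewrite [\prod_(i.+1 <= _ < k) _](big_cat_nat (n := j)) ?(ltnW jk) //=.
by rewrite [\prod_(j <= _ < k) _]big_ltn // !mulrA.
Qed.

Section Quantization.
Variables (R : realType) (V : lmodType R) (Q : V -> R).
Hypothesis HQ : is_qform Q.
Local Notation cv := (clvar (@zero_form R V)).
Local Notation cq := (clvar Q).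
Local Notation iv := (Defs.contraction Q).
Implicit Types (v w : V) (x y : ext V) (a b : Cl Q).

(** These operators square to 0: the mixed terms cancel through the sign of [parity], and v * v is a
    scalar. They make Cl(V) a module over the exterior algebra, and evaluation at 1 is the
    quantization map. *)
Definition sym_mul v a : Cl Q := (2^-1 : R) *: (cq v * a + parity a * cq v).
Definition sbracket v a : Cl Q := cq v * a - parity a * cq v.

Lemma sym_mul_bilinear : bilinear_fun sym_mul.
Proof.
split=> [v c a b|a c v w]; rewrite /sym_mul.
  rewrite mul_linear parityD parityZ mulr_linear addrACA -scalerDr.
  by rewrite [LHS]scalerDr !scalerA [2^-1 * c]mulrC.
rewrite linearP mulr_linear mul_linear addrACA -scalerDr.
by rewrite [LHS]scalerDr !scalerA [2^-1 * c]mulrC.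
Qed.

Lemma sym_mul_module : clifford_module (@zero_form R V) sym_mul.
Proof.
split=> [|v a]; first exact: sym_mul_bilinear.
rewrite mulr0 scale0r /sym_mul parityZ parityD parityM [parity (_ * _)]parityM.
rewrite parityK !parity_clvar mulZr mulZl -scalerDr mulrDr mulrDl !mulrA clvar_sqr.
rewrite mulrN !mulNr -!mulrA clvar_sqr mulZl mulZr mul1r mulr1.
by rewrite [X in _ + X]addrC addrACA !subrr addr0 !scaler0.
Qed.
Let M := sym_mul_module.

Definition qmap x : Cl Q := Cl_act sym_mul x 1.

Lemma qmap_linear : linear qmap.
Proof. by move=> c x y; rewrite /qmap (Cl_actD M) (Cl_actZ M). Qed.
Lemma qmap1 : qmap 1 = 1.
Proof. exact: (Cl_act1 M). Qed.
Lemma qmap_varM v x : qmap (cv v * x) = sym_mul v (qmap x).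
Proof. by rewrite /qmap (Cl_actM M) (Cl_act_var M). Qed.

Lemma qmap_parity x : qmap (parity x) = parity (qmap x).
Proof.
move: x; apply: Cl_lin_ext => [|||v x IH].
- by apply: linear_comp qmap_linear (linear_of _).
- by apply: linear_comp (linear_of _) qmap_linear.
- by rewrite parity1 qmap1 parity1.
- rewrite parity_varM (lin_funN qmap_linear) !qmap_varM IH /sym_mul.
  rewrite parityZ parityD parity_varM parityM parity_clvar !parityK mulrN.
  by rewrite -opprD scalerN.
Qed.

(** With the normalization v w + w v = B(v, w), the graded commutator with w is the odd derivation
    taking v to B(w, v), so it matches the contraction without any numerical factor. *)
Lemma qmap_iv w x : qmap (iv w x) = sbracket w (qmap x).
Proof.
move: x; apply: Cl_lin_ext => [|||v x IH].
- by apply: linear_comp qmap_linear (iv_linear HQ w).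
- move=> c x y; rewrite qmap_linear /sbracket parityD parityZ mul_linear mulr_linear.
  by rewrite opprD addrACA scalerBr.
- by rewrite (iv1 HQ) (lin_fun0 qmap_linear) qmap1 /sbracket parity1 mulr1 mul1r subrr.
- rewrite (iv_varM HQ) (lin_funB qmap_linear) (lin_funZ qmap_linear) !qmap_varM IH.
  move: (qmap x) => a; rewrite /sbracket /sym_mul.
  rewrite parityZ mulZr mulZl -scalerBr !parityD !parityM !parity_clvar !parityN.
  rewrite parityM !parity_clvar !parityK.
  have E1 : cq w * (cq v * a) = polar Q w v *: a - cq v * (cq w * a).
    by apply/eqP; rewrite eq_sym subr_eq !mulrA -mulrDl clvar_anticomm mulZl mul1r.
  have E2 : a * cq v * cq w = polar Q w v *: a - a * cq w * cq v.
    apply/eqP; rewrite eq_sym subr_eq -!mulrA -mulrDr [cq v * _ + _]addrC.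
    by rewrite clvar_anticomm mulZr mulr1.
  rewrite !mulrDr !mulrDl !mulrN !mulNr !opprK !opprD !opprK -!mulrA.
  move: E1 E2; rewrite -!mulrA => -> ->.
  have H2 : polar Q w v *: a = 2^-1 *: (polar Q w v *: a + polar Q w v *: a).
    by rewrite Defs.half_double.
  rewrite [in LHS]H2 -scalerBr; congr (_ *: _).
  set B := polar Q w v *: a; set x1 := cq v * (cq w * a).
  set x2 := a * (cq w * cq v); set x3 := cq v * (parity a * cq w).
  set x4 := cq w * (parity a * cq v).
  by rewrite !opprD !opprK [LHS](AC (2*(2*2)) (1*3*5*(4*(2*6)))%AC).
Qed.
End Quantization.

Section QuantizationExists.
Variables (R : realType) (V : lmodType R) (Q : V -> R).
Hypothesis HQ : is_qform Q.
Local Notation cv := (clvar (@zero_form R V)).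
Local Notation cq := (clvar Q).
Local Notation iv := (Defs.contraction Q).

Lemma iv_word w (u : nat -> V) a b : (a <= b)%N ->
  iv w (\prod_(a <= l < b) cv (u l)) = \sum_(a <= m < b)
    (((-1) ^+ (m - a) * polar Q w (u m)) *:
      ((\prod_(a <= l < m) cv (u l)) * \prod_(m.+1 <= l < b) cv (u l))).
Proof.
move=> ab; rewrite -(subnK ab) addnC; move: (b - a)%N => k {ab b}.
elim: k a => [|k IH] a.
  by rewrite addn0 !big_geq // (iv1 HQ).
rewrite addnS -addSn big_ltn ?ltn_addr // (iv_varM HQ) IH.
rewrite [in RHS]big_ltn ?ltn_addr // subnn expr0 mul1r [\prod_(a <= _ < a) _]big_geq //.
rewrite mul1r mulr_sumr -sumrN; congr (_ + _).
rewrite !big_nat; apply: eq_bigr => m /andP[am _].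
rewrite mulZr mulrA -big_ltn // -scaleNr -(subnSK am).
by rewrite exprS mulN1r mulNr.
Qed.

Variables (k : nat) (v : 'I_k -> V).

(* the argument v (s l), made total in l *)
Definition perm_arg (s : 'S_k) (l : nat) : V :=
  oapp (fun i : 'I_k => v (s i)) 0 (insub l).

Lemma perm_argE (s : 'S_k) (i : 'I_k) : perm_arg s i = v (s i).
Proof. by rewrite /perm_arg -[X in insub X]/(val i) valK. Qed.

Lemma perm_arg_tperm (s : 'S_k) (i j : 'I_k) (l : nat) : l != i -> l != j ->
  perm_arg (tperm i j * s)%g l = perm_arg s l.
Proof.
rewrite /perm_arg; case: (ltnP l k) => [lk li lj|kl _ _].
  by rewrite (insubT (fun l => l < k)%N lk) /= permM tpermD // -val_eqE eq_sym.
by rewrite insubN // -leqNgt.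
Qed.

Lemma ext_perm_word (s : 'S_k) :
  \prod_(i < k) cv (v (s i)) = ((-1) ^+ s : R) *: \prod_(i < k) cv (v i).
Proof.
have [ts -> dts] := prod_tpermP s.
elim: ts dts => [|[i j] ts IH] /=.
  rewrite big_nil odd_perm1 expr0 scale1r => _.
  by apply: eq_bigr => i _; rewrite perm1.
rewrite /dpair /= => /andP[ij /IH {}IH]; rewrite big_cons /=.
rewrite odd_mul_tperm ij signr_addb expr1 mulN1r scaleNr -IH {IH}.
move: (\prod_(_ <- _) _)%g => {}s.
wlog lij : i j ij / (i < j)%N => [H|].
  have /orP[lij|lij] : (i < j)%N || (j < i)%N by rewrite -neq_ltn.
    exact: H.
  by rewrite tpermC; apply: H; rewrite // eq_sym.
have E (r : 'S_k) : \prod_(l < k) cv (v (r l)) = \prod_(0 <= l < k) cv (perm_arg r l).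
  by rewrite big_mkord; apply: eq_bigr => l _; rewrite perm_argE.
rewrite !E !(prod_nat_split2 _ lij (ltn_ord j)) !perm_argE.
rewrite !permM tpermL tpermR ext_swap mulrN mulNr; congr (- (_ * (_ * (_ * _)) * _)).
- rewrite !big_nat; apply: eq_bigr => l /andP[_ li].
  by congr (cv _); apply: perm_arg_tperm; rewrite neq_ltn ?li ?(ltn_trans li lij).
- rewrite !big_nat; apply: eq_bigr => l /andP[il lj].
  by congr (cv _); apply: perm_arg_tperm; rewrite neq_ltn ?il ?lj ?orbT.
- rewrite !big_nat; apply: eq_bigr => l /andP[jl lk].
  by congr (cv _); apply: perm_arg_tperm; rewrite neq_ltn ?jl ?(ltn_trans lij jl) ?orbT.
Qed.

(** Interpolates between the two sides of [qmap_word]: the first j factors are already multiplied in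
    Cl(V), the others are still wedged and then quantized. *)
Let partial (j : nat) (s : 'S_k) : Cl Q :=
  \prod_(0 <= l < j) cq (perm_arg s l) * qmap Q (\prod_(j <= l < k) cv (perm_arg s l)).

(** Releasing the factor at position j changes a term by half a contraction of that factor with the
    later ones. The piece pairing positions j and m is invariant under their exchange, so the
    alternating sum over permutations kills it. *)
Lemma sum_partialS (j : nat) : (j < k)%N ->
  \sum_(s : 'S_k) ((-1) ^+ s : R) *: partial j s =
  \sum_(s : 'S_k) ((-1) ^+ s : R) *: partial j.+1 s.
Proof.
move=> jk; apply/eqP; rewrite -subr_eq0 -sumrB; apply/eqP.
pose F (m : nat) (s : 'S_k) : Cl Q := \prod_(0 <= l < j) cq (perm_arg s l) *
  (polar Q (perm_arg s j) (perm_arg s m) *: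
   qmap Q ((\prod_(j.+1 <= l < m) cv (perm_arg s l)) *
           \prod_(m.+1 <= l < k) cv (perm_arg s l))).
transitivity (\sum_(s : 'S_k) \sum_(j.+1 <= m < k)
    (- 2^-1 * (-1) ^+ (m - j.+1)) *: (((-1) ^+ s : R) *: F m s)).
  apply: eq_bigr => s _; rewrite -scalerBr.
  have -> : partial j s - partial j.+1 s = - (2^-1 *:
      (\prod_(0 <= l < j) cq (perm_arg s l) *
       qmap Q (iv (perm_arg s j) (\prod_(j.+1 <= l < k) cv (perm_arg s l))))).
    rewrite /partial [\prod_(j <= _ < k) _]big_ltn // qmap_varM.
    rewrite big_nat_recr //= -[X in _ - X]mulrA -mulrBr -[in RHS]mulZr -[in RHS]mulrN; congr (_ * _).
    rewrite (qmap_iv HQ) /sym_mul /sbracket.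
    move: (qmap Q _) => a; rewrite scalerBr opprB scalerDr.
    rewrite -[X in _ - X](Defs.half_double (cq _ * _)) scalerDr opprD.
    by rewrite [LHS]addrAC addrA subrr add0r addrC.
  rewrite iv_word // (lin_fun_sum (qmap_linear Q)) mulr_sumr.
  rewrite scaler_sumr -sumrN scaler_sumr; apply: eq_bigr => m _.
  rewrite (lin_funZ (qmap_linear Q)) /F !mulZr !scalerN !scalerA -scaleNr.
  congr (_ *: _); move: (polar Q _ _) ((-1) ^+ s) ((-1) ^+ (m - j.+1)) => p q r.
  by rewrite !mulNr [q / 2]mulrC -!mulrA [q * (r * p)]mulrCA.
rewrite exchange_big /= big_nat big1 // => m /andP[jm mk].
rewrite -scaler_sumr; suff -> : \sum_(s : 'S_k) ((-1) ^+ s : R) *: F m s = 0 by rewrite scaler0.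
pose i1 := Ordinal jk; pose i2 := Ordinal mk.
have i12 : i1 != i2 by rewrite -val_eqE /= neq_ltn jm.
set X := \sum_(s : 'S_k) _; have XN : X = - X.
  rewrite {1}/X (reindex_inj (mulgI (tperm i1 i2))) /= -sumrN; apply: eq_bigr => s _.
  rewrite odd_mul_tperm i12 signr_addb expr1 mulN1r scaleNr; congr (- (_ *: _)).
  have Ej : perm_arg (tperm i1 i2 * s)%g j = perm_arg s m.
    by rewrite -[j]/(val i1) perm_argE permM tpermL -[m]/(val i2) perm_argE.
  have Em : perm_arg (tperm i1 i2 * s)%g m = perm_arg s j.
    by rewrite -[m]/(val i2) perm_argE permM tpermR -[j]/(val i1) perm_argE.
  have El (l : nat) : l != j -> l != m -> perm_arg (tperm i1 i2 * s)%g l = perm_arg s l.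
    exact: (perm_arg_tperm s (i := i1) (j := i2)).
  rewrite /F Ej Em polarC; congr (_ * (_ *: qmap Q (_ * _))).
  - by rewrite !big_nat; apply: eq_bigr => l /andP[_ lj]; congr (clvar _ _); apply: El; rewrite neq_ltn ?lj ?(ltn_trans lj jm).
  - rewrite !big_nat; apply: eq_bigr => l /andP[jl lm].
    by congr (clvar _ _); apply: El; rewrite neq_ltn ?jl ?lm ?orbT.
  - rewrite !big_nat; apply: eq_bigr => l /andP[ml lk].
    by congr (clvar _ _); apply: El; rewrite neq_ltn ?ml ?(ltn_trans jm ml) ?orbT.
by rewrite -[X]Defs.half_double {2}XN subrr scaler0.
Qed.

Lemma qmap_word : qmap Q (\prod_(i < k) cv (v i)) =
  (k`!%:R^-1 : R) *: \sum_(s : 'S_k) ((-1) ^+ s : R) *: \prod_(i < k) cq (v (s i)).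
Proof.
have k0 : k`!%:R != 0 :> R by rewrite pnatr_eq0 -lt0n fact_gt0.
apply: (scalerI k0); rewrite scalerA mulfV // scale1r.
have H j : (j <= k)%N -> \sum_(s : 'S_k) ((-1) ^+ s : R) *: partial 0 s =
    \sum_(s : 'S_k) ((-1) ^+ s : R) *: partial j s.
  by elim: j => // j IH jk; rewrite -sum_partialS // IH // ltnW.
transitivity (\sum_(s : 'S_k) ((-1) ^+ s : R) *: partial 0 s); last first.
  rewrite (H k) //; apply: eq_bigr => s _; congr (_ *: _).
  rewrite /partial [\prod_(k <= _ < k) _]big_geq // qmap1 mulr1 big_mkord.
  by apply: eq_bigr => i _; rewrite perm_argE.
rewrite -card_Sn -sumr_const scaler_suml.
apply: eq_bigr => s _; rewrite /partial big_geq // mul1r scale1r.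
rewrite big_mkord; under [in RHS]eq_bigr => i _ do rewrite perm_argE.
by rewrite ext_perm_word (lin_funZ (qmap_linear Q)) scalerA -signr_addb addbb scale1r.
Qed.

End QuantizationExists.

Section Quant.
Variables (R : realType) (V : lmodType R) (Q : V -> R).
Hypothesis HQ : is_qform Q.
Local Notation cv := (clvar (@zero_form R V)).

Lemma ext_words (x : ext V) : exists ws : seq (R * seq V),
  x = \sum_(w <- ws) w.1 *: \prod_(i < size w.2) cv (w.2`_i).
Proof.
move: x; apply: Cl_lind => [|x y [ws ->] [ws' ->]|c x [ws ->]|v x [ws ->]].
- by exists [:: (1, [::])]; rewrite big_seq1 /= big_ord0 scale1r.
- by exists (ws ++ ws'); rewrite big_cat.
- exists [seq (c * w.1, w.2) | w <- ws]; rewrite big_map scaler_sumr.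
  by apply: eq_bigr => w _; rewrite scalerA.
- exists [seq (w.1, v :: w.2) | w <- ws]; rewrite big_map mulr_sumr.
  apply: eq_bigr => w _ /=; rewrite mulZr big_ord_recl /=.
  by congr (_ *: _); apply: congr1; apply: eq_bigr.
Qed.

(** Words span the exterior algebra, so the values prescribed on them leave [xget] a single
    choice. *)
Lemma quantE : quant Q = qmap Q.
Proof.
have qP : is_quantization (qmap Q).
  by split; [exact: qmap_linear | exact: qmap_word].
rewrite /quant; case: xgetP => [g -> [gl gw]|/(_ _ qP) //].
apply/funext => x; have [ws ->] := ext_words x.
rewrite (lin_fun_sum gl) (lin_fun_sum qP.1); apply: eq_bigr => w _.
by rewrite (lin_funZ gl) (lin_funZ qP.1) gw qP.2.
Qed.
End Quant.

(** * The bivector lambda(A) under contraction and quantization *)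

Section Lambda.
Variables (R : realType) (V : vectType R) (Q : V -> R).
Hypotheses (HQ : is_qform Q) (Qnd : nondegenerate_qform Q).
Variables (n : nat) (e e' : n.-tuple V).
Hypothesis ee' : dual_bases Q e e'.
Variable A : 'End(V).
Hypothesis oA : orthogonal_lie Q A.
Implicit Types (v w : V) (x y b S : ext V).
Local Notation B := (polar Q).
Local Notation iv := (Defs.contraction Q).
Local Notation cv := (clvar (@zero_form R V)).
Local Notation lam := (lambda e e' A).

Lemma orth_skew v w : B (A v) w = - B v (A w).
Proof. by apply/eqP; rewrite -addr_eq0; apply/eqP; exact: oA. Qed.

Lemma dual_skew (U : lmodType R) (F : V -> V -> U) : bilinear_fun F ->
  \sum_a F (A (tnth e a)) (tnth e' a) = - \sum_a F (tnth e a) (A (tnth e' a)).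
Proof.
move=> Fb; transitivity (\sum_a \sum_b
    B (A (tnth e a)) (tnth e' b) *: F (tnth e b) (tnth e' a)).
  apply: eq_bigr => a _; rewrite {1}[A _](dual_expand HQ ee') (lin_fun_sum (Fb.2 _)).
  by apply: eq_bigr => b _; rewrite (lin_funZ (Fb.2 _)).
rewrite exchange_big -sumrN; apply: eq_bigr => b _ /=.
rewrite [in RHS](dual_expand' HQ Qnd ee' (A _)) (lin_fun_sum (Fb.1 _)) -sumrN.
apply: eq_bigr => a _; rewrite (lin_funZ (Fb.1 _)) -scaleNr.
by rewrite [B (A (tnth e' b)) _]orth_skew opprK polarC.
Qed.

Lemma lambda_parity : parity lam = lam.
Proof.
rewrite /lambda parityZ raddf_sum; congr (_ *: _); apply: eq_bigr => a _ /=.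
by rewrite parityM !parity_clvar mulrNN.
Qed.

Lemma lambdaC v : cv v * lam = lam * cv v.
Proof.
rewrite /lambda mulZr mulZl mulr_sumr mulr_suml; congr (_ *: _).
apply: eq_bigr => a _; rewrite mulrA [cv v * cv _]ext_anticomm mulNr -mulrA.
by rewrite -mulrA [cv v * cv _]ext_anticomm mulrN opprK.
Qed.

Lemma contr_lambdaE x :
  contr Q lam x = 2^-1 *: \sum_a iv (A (tnth e a)) (iv (tnth e' a) x).
Proof.
rewrite /lambda (lin_funZ (contr_linearl HQ _)) (lin_fun_sum (contr_linearl HQ _)).
by congr (_ *: _); apply: eq_bigr => a _; rewrite (contrM HQ) !(contr_var HQ).
Qed.

Lemma iv_lambda v : iv v lam = - cv (A v).
Proof.
rewrite /lambda (lin_funZ (iv_linear HQ v)) (lin_fun_sum (iv_linear HQ v)).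
transitivity ((2^-1 : R) *: (- cv (A v) - cv (A v))); last first.
  by rewrite Defs.half_double.
congr (_ *: _); under eq_bigr => a _ do
  rewrite (iv_varM HQ) (iv_var HQ) mulZr mulr1.
rewrite sumrB; congr (_ - _).
  rewrite [in RHS](dual_expand' HQ Qnd ee' (A v)) linear_sum -sumrN.
  by apply: eq_bigr => a _ /=; rewrite linearZ -scaleNr /= orth_skew opprK.
rewrite [in RHS](dual_expand HQ ee' v) !linear_sum /=.
by apply: eq_bigr => a _; rewrite !linearZ.
Qed.

Lemma iv_lambdaM v x : iv v (lam * x) = lam * iv v x - cv (A v) * x.
Proof. by rewrite (ivM HQ) lambda_parity iv_lambda mulNr addrC. Qed.

Lemma contr_lambda_varM v x :
  contr Q lam (cv v * x) = cv v * contr Q lam x + iv (A v) x.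
Proof.
rewrite (contr_mul_var HQ) lambda_parity iv_lambda.
by rewrite (lin_funN (contr_linearl HQ _)) (contr_var HQ) opprK.
Qed.

Lemma contr_lambda_iv v x : contr Q lam (iv v x) = iv v (contr Q lam x).
Proof.
rewrite -!(contr_var HQ v) -!(contrM HQ); congr contr.
by rewrite lambdaC.
Qed.

(** A Leibniz rule of second order: commuting iota_S past the two factors of a bivector contracts S
    zero, one or two times. The two families with one contraction agree because A is skew, which
    absorbs the factor 1/2 in [lambda]. *)
Lemma lambda_contr S x : parity S = S ->
  lam * contr Q S x = contr Q S (lam * x) + contr Q (contr Q lam S) x
    - \sum_a contr Q (iv (tnth e' a) S) (cv (A (tnth e a)) * x).
Proof.
move=> pS.
have pT w : parity (iv w S) = - iv w S.
  by apply/eqP; rewrite -eqr_oppLR -(iv_parity HQ) pS.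
have E u w : contr Q S (cv u * (cv w * x)) = cv u * (cv w * contr Q S x) +
    contr Q (iv w S) (cv u * x) - contr Q (iv u (iv w S)) x
    - contr Q (iv u S) (cv w * x).
  rewrite !(contr_mul_var HQ) !pS !pT mulrBr !(lin_funN (iv_linear HQ _)).
  rewrite !(lin_funN (contr_linearl HQ _)) !mulrN !opprK.
  by rewrite [X in _ = X - _ - _]addrA addrK.
have Fb : bilinear_fun (fun u w => contr Q (iv u S) (cv w * x)).
  split=> [u|w] c y z; first by rewrite linearP mulr_linear (contr_linear HQ).
  by rewrite ((iv_bilinear HQ).2 S) (contr_linearl HQ).
have Fb' : bilinear_fun (fun u w => contr Q (iv u S) (cv (A w) * x)).
  split=> [u|w] c y z; first by rewrite !linearP mulr_linear (contr_linear HQ).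
  by rewrite ((iv_bilinear HQ).2 S) (contr_linearl HQ).
have sk : \sum_a contr Q (iv (A (tnth e a)) S) (cv (tnth e' a) * x) =
    - \sum_a contr Q (iv (tnth e' a) S) (cv (A (tnth e a)) * x).
  by rewrite (dual_skew Fb) (dual_swap HQ Qnd ee' Fb').
set T := \sum_a contr Q (iv (tnth e' a) S) (cv (A (tnth e a)) * x) in sk *.
rewrite contr_lambdaE (lin_funZ (contr_linearl HQ _)) (lin_fun_sum (contr_linearl HQ _)).
rewrite {1 2}/lambda !mulZl (lin_funZ (contr_linear HQ _)) !mulr_suml.
rewrite (lin_fun_sum (contr_linear HQ _)).
rewrite -[T]Defs.half_double -scalerDr -scalerBr; congr (_ *: _).
have -> : \sum_a contr Q S (cv (A (tnth e a)) * cv (tnth e' a) * x) =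
    \sum_a cv (A (tnth e a)) * cv (tnth e' a) * contr Q S x + T -
    \sum_a contr Q (iv (A (tnth e a)) (iv (tnth e' a) S)) x -
    \sum_a contr Q (iv (A (tnth e a)) S) (cv (tnth e' a) * x).
  rewrite -big_split /= -!sumrB; apply: eq_bigr => a _.
  by rewrite -!mulrA E.
by rewrite sk opprK [_ - _ + T]addrAC subrK -[_ + T + T]addrA addrK.
Qed.

End Lambda.

Section QuantLambda.
Variables (R : realType) (V : lmodType R) (Q : V -> R).
Hypothesis HQ : is_qform Q.
Local Notation cv := (clvar (@zero_form R V)).
Local Notation cq := (clvar Q).
Local Notation iv := (Defs.contraction Q).

(** Left multiplication by v is [sym_mul v] plus half of [sbracket v], and right multiplication
    twisted by parity is the same with a minus sign. In the half sum for v ^ w the terms with one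
    bracket cancel; the term with two brackets keeps the factor 1/4. *)
Lemma qmap_bivector v w (x : ext V) :
  qmap Q (cv v * (cv w * x) + 4^-1 *: iv v (iv w x)) =
  2^-1 *: (qmap Q (cv v * cv w) * qmap Q x + qmap Q x * qmap Q (cv v * cv w)).
Proof.
rewrite (lin_funD (qmap_linear Q)) (lin_funZ (qmap_linear Q)) !(qmap_iv HQ).
rewrite -[cv w in X in _ = X]mulr1 !qmap_varM qmap1.
move: (qmap Q x) => a; rewrite /sym_mul /sbracket parity1 mulr1 mul1r.
rewrite Defs.half_double parity_clvar mulNr.
rewrite !parityZ !parityB !parityD !parityM !parityK !parity_clvar.
rewrite !mulZl !mulZr -!scalerDr !scalerA.
have -> : (4^-1 : R) = 2^-1 * 2^-1 by field.
rewrite -[in LHS]scalerDr; congr (_ *: _).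
have E1 : cq w * (cq v * a) = polar Q w v *: a - cq v * (cq w * a).
  by apply/eqP; rewrite eq_sym subr_eq !mulrA -mulrDl clvar_anticomm mulZl mul1r.
have E2 : a * (cq v * cq w) = polar Q w v *: a - a * (cq w * cq v).
  apply/eqP; rewrite eq_sym subr_eq -mulrDr [cq v * _ + _]addrC.
  by rewrite clvar_anticomm mulZr mulr1.
rewrite !scaleN1r !mulNr !mulrBr !mulrDr !mulrDl !mulNr -!mulrA E1 E2.
set c := polar Q w v *: a; set x1 := cq v * (cq w * a).
set x2 := a * (cq w * cq v); set x3 := cq v * (parity a * cq w).
set x4 := cq w * (parity a * cq v).
rewrite !opprD !opprK [LHS](AC ((2*2)*(2*2)) ((1*5*(4*8))*(2*6)*(7*3))%AC) /=.
by rewrite [RHS](AC ((1*2)*3) ((1*3*(5*6))*(4*2))%AC) /= !subrr !addr0.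
Qed.

Lemma qmap_contr_parity (x : ext V) v :
  qmap Q (cv v * parity x) = 2^-1 *: (cq v * parity (qmap Q x) + qmap Q x * cq v).
Proof. by rewrite qmap_varM (qmap_parity Q) /sym_mul parityK. Qed.

End QuantLambda.

Section QuantLambda2.
Variables (R : realType) (V : vectType R) (Q : V -> R).
Hypothesis HQ : is_qform Q.
Variables (n : nat) (e e' : n.-tuple V) (A : 'End(V)).

Lemma qmap_lambda (x : ext V) :
  qmap Q (lambda e e' A * x + 4^-1 *: contr Q (lambda e e' A) x) =
  2^-1 *: (qmap Q (lambda e e' A) * qmap Q x + qmap Q x * qmap Q (lambda e e' A)).
Proof.
rewrite (contr_lambdaE HQ) {1 2 3}/lambda.
rewrite (lin_funZ (qmap_linear Q)) !mulZl !mulZr scalerA [4^-1 * _]mulrC -scalerA -!scalerDr.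
rewrite (lin_funZ (qmap_linear Q)); congr (_ *: _).
rewrite mulr_suml scaler_sumr -big_split (lin_fun_sum (qmap_linear Q)).
rewrite (lin_fun_sum (qmap_linear Q)) mulr_suml mulr_sumr -big_split scaler_sumr.
by apply: eq_bigr => a _ /=; rewrite -mulrA (qmap_bivector HQ).
Qed.

Lemma qmap_lambda_parity : parity (qmap Q (lambda e e' A)) = qmap Q (lambda e e' A).
Proof. by rewrite -qmap_parity lambda_parity. Qed.

End QuantLambda2.

(** * Maps on tensor products and graded multiplication *)

Section Tensor.
Variables (R : realType) (M M' N U : lmodType R).

Lemma tensor_lin_ext (f g : tensor M N -> U) : linear f -> linear g ->
  (forall m n, f (pure m n) = g (pure m n)) -> f =1 g.
Proof.
move=> lf lg fg; apply: tensor_ind => // [x y|c x].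
  by rewrite (lin_funD lf) (lin_funD lg) => -> ->.
by rewrite (lin_funZ lf) (lin_funZ lg) => ->.
Qed.

Lemma pureDl (m m' : M) (n : N) : pure (m + m') n = pure m n + pure m' n.
Proof. exact: (bilinear_funDl (pure_bilinear M N)). Qed.
Lemma pureDr (m : M) (n n' : N) : pure m (n + n') = pure m n + pure m n'.
Proof. exact: (bilinear_funDr (pure_bilinear M N)). Qed.
Lemma pureZl c (m : M) (n : N) : pure (c *: m) n = c *: pure m n.
Proof. exact: (bilinear_funZl (pure_bilinear M N)). Qed.
Lemma pureZr c (m : M) (n : N) : pure m (c *: n) = c *: pure m n.
Proof. exact: (bilinear_funZr (pure_bilinear M N)). Qed.
Lemma pure0l (n : N) : pure (0 : M) n = 0.
Proof. exact: (bilinear_fun0l (pure_bilinear M N)). Qed.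
Lemma pure_linearl (n : N) : linear (fun m : M => pure m n).
Proof. exact: (pure_bilinear M N).2. Qed.
Lemma pure_linearr (m : M) : linear (fun n : N => pure m n).
Proof. exact: (pure_bilinear M N).1. Qed.

Lemma comp_pure_bilinear (N' : lmodType R) (f : M -> M') (g : N -> N') :
  linear f -> linear g -> bilinear_fun (fun m n => pure (f m) (g n)).
Proof.
move=> lf lg; split=> [m|n] c x y.
  by rewrite lg (pure_bilinear _ _).1.
by rewrite lf ((pure_bilinear _ _).2 (g n)).
Qed.

Definition tmap2 (N' : lmodType R) (f : M -> M') (g : N -> N') :
  tensor M N -> tensor M' N' := plift (fun m n => pure (f m) (g n)).

Section Map.
Variables (N' : lmodType R) (f : M -> M') (g : N -> N').
Hypotheses (lf : linear f) (lg : linear g).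
Lemma tmap2_linear : linear (tmap2 f g).
Proof. exact/plift_linear/comp_pure_bilinear. Qed.
Lemma tmap2_pure m n : tmap2 f g (pure m n) = pure (f m) (g n).
Proof. exact/plift_pure/comp_pure_bilinear. Qed.
End Map.

Variable f : M -> M'.
Hypothesis lf : linear f.
Let lid : linear (@id N). Proof. by []. Qed.
Lemma tmap1_linear : linear (tmap1 f : tensor M N -> tensor M' N).
Proof. exact: (tmap2_linear lf lid). Qed.
Lemma tmap1_pure m (n : N) : tmap1 f (pure m n) = pure (f m) n.
Proof. exact: (tmap2_pure lf lid). Qed.

End Tensor.

Section GTensor.
Variables (R : realType) (V E : lmodType R) (Q : V -> R).
Local Notation cE := (clvar (@zero_form R E)).
Local Notation cq := (clvar Q).
Local Notation T := (gtensor Q (@zero_form R E)).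
Implicit Types (a : Cl Q) (b : ext E) (x y : T).

Lemma gtensor_mulZl c x y : (c *: x) * y = c *: (x * y).
Proof. exact: gmulZl. Qed.
Lemma gtensor_mulZr c x y : x * (c *: y) = c *: (x * y).
Proof. exact: gmulZr. Qed.
Lemma gtensor_mul_linear x : linear (fun y => x * y).
Proof. by move=> c y z; rewrite mulrDr gtensor_mulZr. Qed.
Lemma gtensor_mulr_linear y : linear (fun x => x * y).
Proof. by move=> c x z; rewrite mulrDl gtensor_mulZl. Qed.

Lemma cE_parts w : ClEven (cE w) = 0 /\ ClOdd (cE w) = cE w.
Proof. by apply: ClOdd_id; rewrite parity_clvar. Qed.

Lemma pure0r a : pure a (0 : ext E) = 0 :> T.
Proof. exact: (bilinear_fun0r (pure_bilinear _ _)). Qed.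

Lemma gtl_mul_pure a a' b : gtl _ a * pure a' b = pure (a * a') b :> T.
Proof.
have -> : gtl _ a * pure a' b = gmul_pure a 1 a' b :> T by exact: gmulE.
rewrite /gmul_pure; have [-> ->] := ClEven_id (@parity1 R E (@zero_form R E)).
by rewrite mul1r mul0r pure0r addr0.
Qed.

Lemma pure_mul_gtl a a' b : parity a' = a' ->
  (pure a b : T) * gtl _ a' = pure (a * a') b.
Proof.
move=> pa; have -> : (pure a b : T) * gtl _ a' = gmul_pure a b a' 1 by exact: gmulE.
by rewrite /gmul_pure pa -pureDr !mulr1 ClEvenDOdd.
Qed.

Lemma gtl_gtr v w : gtl _ (cq v) * gtr _ (cE w) = pure (cq v) (cE w) :> T.
Proof. by rewrite gtl_mul_pure mulr1. Qed.

Lemma pure_var_mul v w a b :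
  (pure (cq v) (cE w) : T) * pure a b = pure (cq v * parity a) (cE w * b).
Proof.
have -> : (pure (cq v) (cE w) : T) * pure a b = gmul_pure (cq v) (cE w) a b.
  exact: gmulE.
rewrite /gmul_pure; have [-> ->] := cE_parts w.
by rewrite mul0r pure0r add0r.
Qed.

(** The sign created by passing v across b is undone by moving w across b, which is why w ends up to
    the left of b and no sign is left. *)
Lemma mul_pure_var v w a b :
  (pure a b : T) * pure (cq v) (cE w) = pure (a * cq v) (cE w * b).
Proof.
have -> : (pure a b : T) * pure (cq v) (cE w) = gmul_pure a b (cq v) (cE w).
  exact: gmulE.
rewrite /gmul_pure parity_clvar mulrN -scaleN1r pureZl -pureZr -pureDr scaleN1r.
rewrite -mulNr -mulrDl; have -> : ClEven b - ClOdd b = parity b.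
  by rewrite -[in RHS](ClEvenDOdd b) parityD parity_ClEven parity_ClOdd.
by rewrite -ext_parityE.
Qed.

End GTensor.

(** * The exponential identity, degree by degree *)

Section Exponent.
Variables (R : realType) (V : vectType R) (Q : V -> R).
Hypotheses (HQ : is_qform Q) (Qnd : nondegenerate_qform Q).
Variables (n : nat) (e e' : n.-tuple V).
Hypothesis ee' : dual_bases Q e e'.
Variable A : 'End(V).
Hypothesis oA : orthogonal_lie Q A.
Variables (E : lmodType R) (phi : {linear V -> E}).
Implicit Types (v w : V) (S a : ext V) (b : ext E).
Local Notation B := (polar Q).
Local Notation iv := (Defs.contraction Q).
Local Notation cv := (clvar (@zero_form R V)).
Local Notation cE := (clvar (@zero_form R E)).
Local Notation lam := (lambda e e' A).
Local Notation T0 := (gtensor (@zero_form R V) (@zero_form R E)).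
Local Notation TQ := (gtensor Q (@zero_form R E)).

Definition expo (Q0 : V -> R) (g : Cl Q0) : gtensor Q0 (@zero_form R E) :=
  gtl _ g - ephi e e' Q0 phi.

Lemma expo_mul_pure (Q0 : V -> R) (g x : Cl Q0) b : expo g * pure x b =
  pure (g * x) b - \sum_c
    pure (clvar Q0 (tnth e c) * parity x) (cE (phi (tnth e' c)) * b)
  :> gtensor Q0 (@zero_form R E).
Proof.
rewrite /expo mulrBl gtl_mul_pure /ephi mulr_suml; congr (_ - _).
by apply: eq_bigr => c _; rewrite gtl_gtr pure_var_mul.
Qed.

Lemma pure_mul_expo (g x : Cl Q) b : parity g = g -> (pure x b : TQ) * expo g =
  pure (x * g) b - \sum_c pure (x * clvar Q (tnth e c)) (cE (phi (tnth e' c)) * b).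
Proof.
move=> pg; rewrite /expo mulrBr pure_mul_gtl // /ephi mulr_sumr; congr (_ - _).
by apply: eq_bigr => c _; rewrite gtl_gtr mul_pure_var.
Qed.

Local Notation m := (expo lam).

(** The operator carried by q to half the sum of left and right multiplication by q(m). The terms
    e_a phi^a add no contraction: the half sum of the two multiplications by them is already
    [sym_mul]. *)
Definition step (y : T0) : T0 := m * y + 4^-1 *: tmap1 (contr Q lam) y.

Lemma step_linear : linear step.
Proof.
move=> c x y; rewrite /step gtensor_mul_linear (tmap1_linear (contr_linear HQ lam)).
by rewrite [4^-1 *: _]scalerDr !scalerA [4^-1 * c]mulrC -scalerA addrACA -scalerDr.
Qed.

Lemma tmap1_qmap_step (y : T0) : tmap1 (qmap Q) (step y) =
  2^-1 *: (expo (qmap Q lam) * (tmap1 (qmap Q) y : TQ) +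
           (tmap1 (qmap Q) y : TQ) * expo (qmap Q lam)).
Proof.
have ql := qmap_linear Q; have tql := @tmap1_linear _ _ _ (ext E) _ ql.
move: y; apply: tensor_lin_ext.
- exact: linear_comp step_linear.
- apply/linear_scalef/linear_addf.
    by apply: linear_comp (gtensor_mul_linear _) tql.
  by apply: linear_comp (gtensor_mulr_linear _) tql.
move=> a b; rewrite /step expo_mul_pure !(tmap1_pure (contr_linear HQ _)).
rewrite !(tmap1_pure ql) expo_mul_pure (pure_mul_expo _ _ (qmap_lambda_parity _ _ _ _)).
rewrite [X in _ = _ *: X]addrACA -opprD -[X in _ *: (X - _)]pureDl -big_split /=.
rewrite [RHS]scalerBr -[X in _ = X - _]pureZl -(qmap_lambda HQ).
rewrite addrAC (lin_funB tql) -pureZl -pureDl (tmap1_pure ql); congr (_ - _).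
rewrite (lin_fun_sum tql) scaler_sumr; apply: eq_bigr => c _.
by rewrite (tmap1_pure ql) -pureDl -pureZl qmap_contr_parity.
Qed.

(* minus the contraction of the exponent by v, as an operator *)
Definition cop v (y : T0) : T0 :=
  tmap1 (fun x => cv (A v) * x) y + tmap2 (@parity _ _ _) (fun b => cE (phi v) * b) y.

Let lparity : linear (@parity R V (@zero_form R V)). Proof. exact: linear_of. Qed.
Let lmul x : linear (fun y : ext V => x * y). Proof. exact: mul_linear. Qed.
Let lmulE x : linear (fun y : ext E => x * y). Proof. exact: mul_linear. Qed.

Lemma cop_linear v : linear (cop v).
Proof.
move=> c x y; rewrite /cop (tmap1_linear (lmul _)) (tmap2_linear lparity (lmulE _)).
by rewrite addrACA -scalerDr.
Qed.

Lemma cop_pure v a b : cop v (pure a b) =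
  pure (cv (A v) * a) b + pure (parity a) (cE (phi v) * b).
Proof. by rewrite /cop (tmap1_pure (lmul _)) (tmap2_pure lparity (lmulE _)). Qed.

Lemma cop_expo v (y : T0) : cop v (m * y) = m * cop v y.
Proof.
move: y; apply: tensor_lin_ext.
- by apply: linear_comp (cop_linear v) (gtensor_mul_linear _).
- by apply: linear_comp (gtensor_mul_linear _) (cop_linear v).
move=> a b; rewrite cop_pure mulrDr !expo_mul_pure.
rewrite (lin_funB (cop_linear v)) (lin_fun_sum (cop_linear v)) cop_pure.
under eq_bigr do rewrite cop_pure.
rewrite big_split /= opprD addrACA; congr (_ - _ + (_ - _)).
- by rewrite !mulrA lambdaC.
- apply: eq_bigr => c _; rewrite parity_varM mulrN !mulrA.
  by rewrite ext_anticomm mulNr.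
- by rewrite parityM lambda_parity.
- apply: eq_bigr => c _; rewrite parity_varM !mulrA ext_anticomm mulNr.
  by rewrite -scaleN1r pureZl -pureZr scaleN1r opprK parityK.
Qed.

Lemma iv_expo v (y : T0) :
  tmap1 (iv v) (m * y) = m * tmap1 (iv v) y - cop v y.
Proof.
have il := iv_linear HQ v; have til := @tmap1_linear _ _ _ (ext E) _ il.
move: y; apply: tensor_lin_ext.
- by apply: linear_comp til (gtensor_mul_linear _).
- move=> c x y; rewrite til gtensor_mul_linear (cop_linear v) opprD addrACA.
  by rewrite scalerBr.
move=> a b; rewrite (tmap1_pure il) !expo_mul_pure cop_pure.
rewrite (lin_funB til) (tmap1_pure il) (iv_lambdaM HQ Qnd ee' oA).
rewrite opprD addrACA -(lin_funB (pure_linearl b)); congr (_ + _).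
rewrite (lin_fun_sum til) -opprD; congr (- _).
have -> : cE (phi v) = \sum_c B v (tnth e c) *: cE (phi (tnth e' c)).
  rewrite {1}(dual_expand' HQ Qnd ee' v) !linear_sum.
  by apply: eq_bigr => c _; rewrite !linearZ.
rewrite mulr_suml (lin_fun_sum (pure_linearr _)).
rewrite -big_split; apply: eq_bigr => c _ /=.
rewrite (tmap1_pure il) (iv_varM HQ) (iv_parity HQ) mulrN opprK.
by rewrite mulZl pureZr -pureZl -pureDl addrC.
Qed.

(** The commutator of iota_v with m is [- cop v], which commutes with m ([cop_expo]), so the power
    rule of calculus applies. At k = 0 the coefficient vanishes and hides the truncated
    predecessor. *)
Lemma iv_expoX v k : tmap1 (iv v) (m ^+ k) = - k%:R *: cop v (m ^+ k.-1).
Proof.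
elim: k => [|k IH].
  by rewrite expr0 oppr0 scale0r (tmap1_pure (iv_linear HQ v)) (iv1 HQ) pure0l.
rewrite exprS iv_expo IH gtensor_mulZr -cop_expo.
case: k {IH} => [|k] /=; first by rewrite oppr0 scale0r sub0r scaleN1r.
by rewrite -exprS -[X in _ - X]scale1r -scalerBl -opprD natr1.
Qed.

Definition expo_term k : T0 := (k`!%:R^-1 : R) *: m ^+ k.

Lemma expo_termS k : m * expo_term k = k.+1%:R *: expo_term k.+1.
Proof.
rewrite /expo_term gtensor_mulZr -exprS scalerA factS natrM invfM mulrA divff ?mul1r //.
Qed.

Lemma iv_expo_termS v k : tmap1 (iv v) (expo_term k.+1) = - cop v (expo_term k).
Proof.
rewrite /expo_term (lin_funZ (@tmap1_linear _ _ _ _ _ (iv_linear HQ v))) iv_expoX /=.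
rewrite scalerA (lin_funZ (cop_linear v)) -scaleNr mulrN; congr (- _ *: _).
by rewrite factS natrM invfM mulrAC mulVf ?mul1r // pnatr_eq0.
Qed.

(** Extends [lambda_contr] to the tensor product: the contractions of S caused by the terms e_a
    phi^a join those caused by [lambda] and complete A e_a to [cop]. *)
Lemma expo_contr S (y : T0) : parity S = S ->
  m * tmap1 (contr Q S) y = tmap1 (contr Q S) (m * y) + tmap1 (contr Q (contr Q lam S)) y
   - \sum_a tmap1 (contr Q (iv (tnth e' a) S)) (cop (tnth e a) y).
Proof.
move=> pS.
have tl S' := @tmap1_linear _ _ _ (ext E) _ (contr_linear HQ S').
move: y; apply: tensor_lin_ext.
- by apply: linear_comp (gtensor_mul_linear _) (tl _).
- apply: linear_subf; first apply: linear_addf (tl _).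
    by apply: linear_comp (tl _) (gtensor_mul_linear _).
  by apply: linear_sumf => c; apply: linear_comp (tl _) (cop_linear _).
move=> a b; rewrite !(tmap1_pure (contr_linear HQ _)) !expo_mul_pure.
have -> : pure (lam * contr Q S a) b = pure (contr Q S (lam * a)) b +
    pure (contr Q (contr Q lam S) a) b -
    \sum_c pure (contr Q (iv (tnth e' c) S) (cv (A (tnth e c)) * a)) b.
  rewrite (lambda_contr HQ Qnd ee' oA _ pS) (lin_funB (pure_linearl b)) pureDl.
  by rewrite (lin_fun_sum (pure_linearl b)).
have -> : \sum_c pure (cv (tnth e c) * parity (contr Q S a)) (cE (phi (tnth e' c)) * b : ext E) =
  \sum_c pure (contr Q S (cv (tnth e c) * parity a)) (cE (phi (tnth e' c)) * b : ext E) +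
  \sum_c pure (contr Q (iv (tnth e' c) S) (parity a)) (cE (phi (tnth e c)) * b : ext E).
  have Fb : bilinear_fun (fun u w => pure (contr Q (iv u S) (parity a)) (cE (phi w) * b : ext E)).
    split=> [u|w] c x y; first by rewrite !linearP mulr_linear (pure_linearr _ c).
    by rewrite ((iv_bilinear HQ).2 S) (contr_linearl HQ) (pure_linearl _ c).
  rewrite -(dual_swap HQ Qnd ee' Fb) -big_split; apply: eq_bigr => c _ /=.
  by rewrite -pureDl (contr_mul_var HQ) pS subrK -(contr_parity HQ) pS.
rewrite (lin_funB (tl S)) (lin_fun_sum (tl S)) (tmap1_pure (contr_linear HQ _)).
under [in RHS]eq_bigr do rewrite (tmap1_pure (contr_linear HQ _)).
under [X in _ = _ - X]eq_bigr do
  rewrite cop_pure (lin_funD (tl _)) !(tmap1_pure (contr_linear HQ _)).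
rewrite big_split /= !opprD.
by rewrite [LHS](AC (3*2) ((1*4*2)*(3*5))%AC).
Qed.

(** On the exponential series [cop (e_a)] in degree k is minus the contraction by e_a in degree k +
    1. Composed with the contraction by iota_{e^a} S, it becomes contraction by a summand of N S,
    which is how the degree operator enters the recursion. *)
Lemma step_contr S k : parity S = S ->
  step (tmap1 (contr Q S) (expo_term k)) =
    k.+1%:R *: tmap1 (contr Q S) (expo_term k.+1)
    - tmap1 (contr Q (euler Q e e' S)) (expo_term k.+1)
    + tmap1 (contr Q (contr Q lam S + 4^-1 *: (lam * S))) (expo_term k).
Proof.
move=> pS.
have tl S' := @tmap1_linear _ _ _ (ext E) _ (contr_linear HQ S').
have tD (S1 S2 : ext V) (y : T0) : tmap1 (contr Q (S1 + S2)) y =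
    tmap1 (contr Q S1) y + tmap1 (contr Q S2) y.
  move: y; apply: tensor_lin_ext => //; first exact: linear_addf.
  move=> a b; rewrite !(tmap1_pure (contr_linear HQ _)).
  by rewrite (lin_funD (contr_linearl HQ _)) pureDl.
have tZ c (S1 : ext V) (y : T0) : tmap1 (contr Q (c *: S1)) y =
    c *: tmap1 (contr Q S1) y.
  move: y; apply: tensor_lin_ext => //; first exact: linear_scalef.
  move=> a b; rewrite !(tmap1_pure (contr_linear HQ _)).
  by rewrite (lin_funZ (contr_linearl HQ _)) pureZl.
have tS (I : Type) (r : seq I) (F : I -> ext V) (y : T0) :
    tmap1 (contr Q (\sum_(i <- r) F i)) y = \sum_(i <- r) tmap1 (contr Q (F i)) y.
  elim: r => [|i r IH]; last by rewrite !big_cons tD IH.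
  by rewrite !big_nil -(scale0r 0) tZ scale0r.
have tM (S1 S2 : ext V) (y : T0) : tmap1 (contr Q (S1 * S2)) y =
    tmap1 (contr Q S1) (tmap1 (contr Q S2) y).
  move: y; apply: tensor_lin_ext => //; first exact: linear_comp.
  by move=> a b; rewrite !(tmap1_pure (contr_linear HQ _)) (contrM HQ).
rewrite /step (expo_contr _ pS) expo_termS (lin_funZ (tl S)) tD (tZ 4^-1) (tM lam S).
rewrite addrA; congr (_ + _); rewrite addrAC; congr (_ + _); congr (_ - _).
have -> : euler Q e e' S = - \sum_a iv (tnth e' a) S * cv (tnth e a).
  rewrite /euler -sumrN; apply: eq_bigr => a _.
  rewrite ext_parityE -[in LHS]pS (iv_parity HQ) raddfN /= parityK.
  by rewrite mulNr.
rewrite -scaleN1r tZ scaleN1r tS -sumrN; apply: eq_bigr => a _.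
rewrite tM; have -> : tmap1 (contr Q (cv (tnth e a))) (expo_term k.+1) =
    tmap1 (iv (tnth e a)) (expo_term k.+1).
  congr (tmap1 _ _); apply/funext => x; exact: contr_var.
by rewrite iv_expo_termS (lin_funN (tl _)) opprK.
Qed.

Section Series.
Variable s : nat -> ext V.
Hypotheses (s0 : s 0 = 1) (s_even : forall k, parity (s k) = s k).
Hypothesis sS : forall k, k.+1%:R *: s k.+1 + euler Q e e' (s k.+1) =
  contr Q lam (s k) + 4^-1 *: (lam * s k).

Lemma eps_euler S : eps (euler Q e e' S) = 0.
Proof. by rewrite /euler linear_sum big1 // => a _; rewrite /= eps_varM. Qed.

Lemma contr_unit S : contr Q S 1 = eps S *: (1 : ext V).
Proof.
move: S; apply: Cl_lind => [|x y IHx IHy|c x IH|v x IH].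
- by rewrite (contr1 HQ) eps1 scale1r.
- by rewrite (lin_funD (contr_linearl HQ _)) epsD scalerDl IHx IHy.
- by rewrite (lin_funZ (contr_linearl HQ _)) epsZ -scalerA IH.
- rewrite (contrM HQ) (contr_var HQ) IH (lin_funZ (iv_linear HQ v)) (iv1 HQ).
  by rewrite eps_varM scaler0 scale0r.
Qed.

(* part of degree k of iota_S exp(m) when S is the sum of the s i *)
Definition conv_term k : T0 :=
  \sum_(i < k.+1) tmap1 (contr Q (s i)) (expo_term (k - i)).

(** The recursion replaces D s_i by (i + 1 + N) s_(i+1). The terms with N then cancel after a shift
    of the index: at the lower end N s_0 = 0, and at the upper end the contraction acts on 1 and
    sees only the scalar part of N s_(k+1), which is 0. The remaining weights k + 1 - i and i add up
    to k + 1. *)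
Lemma conv_termS k : step (conv_term k) = k.+1%:R *: conv_term k.+1.
Proof.
have tl S' := @tmap1_linear _ _ _ (ext E) _ (contr_linear HQ S').
have tD (S1 S2 : ext V) (y : T0) c : tmap1 (contr Q (c *: S1 + S2)) y =
    c *: tmap1 (contr Q S1) y + tmap1 (contr Q S2) y.
  move: y; apply: tensor_lin_ext => //.
    by apply: linear_addf => //; exact: linear_scalef.
  move=> a b; rewrite !(tmap1_pure (contr_linear HQ _)).
  by rewrite (contr_linearl HQ) (pure_linearl _ c).
rewrite (lin_fun_sum step_linear).
pose X i := tmap1 (contr Q (s i)) (expo_term (k.+1 - i)).
pose Y i := tmap1 (contr Q (euler Q e e' (s i))) (expo_term (k.+1 - i)).
transitivity (\sum_(i < k.+1) ((k.+1 - i)%:R *: X i - Y i) +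
              \sum_(i < k.+1) (i.+1%:R *: X i.+1 + Y i.+1)).
  rewrite -big_split; apply: eq_bigr => i _ /=.
  have ik : (i <= k)%N by rewrite -ltnS.
  rewrite (step_contr _ (s_even i)) -(sS i).
  by rewrite (tD (s i.+1) (euler Q e e' (s i.+1))) /X /Y subSS (subSn ik).
have Ye : Y k.+1 = 0.
  rewrite /Y subnn /expo_term expr0 fact0 invr1 scale1r (tmap1_pure (contr_linear HQ _)).
  by rewrite contr_unit eps_euler scale0r pure0l.
have Y0 : Y 0 = 0.
  rewrite /Y s0 (euler1 HQ); move: (expo_term _); apply: tensor_lin_ext => //.
    by move=> c x y; rewrite scaler0 addr0.
  by move=> a b; rewrite (tmap1_pure (contr_linear HQ _)) (lin_fun0 (contr_linearl HQ _)) pure0l.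
transitivity (\sum_(i < k.+2) ((k.+1 - i)%:R *: X i - Y i) +
              \sum_(i < k.+2) (i%:R *: X i + Y i)).
  congr (_ + _); first by rewrite [RHS]big_ord_recr /= Ye subnn scale0r subr0 addr0.
  by rewrite [RHS]big_ord_recl /= Y0 scale0r !add0r.
rewrite -big_split scaler_sumr; apply: eq_bigr => i _ /=.
rewrite addrACA addNr addr0 -scalerDl -natrD subnK // -ltnS; exact: ltn_ord.
Qed.

Lemma expoX_conv k : ((k`!%:R^-1 : R) *: expo (qmap Q lam) ^+ k : TQ) =
  tmap1 (qmap Q) (conv_term k).
Proof.
have tql := @tmap1_linear _ _ _ (ext E) _ (qmap_linear Q).
elim: k => [|k IH].
  rewrite /conv_term big_ord_recl big_ord0 addr0 s0 /expo_term subnn !expr0 fact0 invr1.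
  by rewrite !scale1r !(tmap1_pure (contr_linear HQ _)) (contr1 HQ) (tmap1_pure (qmap_linear Q)) qmap1.
have k0 : k.+1%:R != 0 :> R by rewrite pnatr_eq0.
apply: (scalerI k0); rewrite -(lin_funZ tql) -conv_termS tmap1_qmap_step -IH.
rewrite gtensor_mulZl gtensor_mulZr -exprS -exprSr Defs.half_double scalerA.
by rewrite factS natrM invfM mulrA divff ?mul1r.
Qed.
End Series.

End Exponent.

(** * Summation tested on linear forms *)

Section Separation.
Variables (R : realType) (U : lmodType R).

Lemma scalar_of (f : U -> R) : scalar f -> exists l : {scalar U}, l =1 f.
Proof.
move=> fl; pose H := GRing.isLinear.Build R U R *%R f fl.
by exists (HB.pack_for {scalar U} f H).
Qed.

(* A maximal subspace avoiding u is the kernel of a linear form. *)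
Lemma scalar_separates (u : U) : u != 0 -> exists l : {scalar U}, l u != 0.
Proof.
move=> u0.
pose P (W : set U) := (forall c x y, W x -> W y -> W (c *: x + y)) /\ ~ W u.
have [W [[Wl Wu] Wmax]] : exists W, P W /\ forall B, (W `<` B)%classic -> ~ P B.
  apply: Zorn_bigcup => F FP Ftot; split=> [c x y [X FX Xx] [Y FY Yy]|[X FX Xu]].
    have [XY|YX] := Ftot _ _ FX FY.
      by exists Y => //; apply: (FP Y FY).1 => //; exact: XY.
    by exists X => //; apply: (FP X FX).1 => //; exact: YX.
  exact: (FP X FX).2 Xu.
(* The property P leaves room for the empty set, since the union of an empty chain must satisfy it;
   maximality supplies 0. *)
have W0 : W 0.
  apply: contrapT => nW0; apply: (Wmax (W `|` [set 0])%classic).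
    split; first by move=> x Wx; left.
    by move=> H; apply/nW0/H; right.
  split=> [c x y [Wx|->] [Wy|->]|[//|/= u00]].
  - by left; exact: Wl.
  - by case: nW0; have := Wl (-1) _ _ Wx Wx; rewrite scaleN1r addNr.
  - by rewrite scaler0 add0r; left.
  - by rewrite scaler0 add0r; right.
  - by move: u0; rewrite u00 eqxx.
have WZ c x : W x -> W (c *: x) by move=> Wx; rewrite -[_ *: _]addr0; exact: Wl.
(* By maximality W and u together span everything, so x is a multiple of u modulo W; that multiple
   will be the value of the linear form. *)
have ex x : exists c, W (x - c *: u).
  apply: contrapT => nx.
  have nWx : ~ W x by move=> Wx; apply: nx; exists 0; rewrite scale0r subr0.
  apply: (Wmax [set y | exists c, W (y - c *: x)]%classic).
    split=> [y Wy|/(_ x) H]; first by exists 0; rewrite scale0r subr0.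
    by apply/nWx/H; exists 1; rewrite scale1r subrr.
  split=> [c y z [d Wd] [d' Wd']|[d Wd]].
    exists (c * d + d'); have := Wl c _ _ Wd Wd'.
    by rewrite scalerBr scalerA scalerDl opprD addrACA.
  have [d0|d0] := eqVneq d 0; first by move: Wd; rewrite d0 scale0r subr0.
  apply: nx; exists d^-1; have := WZ (- d^-1) _ Wd.
  by rewrite scalerBr !scaleNr opprK scalerA mulVf // scale1r addrC.
pose f x := xget 0 [set c | W (x - c *: u)].
have fW x : W (x - f x *: u) by rewrite /f; case: xgetP => // /(_ _) H; have [c /H] := ex x.
have f_uniq x c : W (x - c *: u) -> f x = c.
  move=> Wc; apply/eqP; rewrite -subr_eq0; apply: contrapT => /negP fc; apply: Wu.
  have := WZ (f x - c)^-1 _ (Wl (-1) _ _ (fW x) Wc).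
  by rewrite scaleN1r opprB subrKA -scalerBl scalerA mulVf ?scale1r.
have f_lin : scalar f.
  move=> c x y; apply: f_uniq.
  by have := Wl c _ _ (fW x) (fW y); rewrite scalerBr scalerA scalerDl opprD addrACA.
have [l lE] := scalar_of f_lin.
exists l; rewrite lE (f_uniq u 1) ?oner_neq0 //.
by rewrite scale1r subrr.
Qed.

Definition is_vsum (u : nat -> U) (y : U) :=
  forall l : {scalar U}, (fun N => \sum_(k < N) l (u k)) @ \oo --> l y.

Lemma vsumE u y : is_vsum u y -> vsum u = y.
Proof.
move=> uy; rewrite /vsum; case: xgetP => [z -> uz|/(_ y)//].
apply/eqP; rewrite -subr_eq0; apply: contrapT => /negP /scalar_separates[l].
rewrite linearB /= subr_eq0 => /eqP; apply.
exact: (cvg_unique _ (uz l) (uy l)).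
Qed.
End Separation.

(** * Absolutely summable series and Cauchy products *)

Section AbsSummable.
Variable R : realType.
Implicit Types a b : nat -> R.

Definition abs_summable a := exists M : R, forall N, \sum_(k < N) `|a k| <= M.
Definition asum a : R := limn (fun N => \sum_(k < N) a k).

Lemma abs_summable_cvg a : abs_summable a ->
  (fun N => \sum_(k < N) a k) @ \oo --> asum a.
Proof.
have psE b : (fun N => \sum_(k < N) b k) = series b.
  by apply/funext => N; rewrite /series /= big_mkord.
move=> [M aM]; suff : cvgn (fun N => \sum_(k < N) a k) by [].
rewrite psE; apply: normed_cvg.
have -> : [normed series a] = (fun N => \sum_(k < N) `|a k|).
  by rewrite /normed_series_of /= -psE.
apply: nondecreasing_is_cvgn.
  apply/nondecreasing_seqP => N; rewrite big_ord_recr /=.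
  by rewrite lerDl.
by exists M => _ [N _ <-].
Qed.

Lemma asumE a x : (fun N => \sum_(k < N) a k) @ \oo --> x -> asum a = x.
Proof. exact: cvg_lim. Qed.

Lemma abs_summable_norm a : abs_summable a -> abs_summable (fun k => `|a k|).
Proof. by move=> [M aM]; exists M => N; under eq_bigr do rewrite normr_id. Qed.

Lemma abs_summable_le a b : (forall k, `|a k| <= `|b k|) -> abs_summable b ->
  abs_summable a.
Proof.
by move=> ab [M bM]; exists M => N; apply: le_trans (bM N); apply: ler_sum.
Qed.

Lemma abs_summableD a b : abs_summable a -> abs_summable b ->
  abs_summable (fun k => a k + b k).
Proof.
move=> [M aM] [M' bM]; exists (M + M') => N; apply: le_trans (lerD (aM N) (bM N)).
by rewrite -big_split; apply: ler_sum => k _; exact: ler_normD.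
Qed.

Lemma abs_summableZ c a : abs_summable a -> abs_summable (fun k => c * a k).
Proof.
move=> [M aM]; exists (`|c| * M) => N; under eq_bigr do rewrite normrM.
by rewrite -mulr_sumr ler_wpM2l.
Qed.

Lemma abs_summable_sum (I : Type) (r : seq I) (F : I -> nat -> R) :
  (forall i, abs_summable (F i)) -> abs_summable (fun k => \sum_(i <- r) F i k).
Proof.
move=> FS; elim: r => [|i r IH].
  by exists 0 => N; rewrite big1 // => k _; rewrite big_nil normr0.
apply: abs_summable_le (abs_summableD (FS i) IH) => k.
by rewrite big_cons.
Qed.

Lemma asumD a b : abs_summable a -> abs_summable b ->
  asum (fun k => a k + b k) = asum a + asum b.
Proof.
move=> sa sb; apply: asumE; under eq_fun do rewrite big_split.
exact: cvgD (abs_summable_cvg sa) (abs_summable_cvg sb).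
Qed.

Lemma asumZ c a : abs_summable a -> asum (fun k => c * a k) = c * asum a.
Proof.
move=> sa; apply: asumE; under eq_fun do rewrite -mulr_sumr.
exact: cvgMr (abs_summable_cvg sa).
Qed.

Lemma asum_le a M : abs_summable a -> (forall N, \sum_(k < N) a k <= M) ->
  asum a <= M.
Proof.
move=> sa aM; apply: limr_le; first by have := abs_summable_cvg sa; apply: cvgP.
exact: nearW.
Qed.

Lemma asum_norm_le a M : (forall N, \sum_(k < N) `|a k| <= M) -> `|asum a| <= M.
Proof.
move=> aM; have sa : abs_summable a by exists M.
have [aN aP] : (asum a <= M) /\ (- asum a <= M).
  split; first by apply: asum_le => // N; apply: le_trans (aM N); apply: ler_sum => k _; exact: ler_norm.
  have -> : - asum a = asum (fun k => -1 * a k) by rewrite asumZ // mulN1r.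
  apply: asum_le => [|N]; first exact: abs_summableZ.
  by apply: le_trans (aM N); apply: ler_sum => k _; rewrite mulN1r -normrN ler_norm.
by rewrite ler_norml lerNl aP aN.
Qed.

Lemma abs_summable_tail a (eps : R) : abs_summable a -> 0 < eps -> exists M,
  forall N N', (M <= N)%N -> (N <= N')%N -> \sum_(N <= k < N') `|a k| <= eps.
Proof.
move=> sa e0; have sna := abs_summable_norm sa.
have := abs_summable_cvg sna => /cvgrPdist_le /(_ _ e0)[M _ HM].
exists M => N N' MN NN'.
have incr p q : (p <= q)%N -> \sum_(k < p) `|a k| <= \sum_(k < q) `|a k|.
  by move=> pq; rewrite -!(big_mkord predT (fun k => `|a k|)) [leRHS](big_cat_nat (n := p)) //= lerDl sumr_ge0.
have E : \sum_(N <= k < N') `|a k| = \sum_(k < N') `|a k| - \sum_(k < N) `|a k|.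
  rewrite -!(big_mkord predT (fun k => `|a k|)) [in RHS](big_cat_nat (n := N)) //=.
  by rewrite addrAC subrr add0r.
have L : \sum_(k < N') `|a k| <= asum (fun k => `|a k|).
  apply: limr_ge; first by have := abs_summable_cvg sna; apply: cvgP.
  by exists N' => // p /= N'p; exact: incr.
rewrite E; apply: le_trans (lerB L (lexx _)) _.
exact: le_trans (ler_norm _) (HM N MN).
Qed.

Definition cauchy_prod a b k := \sum_(i < k.+1) a i * b (k - i)%N.

Lemma psum_conv a b N :
  \sum_(k < N) cauchy_prod a b k = \sum_(i < N) a i * \sum_(j < N - i) b j.
Proof.
elim: N => [|N IH]; first by rewrite !big_ord0.
rewrite big_ord_recr /= IH /cauchy_prod [in RHS]big_ord_recr /= subSnn big_ord1.
rewrite big_ord_recr /= subnn addrA; congr (_ + _).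
rewrite -big_split; apply: eq_bigr => i _ /=.
by rewrite subSn ?(ltnW (ltn_ord i)) // big_ord_recr /= mulrDr.
Qed.

Lemma conv_abs_summable a b : abs_summable a -> abs_summable b ->
  abs_summable (cauchy_prod a b).
Proof.
move=> [M aM] [M' bM]; exists (M * M') => N.
have M'0 : 0 <= M' by have := bM 0%N; rewrite big_ord0.
apply: (@le_trans _ _ (\sum_(k < N) cauchy_prod (fun k => `|a k|) (fun k => `|b k|) k)).
  apply: ler_sum => k _; rewrite /cauchy_prod; apply: le_trans (ler_norm_sum _ _ _) _.
  by apply: ler_sum => i _; rewrite normrM.
rewrite psum_conv; apply: le_trans (ler_wpM2r M'0 (aM N)).
by rewrite mulr_suml; apply: ler_sum => i _; apply: ler_wpM2l.
Qed.

(** The partial sums differ from the product by sum_k a_k times the tail of b from N - k on. For k <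
    M this tail is small, and for k >= M the tail of a is small while the tails of b stay
    bounded. *)
Lemma conv_asum a b : abs_summable a -> abs_summable b ->
  asum (cauchy_prod a b) = asum a * asum b.
Proof.
move=> sa sb; apply: asumE.
have : (fun N => \sum_(k < N) a k * asum b) @ \oo --> asum a * asum b.
  under eq_fun do rewrite -mulr_suml.
  exact: cvgMl (abs_summable_cvg sa).
suff H : (fun N => \sum_(k < N) a k * asum b - \sum_(k < N) cauchy_prod a b k) @ \oo --> 0.
  move=> /cvgB /(_ H); rewrite subr0; set f := (X in X @ _ --> _ -> _).
  have -> // : f = (fun N => \sum_(k < N) cauchy_prod a b k).
  apply/funext => N; rewrite /f.
  change (\sum_(k < N) a k * asum b - (\sum_(k < N) a k * asum b -
    \sum_(k < N) cauchy_prod a b k) = \sum_(k < N) cauchy_prod a b k).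
  by rewrite opprB addrC subrK.
apply/cvgrPdist_le => e e0; have [Ma aM] := sa; have [Mb bM] := sb.
have Ma0 : 0 <= Ma by have := aM 0%N; rewrite big_ord0.
have Mb0 : 0 <= Mb by have := bM 0%N; rewrite big_ord0.
(* The two ranges of k will contribute at most Ma d and 2 Mb d; the 1 keeps the denominator
   positive. *)
have d0 : 0 < e / (Ma + Mb + Mb + 1) by rewrite divr_gt0 // ltr_wpDl // !addr_ge0.
set d := e / _ in d0.
have [M HM] := abs_summable_tail sa d0.
have [M' _ HM'] := (@cvgrPdist_le _ _ _ _ _ _ _).1 (abs_summable_cvg sb) d d0.
exists (M + M')%N => // N /= MN; rewrite sub0r normrN psum_conv -sumrB.
have bb j : `|asum b - \sum_(i < j) b i| <= Mb + Mb.
  apply: le_trans (ler_normB _ _) (lerD _ _); first exact: asum_norm_le.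
  by apply: le_trans (ler_norm_sum _ _ _) (bM j).
apply: le_trans (ler_norm_sum _ _ _) _.
under eq_bigr do rewrite -mulrBr normrM.
rewrite -(big_mkord predT (fun k => `|a k| * `|asum b - \sum_(i < N - k) b i|)).
have MN' : (M <= N)%N by apply: leq_trans MN; exact: leq_addr.
rewrite (big_cat_nat (n := M)) //=.
apply: (@le_trans _ _ (Ma * d + d * (Mb + Mb))).
  apply: lerD.
    apply: le_trans (ler_wpM2r (ltW d0) (aM M)).
    rewrite big_mkord mulr_suml; apply: ler_sum => k _; apply: ler_wpM2l => //.
    apply: HM' => /=; rewrite leq_subRL ?(leq_trans (ltnW (ltn_ord k))) //.
    by apply: leq_trans MN; rewrite leq_add2r ltnW.
  apply: le_trans (ler_wpM2r (addr_ge0 Mb0 Mb0) (HM M N (leqnn _) MN')).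
  by rewrite mulr_suml; apply: ler_sum => k _; apply: ler_wpM2l => //; exact: bb.
rewrite [Ma * d]mulrC -mulrDr /d mulrAC -mulrA ler_piMr ?(ltW e0) //.
by rewrite ler_pdivrMr ?mul1r ?addrA ?lerDl // ltr_wpDl // !addr_ge0.
Qed.

Lemma exp_abs_summable (x C : R) : 0 <= C ->
  abs_summable (fun k => C * (x ^+ k / k`!%:R)).
Proof.
move=> C0; apply: abs_summableZ.
have Hc := is_cvg_series_exp_coeff `|x|.
exists (limn (series (exp_coeff `|x|))) => N.
apply: le_trans (nondecreasing_cvgn_le _ Hc N).
  rewrite /series /= big_mkord; apply: ler_sum => k _.
  by rewrite /exp_coeff /= normrM normrX normfV normr_nat.
apply/nondecreasing_seqP => n; rewrite /series /= big_nat_recr //= lerDl.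
by apply: exp_coeff_ge0.
Qed.

End AbsSummable.

Lemma cvg_sumr (R : realType) (I : Type) (r : seq I) (F : I -> nat -> R) (l : I -> R) :
  (forall i, F i @ \oo --> l i) ->
  (fun N => \sum_(i <- r) F i N) @ \oo --> \sum_(i <- r) l i.
Proof.
move=> Fl; elim: r => [|i r IH].
  by rewrite big_nil; under eq_fun do rewrite big_nil; exact: cvg_cst.
by rewrite big_cons; under eq_fun do rewrite big_cons; exact: cvgD (Fl i) IH.
Qed.

Section CoordSum.
Variable R : realType.

(** Summation in finitely many coordinates, with absolutely summable coefficients; the b i need not
    be independent. Unlike convergence tested on linear forms, this notion passes to Cauchy products
    under a bilinear map. *)
Definition coord_sum (U : lmodType R) (u : nat -> U) (y : U) :=
  exists (I : finType) (b : I -> U) (c : nat -> I -> R),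
  [/\ forall k, u k = \sum_i c k i *: b i,
      forall i, abs_summable (c^~ i) & y = \sum_i asum (c^~ i) *: b i].

Lemma coord_sum_is_vsum (U : lmodType R) (u : nat -> U) y :
  coord_sum u y -> is_vsum u y.
Proof.
move=> [I [b [c [uE cS ->]]]] l.
have -> : (fun N => \sum_(k < N) l (u k)) =
    (fun N => \sum_i (\sum_(k < N) c k i) * l (b i)).
  apply/funext => N; under eq_bigr do rewrite uE linear_sum /=.
  rewrite exchange_big; apply: eq_bigr => i _ /=; rewrite mulr_suml.
  by apply: eq_bigr => k _; rewrite linearZ.
rewrite linear_sum /=; apply: cvg_sumr => i; rewrite linearZ /=.
exact: cvgMl (abs_summable_cvg (cS i)).
Qed.

Lemma coord_sum_vsum (U : lmodType R) (u : nat -> U) y : coord_sum u y -> vsum u = y.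
Proof. by move=> /coord_sum_is_vsum /vsumE. Qed.

Lemma coord_sum_lin (U W : lmodType R) (f : U -> W) u y : linear f ->
  coord_sum u y -> coord_sum (fun k => f (u k)) (f y).
Proof.
move=> lf [I [b [c [uE cS ->]]]]; exists I, (f \o b), c; split=> [k|//|].
  by rewrite uE (lin_fun_sum lf); apply: eq_bigr => i _; rewrite (lin_funZ lf).
by rewrite (lin_fun_sum lf); apply: eq_bigr => i _; rewrite (lin_funZ lf).
Qed.

Lemma coord_sum_bil (U W X : lmodType R) (F : U -> W -> X) u y v z :
  bilinear_fun F -> coord_sum u y -> coord_sum v z ->
  coord_sum (fun k => \sum_(i < k.+1) F (u i) (v (k - i)%N)) (F y z).
Proof.
move=> FB [I [b [c [uE cS ->]]]] [J [b' [c' [vE c'S ->]]]].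
have FE (f : I -> R) (g : J -> R) : F (\sum_i f i *: b i) (\sum_j g j *: b' j) =
    \sum_(p : I * J) (f p.1 * g p.2) *: F (b p.1) (b' p.2).
  rewrite -(pair_bigA _ (fun i j => (f i * g j) *: F (b i) (b' j))) /=.
  rewrite (lin_fun_sum (FB.2 _)); apply: eq_bigr => i _.
  rewrite (lin_fun_sum (FB.1 _)); apply: eq_bigr => j _.
  by rewrite (lin_funZ (FB.2 _)) (lin_funZ (FB.1 _)) scalerA.
exists (I * J)%type, (fun p => F (b p.1) (b' p.2)),
  (fun k p => cauchy_prod (c^~ p.1) (c'^~ p.2) k); split=> [k|p|].
- under eq_bigr do rewrite uE vE FE.
  by rewrite exchange_big; apply: eq_bigr => p _ /=; rewrite -scaler_suml.
- exact: conv_abs_summable.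
- by rewrite FE; apply: eq_bigr => p _; rewrite conv_asum.
Qed.

Lemma coord_sum_scalar (u : nat -> R) y : coord_sum (u : nat -> R^o) y ->
  abs_summable u /\ asum u = y.
Proof.
move=> uy; split.
  have [I [b [c [uE cS _]]]] := uy.
  have -> : u = (fun k => \sum_i b i * c k i).
    by apply/funext => k; rewrite uE; apply: eq_bigr => i _; rewrite mulrC.
  by apply: abs_summable_sum => i; exact: abs_summableZ.
have [l lE] : exists l : {scalar R^o}, l =1 (id : R^o -> R) by apply: scalar_of.
apply: asumE; have /(_ l) := coord_sum_is_vsum uy; rewrite lE.
by under eq_fun do under eq_bigr do rewrite lE.
Qed.

End CoordSum.

(** * Linear recursions with coefficients of size O(1/k) *)

Section LinearRecursion.
Variables (R : realType) (I : finType).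
Implicit Types (T H : nat -> I -> I -> R) (f g z : I -> R) (K eta : R).

Definition mxv (A : I -> I -> R) f i := \sum_j A i j * f j.
Definition norm1 f : R := \sum_i `|f i|.

Fixpoint zrec T z (k : nat) : I -> R :=
  if k is k'.+1 then mxv (T k') (zrec T z k') else z.

(** The factor 1/(k+1) gained at each step gives solutions of size C^k / k!, whose sums converge for
    every value of the parameters. *)
Definition decays K T := forall k i j, `|T k i j| <= K / k.+1%:R.

Lemma norm1_ge0 f : 0 <= norm1 f.
Proof. by apply: sumr_ge0. Qed.

Lemma norm1_add f g : norm1 (fun i => f i + g i) <= norm1 f + norm1 g.
Proof. by rewrite -big_split; apply: ler_sum => i _; exact: ler_normD. Qed.

Lemma norm1_mxv (A : I -> I -> R) (c : R) f : (forall i j, `|A i j| <= c) ->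
  norm1 (mxv A f) <= #|I|%:R * c * norm1 f.
Proof.
move=> Ac; apply: (@le_trans _ _ (\sum_(i : I) c * norm1 f)).
  apply: ler_sum => i _; apply: le_trans (ler_norm_sum _ _ _) _.
  rewrite mulr_sumr; apply: ler_sum => j _; rewrite normrM.
  exact: ler_wpM2r.
by rewrite sumr_const -[leLHS]mulr_natl mulrA.
Qed.

Lemma mxvB A f g i : mxv A (fun i => f i - g i) i = mxv A f i - mxv A g i.
Proof. by rewrite -sumrB; apply: eq_bigr => j _; rewrite mulrBr. Qed.

(** A discrete Gronwall estimate, with y as the source term. The polynomial factor rises by one
    degree since k^(e+1) + k^e = (k+1) k^e is at most (k+1)^(e+1). *)
Lemma rec_bound (L c : R) (e : nat) (x y : nat -> R) : 0 <= L -> 0 <= c ->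
  x 0 <= 0 -> (forall k, x k.+1 <= L / k.+1%:R * (x k + y k)) ->
  (forall k, y k <= c * k%:R ^+ e * (L ^+ k / k`!%:R)) ->
  forall k, x k <= c * k%:R ^+ e.+1 * (L ^+ k / k`!%:R).
Proof.
move=> L0 c0 x0 xS yB; elim=> [|k IH].
  by rewrite expr0n mulr0 mul0r.
apply: le_trans (xS k) _.
have fk : 0 <= L ^+ k / k`!%:R by rewrite divr_ge0 ?exprn_ge0.
have -> : L ^+ k.+1 / k.+1`!%:R = L / k.+1%:R * (L ^+ k / k`!%:R).
  by rewrite exprS factS natrM invfM mulrACA.
rewrite [leRHS]mulrCA ler_wpM2l ?divr_ge0 //.
apply: le_trans (lerD IH (yB k)) _.
rewrite -mulrDl -mulrDr ler_wpM2r // ler_wpM2l //.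
rewrite exprS -[X in _ + X]mul1r -mulrDl natr1 exprS ler_wpM2l //.
by rewrite lerXn2r ?nnegrE // ler_nat.
Qed.

Lemma zrec_bound T z K : 0 <= K -> decays K T -> forall k,
  norm1 (zrec T z k) <= norm1 z * ((#|I|%:R * K) ^+ k / k`!%:R).
Proof.
move=> K0 TK; elim=> [|k IH] /=.
  by rewrite fact0 divr1 mulr1.
apply: le_trans (norm1_mxv _ (TK k)) _.
apply: le_trans (ler_wpM2l _ IH) _; first by rewrite mulr_ge0 // divr_ge0.
rewrite exprS factS natrM invfM le_eqVlt; apply/orP; left; apply/eqP.
have E (a b c d f h : R) : f * (h * b) * (d * (a * c)) = d * (f * h * a * (b * c)).
  by ring.
exact: E.
Qed.

Section Perturbation.
Variables (T H : nat -> I -> I -> R) (z : I -> R) (K eta : R).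
Hypotheses (K0 : 0 <= K) (TK : decays K T) (eta01 : 0 <= eta <= 1)
  (HK : decays (eta * K) H).

Let TH k i j := T k i j + H k i j.

(* first-order variation of zrec in the direction H *)
Fixpoint dzrec (k : nat) : I -> R :=
  if k is k'.+1 then fun i => mxv (T k') (dzrec k') i + mxv (H k') (zrec T z k') i
  else fun=> 0.

Let L := #|I|%:R * (2 * K).
Let L0 : 0 <= L. Proof. by rewrite !mulr_ge0. Qed.
Let eta0 : 0 <= eta. Proof. by case/andP: eta01. Qed.
Let eta1 : eta <= 1. Proof. by case/andP: eta01. Qed.
Let KL k : #|I|%:R * (K / k.+1%:R) <= L / k.+1%:R.
Proof.
rewrite /L mulrA ler_wpM2r // ler_wpM2l // mulrDl mul1r lerDl //.
Qed.
Let HKL k : #|I|%:R * (eta * K / k.+1%:R) <= eta * (L / k.+1%:R).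
Proof.
by rewrite -mulrA mulrCA ler_wpM2l.
Qed.

Lemma TH_decays : decays (2 * K) TH.
Proof.
move=> k i j; apply: le_trans (ler_normD _ _) _.
apply: le_trans (lerD (TK k i j) (HK k i j)) _.
rewrite -mulrDl ler_wpM2r // mulrDl mul1r lerD2l.
by rewrite ler_piMl.
Qed.

Lemma zrec_perturb1 k : norm1 (fun i => zrec TH z k i - zrec T z k i) <=
  eta * norm1 z * k%:R * (L ^+ k / k`!%:R).
Proof.
rewrite -[k%:R in leRHS]expr1; move: k.
apply: (@rec_bound _ _ _ _ (fun k => eta * norm1 (zrec TH z k))) => //.
- by rewrite mulr_ge0 ?norm1_ge0.
- by rewrite /norm1 big1 // => i _; rewrite subrr normr0.
- move=> k /=.
  have -> : (fun i => mxv (TH k) (zrec TH z k) i - mxv (T k) (zrec T z k) i) =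
    (fun i => mxv (T k) (fun j => zrec TH z k j - zrec T z k j) i + mxv (H k) (zrec TH z k) i).
    apply/funext => i; rewrite mxvB addrAC; congr (_ - _).
    by rewrite /mxv -big_split; apply: eq_bigr => j _; rewrite /TH mulrDl.
  apply: le_trans (norm1_add _ _) _; rewrite mulrDr; apply: lerD.
    apply: le_trans (norm1_mxv _ (TK k)) _.
    by rewrite ler_wpM2r ?norm1_ge0.
  apply: le_trans (norm1_mxv _ (HK k)) _.
  by rewrite [leRHS]mulrCA [leRHS]mulrA ler_wpM2r ?norm1_ge0.
- move=> k; rewrite expr0 mulr1 -mulrA ler_wpM2l //.
  by apply: zrec_bound TH_decays k; rewrite mulr_ge0.
Qed.

(** The second-order remainder solves the recursion for T with source H applied to the first-order
    difference; both are of order eta, whence eta^2. *)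
Lemma zrec_perturb2 k :
  norm1 (fun i => zrec TH z k i - zrec T z k i - dzrec k i) <=
  eta ^+ 2 * norm1 z * k%:R ^+ 2 * (L ^+ k / k`!%:R).
Proof.
move: k; apply: (@rec_bound _ _ _ _
    (fun k => eta * norm1 (fun i => zrec TH z k i - zrec T z k i))) => //.
- by rewrite mulr_ge0 ?norm1_ge0 // exprn_ge0.
- by rewrite /norm1 big1 // => i _; rewrite !subrr normr0.
- move=> k /=.
  have -> : (fun i => mxv (TH k) (zrec TH z k) i - mxv (T k) (zrec T z k) i -
       (mxv (T k) (dzrec k) i + mxv (H k) (zrec T z k) i)) =
    (fun i => mxv (T k) (fun j => zrec TH z k j - zrec T z k j - dzrec k j) i +
              mxv (H k) (fun j => zrec TH z k j - zrec T z k j) i).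
    apply/funext => i; rewrite !mxvB.
    have -> : mxv (TH k) (zrec TH z k) i =
      mxv (T k) (zrec TH z k) i + mxv (H k) (zrec TH z k) i.
      by rewrite /mxv -big_split; apply: eq_bigr => j _; rewrite /TH mulrDl.
    by lra.
  apply: le_trans (norm1_add _ _) _; rewrite mulrDr; apply: lerD.
    apply: le_trans (norm1_mxv _ (TK k)) _.
    by rewrite ler_wpM2r ?norm1_ge0.
  apply: le_trans (norm1_mxv _ (HK k)) _.
  by rewrite [leRHS]mulrCA [leRHS]mulrA ler_wpM2r ?norm1_ge0.
- move=> k; rewrite expr1 exprS expr1 -!mulrA ler_wpM2l //.
  by rewrite mulrA (mulrA (eta * _)); exact: zrec_perturb1.
Qed.

End Perturbation.

Definition pairing (w : I -> R) f := \sum_i w i * f i.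

Lemma pairing_le w f : `|pairing w f| <= norm1 w * norm1 f.
Proof.
apply: le_trans (ler_norm_sum _ _ _) _; rewrite /norm1 mulr_suml.
apply: ler_sum => i _; rewrite normrM ler_wpM2l //.
by rewrite (bigD1 i) //= lerDl sumr_ge0.
Qed.

Lemma zrec_summable T z w K : 0 <= K -> decays K T ->
  abs_summable (fun k => pairing w (zrec T z k)).
Proof.
move=> K0 TK; apply: abs_summable_le (@exp_abs_summable _ (#|I|%:R * K)
  (norm1 w * norm1 z) _); last by rewrite mulr_ge0 ?norm1_ge0.
move=> k; apply: le_trans (pairing_le _ _) _; rewrite [leRHS]ger0_norm.
  by rewrite -mulrA ler_wpM2l ?norm1_ge0 //; exact: zrec_bound.
by rewrite !mulr_ge0 ?norm1_ge0 ?invr_ge0 // exprn_ge0 // mulr_ge0.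
Qed.

End LinearRecursion.

Section PerturbationSum.
Variables (R : realType) (I : finType) (T H : nat -> I -> I -> R) (z w : I -> R).
Variables (K eta : R).
Hypotheses (K0 : 0 <= K) (TK : decays K T) (eta01 : 0 <= eta <= 1)
  (HK : decays (eta * K) H).
Let TH k i j := T k i j + H k i j.
Let L := #|I|%:R * (2 * K).

(* k <= 4^k and k^2 <= 4^k absorb the polynomial factors *)
Definition perturb_cst : R :=
  norm1 w * norm1 z * asum (fun k => 1 * ((4 * L) ^+ k / k`!%:R)).

Let L0 : 0 <= L. Proof. by rewrite !mulr_ge0. Qed.
Let Lk k : 0 <= L ^+ k / k`!%:R. Proof. by rewrite divr_ge0 // exprn_ge0. Qed.
Let eta0 : 0 <= eta. Proof. by case/andP: eta01. Qed.

Let le4 k : (k%:R : R) <= 4 ^+ k /\ (k%:R ^+ 2 : R) <= 4 ^+ k.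
Proof.
have k2 : (k <= 2 ^ k)%N by apply/ltnW/ltn_expl.
have -> : (4 : R) ^+ k = (2 ^ k * 2 ^ k)%N%:R by rewrite -expnMn natrX.
split; rewrite -?natrX ler_nat; last by rewrite expnS expn1 leq_mul.
by apply: leq_trans k2 _; rewrite leq_pmulr // expn_gt0.
Qed.

Let le_exp (x : nat -> R) (c : R) (e : nat -> R) : 0 <= c ->
  (forall k, e k <= 4 ^+ k) ->
  (forall k, `|x k| <= norm1 w * (c * norm1 z * e k * (L ^+ k / k`!%:R))) ->
  `|asum x| <= c * perturb_cst.
Proof.
move=> c0 e4 xe.
have S : abs_summable (fun k => 1 * ((4 * L) ^+ k / k`!%:R)).
  exact: exp_abs_summable.
apply: asum_norm_le => N; rewrite /perturb_cst mulrA -asumZ //.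
apply: (@le_trans _ _ (\sum_(k < N) c * (norm1 w * norm1 z) * (1 * ((4 * L) ^+ k / k`!%:R)))).
  apply: ler_sum => k _; apply: le_trans (xe k) _.
  rewrite mul1r [(4 * L) ^+ k]exprMn -!mulrA [norm1 w * (c * _)]mulrCA ler_wpM2l //.
  rewrite ler_wpM2l ?norm1_ge0 // ler_wpM2l ?norm1_ge0 // ler_wpM2r //.
apply: limr_ge; first by have := abs_summable_cvg (abs_summableZ (c * (norm1 w * norm1 z)) S); apply: cvgP.
exists N => // N' /= NN'.
rewrite -!(big_mkord predT (fun k => c * (norm1 w * norm1 z) * (1 * ((4 * L) ^+ k / k`!%:R)))).
rewrite [leRHS](big_cat_nat (n := N)) //= lerDl sumr_ge0 // => k _.
by rewrite !mulr_ge0 ?norm1_ge0 ?invr_ge0 // exprn_ge0 // mulr_ge0.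
Qed.

Lemma asum_perturb1 :
  `|asum (fun k => pairing w (zrec TH z k)) - asum (fun k => pairing w (zrec T z k))| <=
  eta * perturb_cst.
Proof.
have s1 : abs_summable (fun k => pairing w (zrec TH z k)).
  by apply: zrec_summable (TH_decays K0 TK eta01 HK); rewrite mulr_ge0.
have s2 : abs_summable (fun k => -1 * pairing w (zrec T z k)).
  by apply/abs_summableZ/(zrec_summable _ _ K0).
rewrite -mulN1r -asumZ; last exact: zrec_summable TK.
rewrite -asumD //; apply: (le_exp eta0 (fun k => (le4 k).1)) => k.
have -> : pairing w (zrec TH z k) + -1 * pairing w (zrec T z k) =
    pairing w (fun i => zrec TH z k i - zrec T z k i).
  by rewrite mulN1r -sumrB; apply: eq_bigr => i _; rewrite mulrBr.
apply: le_trans (pairing_le _ _) _; rewrite ler_wpM2l ?norm1_ge0 //.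
exact: zrec_perturb1.
Qed.

Lemma asum_perturb2 : abs_summable (fun k => pairing w (dzrec T H z k)) ->
  `|asum (fun k => pairing w (zrec TH z k)) - asum (fun k => pairing w (zrec T z k))
    - asum (fun k => pairing w (dzrec T H z k))| <= eta ^+ 2 * perturb_cst.
Proof.
move=> s3.
have s1 : abs_summable (fun k => pairing w (zrec TH z k)).
  by apply: zrec_summable (TH_decays K0 TK eta01 HK); rewrite mulr_ge0.
have s2 : abs_summable (fun k => -1 * pairing w (zrec T z k)).
  by apply/abs_summableZ/(zrec_summable _ _ K0).
rewrite -mulN1r -asumZ; last exact: zrec_summable TK.
rewrite -[X in _ - X]mul1r -mulNr -asumZ // -asumD // -asumD //; last first.
- exact: abs_summableZ.
- exact: abs_summableD.
apply: (le_exp (exprn_ge0 2 eta0) (fun k => (le4 k).2)) => k.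
have -> : pairing w (zrec TH z k) + -1 * pairing w (zrec T z k) +
    -1 * pairing w (dzrec T H z k) =
    pairing w (fun i => zrec TH z k i - zrec T z k i - dzrec T H z k i).
  by rewrite !mulN1r -!sumrB; apply: eq_bigr => i _; rewrite !mulrBr.
apply: le_trans (pairing_le _ _) _; rewrite ler_wpM2l ?norm1_ge0 //.
exact: zrec_perturb2.
Qed.

End PerturbationSum.

Section AffineClass.
Variables (R : realType) (m : nat) (I : finType).
Implicit Types (x v : 'rV[R]_m) (K : R) (z w : I -> R).

Definition lin_part (th : nat -> 'I_m -> I -> I -> R) x k i j := \sum_p x ord0 p * th k p i j.
Definition aff (th0 : nat -> I -> I -> R) (th : nat -> 'I_m -> I -> I -> R) x k i j := th0 k i j + lin_part th x k i j.

Lemma decays_mono K K' (T : nat -> I -> I -> R) : K <= K' -> decays K T -> decays K' T.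
Proof.
by move=> KK' TK k i j; apply: le_trans (TK k i j) _; rewrite ler_wpM2r.
Qed.

Lemma decays_lin K th (x : 'rV[R]_m) (c : R) : (forall p, `|x ord0 p| <= c) ->
  (forall p, decays K (th^~ p)) -> decays (c * (m%:R * K)) (lin_part th x).
Proof.
move=> xc thK k i j; apply: le_trans (ler_norm_sum _ _ _) _.
apply: (@le_trans _ _ (\sum_(p < m) c * (K / k.+1%:R))).
  by apply: ler_sum => p _; rewrite normrM ler_pM // thK.
by rewrite sumr_const card_ord -[leLHS]mulr_natl; rewrite le_eqVlt; apply/orP; left;
  rewrite mulrCA -!mulrA.
Qed.

Definition row_bound (x : 'rV[R]_m) : R := \sum_p `|x ord0 p|.
Lemma row_boundP x p : `|x ord0 p| <= row_bound x.
Proof. by rewrite /row_bound (bigD1 p) //= lerDl sumr_ge0. Qed.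
Lemma row_bound_ge0 x : 0 <= row_bound x.
Proof. exact: sumr_ge0. Qed.

Lemma decays_aff K th0 th x : 0 <= K -> decays K th0 -> (forall p, decays K (th^~ p)) ->
  decays (K + row_bound x * (m%:R * K)) (aff th0 th x).
Proof.
move=> K0 t0 t k i j; rewrite mulrDl; apply: le_trans (ler_normD _ _) (lerD _ _) => //.
exact: (decays_lin (row_boundP x)).
Qed.

Lemma affD th0 th x v k i j : aff th0 th (x + v) k i j =
  aff th0 th x k i j + lin_part th v k i j.
Proof.
rewrite /aff -addrA; congr (_ + _); rewrite -big_split; apply: eq_bigr => p _ /=.
by rewrite mxE mulrDl.
Qed.

End AffineClass.

(** The coordinates of S along any linear map into End(V) lie in this class. It is closed under
    directional derivatives, which gives smoothness, and its members expand in power series around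
    every point, which gives analyticity. *)
Definition rec_class (R : realType) (m : nat) (g : 'rV[R]_m -> R) :=
  exists (I : finType) (th0 : nat -> I -> I -> R) (th : nat -> 'I_m -> I -> I -> R)
    (z w : I -> R) (K : R),
  [/\ 0 <= K, decays K th0, forall p, decays K (th^~ p) &
      forall x, g x = asum (fun k => pairing w (zrec (aff th0 th x) z k))].

Section ClassDerivative.
Variables (R : realType) (m : nat).
Implicit Types (g : 'rV[R]_m -> R) (x v : 'rV[R]_m).

Lemma rec_class_shift g a : rec_class g -> rec_class (fun x => g (a + x)).
Proof.
move=> [I [th0 [th [z [w [K [K0 t0 t gE]]]]]]].
have K'0 : 0 <= K + row_bound a * (m%:R * K).
  by rewrite addr_ge0 // mulr_ge0 ?row_bound_ge0 // mulr_ge0.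
exists I, (aff th0 th a), th, z, w, (K + row_bound a * (m%:R * K)); split=> //.
- exact: decays_aff.
- by move=> p; apply: decays_mono (t p); rewrite lerDl mulr_ge0 ?row_bound_ge0 // mulr_ge0.
- move=> x; rewrite gE; congr asum; apply/funext => k; congr (pairing w (zrec _ z k)).
  by apply/funext => k'; apply/funext => i; apply/funext => j; rewrite affD.
Qed.

Lemma rec_class_increment g : rec_class g -> forall x, exists2 C : R, 0 <= C &
  forall (h : 'rV[R]_m) (eta : R), 0 <= eta <= 1 -> (forall p, `|h ord0 p| <= eta) ->
    `|g (x + h) - g x| <= eta * C.
Proof.
move=> [I [th0 [th [z [w [K [K0 t0 t gE]]]]]]] x.
set K' := K + row_bound x * (m%:R * K) + m%:R * K.
have rK : 0 <= row_bound x * (m%:R * K) by rewrite mulr_ge0 ?row_bound_ge0 // mulr_ge0.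
have K'0 : 0 <= K' by rewrite !addr_ge0 // mulr_ge0.
exists `|perturb_cst z w K'| => // h eta eta01 hp.
have TK : decays K' (aff th0 th x).
  by apply: decays_mono (decays_aff x K0 t0 t); rewrite lerDl mulr_ge0.
have HK : decays (eta * K') (lin_part th h).
  apply: decays_mono (decays_lin hp t); rewrite ler_wpM2l ?(andP eta01).1 //.
  by rewrite lerDr addr_ge0.
rewrite !gE; have -> : aff th0 th (x + h) =
    fun k i j => aff th0 th x k i j + lin_part th h k i j.
  by apply/funext => k'; apply/funext => i; apply/funext => j; rewrite affD.
apply: le_trans (asum_perturb1 z w K'0 TK eta01 HK) _.
by rewrite ler_wpM2l ?(andP eta01).1 // ler_norm.
Qed.

Lemma rec_class_continuous g : rec_class g -> continuous g.
Proof.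
move=> cg; suff H (x : 'rV[R]_m) : g @ x --> g x by exact: H.
have [C C0 HC] := rec_class_increment cg x.
apply/(@cvgrPdist_le _ R^o _ _ (nbhs_filter x)) => e e0.
have d0 : 0 < Num.min 1 (e / (C + 1)) by rewrite lt_min ltr01 divr_gt0 // ltr_wpDl.
set d := Num.min _ _ in d0.
near=> y; rewrite distrC.
have := HC (y - x) d; rewrite addrCA subrr addr0; move=> H.
apply: le_trans (H _ _) _.
- by rewrite (ltW d0) /= ge_min lexx.
- move=> p; rewrite mxE mxE distrC; apply/ltW.
  have : ball x d y by near: y; exact: nbhsx_ballx.
  by move=> [_ /(_ ord0 p)].
- apply: (@le_trans _ _ (e / (C + 1) * C)); first by rewrite ler_wpM2r // ge_min lexx orbT.
  by rewrite mulrAC ler_pdivrMr ?ltr_wpDl // ler_wpM2l ?(ltW e0) // lerDl.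
Unshelve. all: by end_near.
Qed.

Lemma dzrecZ (I : finType) (T H : nat -> I -> I -> R) (z : I -> R) (s : R) k i :
  dzrec T (fun k i j => s * H k i j) z k i = s * dzrec T H z k i.
Proof.
elim: k i => [|k IH] i /=; first by rewrite mulr0.
rewrite mulrDr /mxv !mulr_sumr; congr (_ + _); apply: eq_bigr => j _.
  by rewrite IH mulrCA.
by rewrite mulrA.
Qed.

Lemma rec_class_derive g v : rec_class g -> exists2 g' : 'rV[R]_m -> R, rec_class g' &
  forall x, exists C : R, forall s : R, `|s| <= 1 ->
    `|g (x + s *: v) - g x - s * g' x| <= s ^+ 2 * C.
Proof.
move=> [I [th0 [th [z [w [K [K0 t0 t gE]]]]]]].
(* The pair formed by the solution and its first-order variation in the direction v solves a block
   triangular recursion of the same class. The block coupling the two halves is constant in x, and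
   w' reads only the second half. *)
pose I' : finType := (I + I)%type.
pose b0 k (p q : I') := match p, q with
  | inl i, inl j => th0 k i j | inr i, inr j => th0 k i j
  | inr i, inl j => lin_part th v k i j | inl _, inr _ => 0 end.
pose b k r (p q : I') := match p, q with
  | inl i, inl j => th k r i j | inr i, inr j => th k r i j
  | inr i, inl j => 0 | inl _, inr _ => 0 end.
pose z' (p : I') := if p is inl i then z i else 0.
pose w' (p : I') := if p is inr i then w i else 0.
have mK : 0 <= m%:R * K by rewrite mulr_ge0.
set K' := K + row_bound v * (m%:R * K).
have K'0 : 0 <= K' by rewrite addr_ge0 // mulr_ge0 ?row_bound_ge0.
have KK' : K <= K' by rewrite lerDl mulr_ge0 ?row_bound_ge0.
have affE x k : (forall i j, aff b0 b x k (inl i) (inl j) = aff th0 th x k i j) /\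
    (forall i j, aff b0 b x k (inr i) (inr j) = aff th0 th x k i j) /\
    (forall i j, aff b0 b x k (inl i) (inr j) = 0) /\
    (forall i j, aff b0 b x k (inr i) (inl j) = lin_part th v k i j).
  have E0 : \sum_(p < m) x ord0 p * 0 = 0 by rewrite big1 // => p _; rewrite mulr0.
  by rewrite /aff /lin_part /=; split=> //; split=> //; split=> i j; rewrite E0 addr0.
have zE x k : (forall i, zrec (aff b0 b x) z' k (inl i) = zrec (aff th0 th x) z k i) /\
    (forall i, zrec (aff b0 b x) z' k (inr i) =
      dzrec (aff th0 th x) (lin_part th v) z k i).
  elim: k => [//|k [IH1 IH2]] /=; have [E1 [E2 [E3 E4]]] := affE x k.
  split=> i; rewrite /mxv big_sumType /=.
    rewrite [X in _ + X]big1 ?addr0 => [|j _]; last by rewrite E3 mul0r.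
    by apply: eq_bigr => j _; rewrite E1 IH1.
  rewrite addrC; congr (_ + _); apply: eq_bigr => j _; first by rewrite E2 IH2.
  by rewrite E4 IH1.
have b0K : decays K' b0.
  move=> k [i|i] [j|j] /=; rewrite ?normr0 ?divr_ge0 //.
  - exact: decays_mono KK' t0 k i j.
  - apply: (decays_mono _ (decays_lin (row_boundP v) t)).
    by rewrite lerDr.
  - exact: decays_mono KK' t0 k i j.
have bK p : decays K' (b^~ p).
  move=> k [i|i] [j|j] /=; rewrite ?normr0 ?divr_ge0 //; exact: decays_mono KK' (t p) k i j.
pose g' x := asum (fun k => pairing w (dzrec (aff th0 th x) (lin_part th v) z k)).
have pE x k : pairing w' (zrec (aff b0 b x) z' k) =
    pairing w (dzrec (aff th0 th x) (lin_part th v) z k).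
  rewrite /pairing big_sumType /= big1 ?add0r => [|i _]; last by rewrite mul0r.
  by apply: eq_bigr => i _; rewrite (zE x k).2.
exists g'.
  exists I', b0, b, z', w', K'; split=> // x.
  by congr asum; apply/funext => k; rewrite pE.
move=> x; set K2 := K' + row_bound x * (m%:R * K).
have K20 : 0 <= K2 by rewrite addr_ge0 // mulr_ge0 ?row_bound_ge0.
exists (perturb_cst z w K2) => s s1.
have TK : decays K2 (aff th0 th x).
  apply: decays_mono (decays_aff x K0 t0 t).
  by rewrite lerD2r.
have HK : decays (`|s| * K2) (fun k i j => s * lin_part th v k i j).
  move=> k i j; rewrite normrM -mulrA ler_wpM2l //.
  apply: (decays_mono _ (decays_lin (row_boundP v) t)).
  by rewrite /K2 /K' addrAC lerDr addr_ge0 // mulr_ge0 ?row_bound_ge0.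
have s01 : 0 <= `|s| <= 1 by rewrite normr_ge0.
have S3 : abs_summable (fun k => pairing w (dzrec (aff th0 th x) (lin_part th v) z k)).
  have -> : (fun k => pairing w (dzrec (aff th0 th x) (lin_part th v) z k)) =
     (fun k => pairing w' (zrec (aff b0 b x) z' k)).
    by apply/funext => k; rewrite pE.
  apply: zrec_summable (decays_aff x K'0 b0K bK).
  by rewrite addr_ge0 // !mulr_ge0 ?row_bound_ge0.
have dE k : pairing w (dzrec (aff th0 th x) (fun k i j => s * lin_part th v k i j) z k) =
    s * pairing w (dzrec (aff th0 th x) (lin_part th v) z k).
  rewrite /pairing mulr_sumr; apply: eq_bigr => i _.
  by rewrite dzrecZ mulrCA.
have S4 : abs_summable (fun k => pairing w (dzrec (aff th0 th x)
    (fun k i j => s * lin_part th v k i j) z k)).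
  have -> : (fun k => pairing w (dzrec (aff th0 th x)
    (fun k i j => s * lin_part th v k i j) z k)) = (fun k => s *
     pairing w (dzrec (aff th0 th x) (lin_part th v) z k)) by apply/funext => k; rewrite dE.
  exact: abs_summableZ.
have := asum_perturb2 (z := z) (w := w) K20 TK s01 HK S4.
rewrite real_normK ?num_real // !gE.
have -> : aff th0 th (x + s *: v) =
    fun k i j => aff th0 th x k i j + s * lin_part th v k i j.
  apply/funext => k; apply/funext => i; apply/funext => j; rewrite affD; congr (_ + _).
  by rewrite mulr_sumr; apply: eq_bigr => p _; rewrite mxE mulrA.
have -> : (fun k => pairing w (dzrec (aff th0 th x)
    (fun k i j => s * lin_part th v k i j) z k)) = (fun k => s *
     pairing w (dzrec (aff th0 th x) (lin_part th v) z k)) by apply/funext => k; rewrite dE.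
by rewrite asumZ.
Qed.

Lemma quadratic_is_derive g v x (d C : R) : (forall s : R, `|s| <= 1 ->
    `|g (x + s *: v) - g x - s * d| <= s ^+ 2 * C) ->
  is_derive x v (g : 'rV[R]_m -> R^o) d.
Proof.
move=> H.
have lim : (fun h : R => h^-1 *: ((g \o shift x) (h *: v) - g x : R^o)) @ 0^' --> (d : R^o).
  apply/cvgrPdist_le => e e0.
  have C1 : 0 < `|C| + 1 by rewrite ltr_wpDl.
  near=> h.
  have h0 : h != 0 by near: h; exact: nbhs_dnbhs_neq.
  have hs : `|h| <= Num.min 1 (e / (`|C| + 1)).
    near: h; apply: dnbhs0_le.
    by rewrite lt_min ltr01 divr_gt0.
  have h1 : `|h| <= 1 by apply: le_trans hs _; rewrite ge_min lexx.
  have hC : `|h| * `|C| <= e.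
    apply: (@le_trans _ _ (e / (`|C| + 1) * `|C|)).
      by rewrite ler_wpM2r //; apply: le_trans hs _; rewrite ge_min lexx orbT.
    by rewrite mulrAC ler_pdivrMr // ler_wpM2l ?(ltW e0) // lerDl.
  have := H h h1; rewrite /= [h *: v + x]addrC => Hh.
  have -> : d - h^-1 *: (g (x + h *: v) - g x) =
      - (h^-1 * (g (x + h *: v) - g x - h * d)).
    by rewrite [in RHS]mulrBr mulKf // opprB.
  rewrite normrN normrM normfV ler_pdivrMl ?normr_gt0 //.
  apply: le_trans Hh _; rewrite -real_normK ?num_real // expr2 -mulrA ler_wpM2l //.
  apply: le_trans hC; rewrite ler_wpM2l //; exact: ler_norm.
split; first by apply/cvg_ex; exists d.
exact: cvg_lim lim.
Unshelve. all: by end_near.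
Qed.

Lemma rec_class_smooth g : rec_class g -> smooth g.
Proof.
move=> cg k; elim: k g cg => [|k IH] g cg; first exact: rec_class_continuous.
have D v : exists2 g', rec_class g' & forall x, is_derive x v (g : 'rV[R]_m -> R^o) (g' x).
  have [g' cg' H] := rec_class_derive v cg; exists g' => // x.
  by have [C HC] := H x; exact: quadratic_is_derive HC.
split=> [x v|v]; first by have [g' _ /(_ x) H] := D v; exact: ex_derive.
have [g' cg' H] := D v.
have -> : (fun x => 'D_v (g : 'rV[R]_m -> R^o) x) = g'.
  by apply/funext => x; case: (H x).
exact: IH.
Qed.

End ClassDerivative.

Lemma asum_sum (R : realType) (I : Type) (r : seq I) (F : I -> nat -> R) :
  (forall i, abs_summable (F i)) ->
  asum (fun k => \sum_(i <- r) F i k) = \sum_(i <- r) asum (F i).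
Proof.
move=> FS; apply: asumE.
have -> : (fun N => \sum_(k < N) \sum_(i <- r) F i k) =
    (fun N => \sum_(i <- r) \sum_(k < N) F i k).
  by apply/funext => N; rewrite exchange_big.
by apply: cvg_sumr => i; exact: abs_summable_cvg.
Qed.

Lemma norm1_sum (R : realType) (I : finType) (J : Type) (r : seq J) (P : pred J)
    (F : J -> I -> R) :
  norm1 (fun i => \sum_(j <- r | P j) F j i) <= \sum_(j <- r | P j) norm1 (F j).
Proof.
rewrite /norm1 exchange_big /=; apply: ler_sum => i _; exact: ler_norm_sum.
Qed.

(** * Power series expansion in several variables *)

Section Monomials.
Variables (R : realType) (m : nat).
Implicit Types (h : 'I_m -> R) (al : 'I_m -> nat) (p q : 'I_m).

Definition mon h al : R := \prod_(i < m) h i ^+ al i.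
Definition dec p al q : nat := if q == p then (al q).-1 else al q.

Lemma mon_dec h al p : (0 < al p)%N -> mon h al = h p * mon h (dec p al).
Proof.
move=> ap; rewrite /mon (bigD1 p) //= [in RHS](bigD1 p) //= mulrA; congr (_ * _).
  by rewrite /dec eqxx -exprS prednK.
by apply: eq_bigr => i /negbTE ip; rewrite /dec ip.
Qed.

Lemma mon_norm h al : `|mon h al| = mon (fun i => `|h i|) al.
Proof. by rewrite /mon normr_prod; apply: eq_bigr => i _; rewrite normrX. Qed.

Lemma mon_le h h' al : (forall i, 0 <= h i <= h' i) -> mon h al <= mon h' al.
Proof.
move=> hh; apply: ler_prod => i _; have /andP[h0 hh'] := hh i.
by rewrite exprn_ge0 //= lerXn2r ?nnegrE // (le_trans h0).
Qed.

Lemma mon_ge0 h al : (forall i, 0 <= h i) -> 0 <= mon h al.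
Proof. by move=> h0; apply: prodr_ge0 => i _; rewrite exprn_ge0. Qed.

Variable N : nat.
Implicit Types (a : {ffun 'I_m -> 'I_N}).

Definition dec_ffun p a : {ffun 'I_m -> 'I_N} :=
  [ffun q => if q == p then Ordinal (leq_ltn_trans (leq_pred (a q)) (ltn_ord (a q)))
             else a q].
Definition inc_ffun p a : {ffun 'I_m -> 'I_N} :=
  [ffun q => if q == p then insubd (a q) (a q).+1 else a q].

Lemma dec_ffunE p a : (fun q => dec_ffun p a q : nat) = dec p (fun q => a q).
Proof. by apply/funext => q; rewrite /dec_ffun /dec ffunE; case: eqP. Qed.

(** On the box of exponents below N, [inc_ffun] inverts [dec_ffun]; the default of [insubd] is
    reached only when (a p) + 1 = N, which the range on the right excludes. *)
Lemma sum_dec p (F : {ffun 'I_m -> 'I_N} -> R) :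
  \sum_(a : {ffun 'I_m -> 'I_N} | (0 < a p)%N) F (dec_ffun p a) =
  \sum_(a : {ffun 'I_m -> 'I_N} | ((a p).+1 < N)%N) F a.
Proof.
rewrite [RHS](reindex_onto (dec_ffun p) (inc_ffun p)) /=; last first.
  move=> a ap; apply/ffunP => q; apply: val_inj; rewrite /dec_ffun /inc_ffun !ffunE.
  by case: eqP => // -> /=; rewrite val_insubd ap.
apply: eq_bigl => a; apply/idP/andP => [ap|[ap /eqP ap']].
  have E : ((dec_ffun p a p).+1 = a p)%N by rewrite /dec_ffun ffunE eqxx /= prednK.
  split; first by rewrite E.
  apply/eqP/ffunP => q; apply: val_inj; rewrite /inc_ffun ffunE.
  case: eqP => [->|qp]; last by rewrite /dec_ffun ffunE; case: eqP qp.
  by rewrite val_insubd E ltn_ord.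
by rewrite -ap' /inc_ffun ffunE eqxx val_insubd ap.
Qed.

End Monomials.

Section Expansion.
Variables (R : realType) (m : nat) (I : finType).
Variables (th0 : nat -> I -> I -> R) (th : nat -> 'I_m -> I -> I -> R).
Variables (z w : I -> R) (K : R).
Hypotheses (K0 : 0 <= K) (th0K : decays K th0) (thK : forall p, decays K (th^~ p)).
Implicit Types (al : 'I_m -> nat) (h : 'I_m -> R).

(* coefficient of h^al in zrec (aff th0 th h) z k *)
Fixpoint coef k al : I -> R :=
  match k with
  | 0 => fun i => if [forall q, al q == 0%N] then z i else 0
  | k'.+1 => fun i => mxv (th0 k') (coef k' al) i +
     \sum_(p < m | (0 < al p)%N) mxv (th k' p) (coef k' (dec p al)) i
  end.

Lemma mxv0 (A : I -> I -> R) f i : (forall j, f j = 0) -> mxv A f i = 0.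
Proof. by move=> f0; rewrite /mxv big1 // => j _; rewrite f0 mulr0. Qed.

Lemma coef_supp k al q i : (k < al q)%N -> coef k al i = 0.
Proof.
elim: k al i => [|k IH] al i kq /=.
  by case: forallP => // /(_ q) /eqP alq; rewrite alq in kq.
rewrite mxv0 ?add0r => [|j]; last by apply: IH; exact: ltnW.
rewrite big1 // => p p0; apply: mxv0 => j; apply: IH.
rewrite /dec; case: eqP => _; last exact: ltnW.
by move: kq; case: (al q).
Qed.

Definition coef_norm (r : R) N k : R :=
  \sum_(a : {ffun 'I_m -> 'I_N}) norm1 (coef k (fun q => a q)) * mon (fun=> r) (fun q => a q).

Let L r := #|I|%:R * (K * (1 + m%:R * r)).

(** Raising one exponent costs a factor r in weight, and there are m exponents to raise, so the
    weighted norm obeys a scalar recursion with factor #|I| K (1 + m r) / (k + 1). Truncation to the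
    box only drops nonnegative terms. *)
Lemma coef_norm_le r N k : 0 <= r ->
  coef_norm r N k <= norm1 z * (L r ^+ k / k`!%:R).
Proof.
move=> r0; elim: k => [|k IH].
  rewrite expr0 fact0 divr1 mulr1 /coef_norm.
  have nz (a : {ffun 'I_m -> 'I_N}) : ~~ [forall q, a q == 0%N :> nat] ->
      norm1 (coef 0 (fun q => a q)) = 0.
    by move=> /negbTE a0; rewrite /norm1 big1 // => i _ /=; rewrite a0 normr0.
  have [a0 /forallP a00|none] := pickP (fun a : {ffun 'I_m -> 'I_N} =>
      [forall q, a q == 0%N :> nat]); last first.
    by rewrite big1 ?norm1_ge0 // => a _; rewrite nz ?mul0r // none.
  rewrite (bigD1 a0) //= big1 ?addr0 => [|a aa0].
    rewrite /mon big1 ?mulr1 => [|q _]; last by rewrite (eqP (a00 q)) expr0.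
    by apply: ler_sum => i _ /=; case: ifP => _ //; rewrite normr0.
  rewrite nz ?mul0r //; apply/forallP => H; case/eqP: aa0; apply/ffunP => q.
  by apply: val_inj; rewrite /= (eqP (H q)) (eqP (a00 q)).
set F := fun a : {ffun 'I_m -> 'I_N} => norm1 (coef k (fun q => a q)) * mon (fun=> r) (fun q => a q).
have F0 a : 0 <= F a by rewrite mulr_ge0 ?norm1_ge0 // mon_ge0.
have cK : 0 <= #|I|%:R * (K / k.+1%:R) by rewrite mulr_ge0 // divr_ge0.
apply: (@le_trans _ _ (#|I|%:R * (K / k.+1%:R) * ((1 + m%:R * r) * coef_norm r N k))).
  rewrite mulrDl mul1r mulrDr /coef_norm.
  apply: (@le_trans _ _ (\sum_(a : {ffun 'I_m -> 'I_N})
     (#|I|%:R * (K / k.+1%:R) * F a + \sum_(p < m | (0 < a p)%N)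
       #|I|%:R * (K / k.+1%:R) * (r * F (dec_ffun p a))))).
    apply: ler_sum => a _ /=.
    apply: (@le_trans _ _ ((#|I|%:R * (K / k.+1%:R) * norm1 (coef k (fun q => a q)) +
      \sum_(p < m | (0 < a p)%N) #|I|%:R * (K / k.+1%:R) *
         norm1 (coef k (dec p (fun q => a q)))) * mon (fun=> r) (fun q => a q))).
      rewrite ler_wpM2r ?mon_ge0 //; apply: le_trans (norm1_add _ _) (lerD _ _).
        exact: norm1_mxv.
      apply: le_trans (norm1_sum _ _ _) _; apply: ler_sum => p _.
      by apply: norm1_mxv => i j; exact: thK.
    rewrite mulrDl -[X in X + _ <= _]mulrA lerD2l mulr_suml; apply: ler_sum => p ap.
    by rewrite (@mon_dec _ _ (fun=> r) (fun q => a q) p ap) /F !dec_ffunE -!mulrA [r * (_ * _)]mulrCA.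
  rewrite big_split /= -mulr_sumr lerD2l.
  under eq_bigr do rewrite -mulr_sumr.
  rewrite -mulr_sumr ler_wpM2l // -mulrA.
  rewrite (exchange_big_dep predT) //=.
  apply: (@le_trans _ _ (\sum_(p < m) r * \sum_(a : {ffun 'I_m -> 'I_N}) F a)).
    apply: ler_sum => p _; rewrite -mulr_sumr ler_wpM2l //.
    rewrite (sum_dec p F) [leRHS](bigID (fun a : {ffun 'I_m -> 'I_N} => ((a p).+1 < N)%N)) /=.
    by rewrite lerDl sumr_ge0.
  by rewrite sumr_const card_ord -[leLHS]mulr_natl.
apply: le_trans (ler_wpM2l cK (ler_wpM2l _ IH)) _; first by rewrite addr_ge0 // mulr_ge0.
rewrite exprS factS natrM invfM le_eqVlt; apply/orP; left; apply/eqP; rewrite {1}/L.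
have E (a b c d f g x : R) : f * (g * b) * (x * (d * (a * c))) = d * (f * (g * x) * a * (b * c)).
  by ring.
exact: E.
Qed.

(** By [coef_supp] all exponents occurring in [coef k] are at most k, so for k < N the box of
    exponents below N misses none of them and the finite sum is exact. *)
Lemma coef_eval (h : 'rV[R]_m) N k i : (k < N)%N ->
  \sum_(a : {ffun 'I_m -> 'I_N}) coef k (fun q => a q) i * mon (fun q => h ord0 q) (fun q => a q) =
  zrec (aff th0 th h) z k i.
Proof.
elim: k i => [|k IH] i kN.
  rewrite (bigD1 [ffun=> Ordinal kN]) //= big1 ?addr0 => [|a a0].
    rewrite /mon big1 ?mulr1 => [|q _]; last by rewrite ffunE expr0.
    by case: forallP => // -[] q; rewrite ffunE.
  case: forallP => [H|_]; last by rewrite mul0r.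
  by case/eqP: a0; apply/ffunP => q; apply: val_inj; rewrite ffunE /=; apply/eqP/H.
have {}IH j := IH j (ltnW kN).
have exch (A : I -> I -> R) : \sum_(a : {ffun 'I_m -> 'I_N})
    mxv A (coef k (fun q => a q)) i * mon (fun q => h ord0 q) (fun q => a q) =
    mxv A (zrec (aff th0 th h) z k) i.
  under eq_bigr do rewrite /mxv mulr_suml.
  rewrite exchange_big; apply: eq_bigr => j _ /=; rewrite -IH mulr_sumr.
  by apply: eq_bigr => a _; rewrite mulrA.
under eq_bigr do rewrite /= mulrDl [X in _ + X]mulr_suml.
rewrite big_split /= exch (exchange_big_dep predT) //=.
transitivity (mxv (th0 k) (zrec (aff th0 th h) z k) i +
   \sum_(p < m) h ord0 p * mxv (th k p) (zrec (aff th0 th h) z k) i); last first.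
  rewrite /mxv; under [X in _ + X]eq_bigr do rewrite mulr_sumr.
  rewrite exchange_big -big_split; apply: eq_bigr => j _ /=.
  by rewrite /aff /lin_part mulrDl mulr_suml; congr (_ + _); apply: eq_bigr => p _; rewrite mulrA.
congr (_ + _); apply: eq_bigr => p _.
pose F (a : {ffun 'I_m -> 'I_N}) := mxv (th k p) (coef k (fun q => a q)) i *
  mon (fun q => h ord0 q) (fun q => a q).
transitivity (h ord0 p * \sum_(a : {ffun 'I_m -> 'I_N} | (0 < a p)%N) F (dec_ffun p a)).
  rewrite mulr_sumr; apply: eq_bigr => a ap.
  by rewrite (@mon_dec _ _ (fun q => h ord0 q) (fun q => a q) p ap) /F !dec_ffunE mulrCA.
congr (_ * _); rewrite (sum_dec p F) -exch.
rewrite [RHS](bigID (fun a : {ffun 'I_m -> 'I_N} => ((a p).+1 < N)%N)) /=.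
rewrite [X in _ = _ + X]big1 ?addr0 // => a ap; rewrite mxv0 ?mul0r // => j.
apply: (coef_supp (q := p)); move: ap; rewrite -leqNgt => ap.
by have := leq_trans kN ap.
Qed.

Definition ser_coef al : R := asum (fun k => pairing w (coef k al)).

Let B r k := norm1 w * norm1 z * (L r ^+ k / k`!%:R).
Let B_summable r : 0 <= r -> abs_summable (B r).
Proof. by move=> r0; apply: exp_abs_summable; rewrite mulr_ge0 ?norm1_ge0. Qed.
Let B_ge0 r k : 0 <= r -> 0 <= B r k.
Proof.
move=> r0; have L0 : 0 <= L r by rewrite !mulr_ge0 // addr_ge0 // mulr_ge0.
by rewrite !mulr_ge0 ?norm1_ge0 ?invr_ge0 // exprn_ge0.
Qed.

(** The weights s serve three purposes: the indicator of one multi-index, signs times powers of r,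
    and the monomials in h. *)
Lemma sum_coef_le r N k (s : {ffun 'I_m -> 'I_N} -> R) : 0 <= r ->
  (forall a, `|s a| <= mon (fun=> r) (fun q => a q)) ->
  `|\sum_(a : {ffun 'I_m -> 'I_N}) s a * pairing w (coef k (fun q => a q))| <= B r k.
Proof.
move=> r0 sr; apply: le_trans (ler_norm_sum _ _ _) _.
rewrite /B -mulrA; apply: le_trans (ler_wpM2l (norm1_ge0 _) (coef_norm_le N k r0)).
rewrite mulr_sumr; apply: ler_sum => a _; rewrite normrM mulrC mulrA.
by apply: ler_pM => //; exact: pairing_le.
Qed.

Lemma coef_summable al : abs_summable (fun k => pairing w (coef k al)).
Proof.
apply: abs_summable_le (B_summable ler01) => k; rewrite [leRHS]ger0_norm ?B_ge0 //.
pose N := (\sum_i al i).+1.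
have alN i : (al i < N)%N by rewrite ltnS (bigD1 i) //= leq_addr.
pose a0 : {ffun 'I_m -> 'I_N} := [ffun i => Ordinal (alN i)].
have a0E : (fun q => nat_of_ord (a0 q)) = al by apply/funext => q; rewrite ffunE.
have := @sum_coef_le 1 N k (fun a => (a == a0)%:R) ler01.
rewrite (bigD1 a0) //= eqxx mul1r big1 ?addr0 => [|a /negbTE ->]; last by rewrite mul0r.
rewrite a0E; apply => a; rewrite /mon big1 => [|i _]; last by rewrite expr1n.
by case: eqP; rewrite ?normr1 ?normr0.
Qed.

Lemma psum_le_asum (b : nat -> R) N : (forall k, 0 <= b k) -> abs_summable b ->
  \sum_(k < N) b k <= asum b.
Proof.
move=> b0 sb; apply: limr_ge; first by have := abs_summable_cvg sb; apply: cvgP.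
exists N => // N' /= NN'; rewrite -!(big_mkord predT b).
by rewrite [leRHS](big_cat_nat (n := N)) //= lerDl sumr_ge0.
Qed.

Lemma ser_coef_bound r : 0 <= r -> exists M : R, forall N,
  \sum_(a : {ffun 'I_m -> 'I_N}) `|ser_coef (fun q => a q)| * mon (fun=> r) (fun q => a q) <= M.
Proof.
move=> r0; exists (asum (B r)) => N.
(* Writing an absolute value as sign times coefficient keeps the expression linear, so the finite
   sum over a can be exchanged with the series in k. *)
pose s (a : {ffun 'I_m -> 'I_N}) := Num.sg (ser_coef (fun q => a q)) * mon (fun=> r) (fun q => a q).
have -> : \sum_(a : {ffun 'I_m -> 'I_N}) `|ser_coef (fun q => a q)| * mon (fun=> r) (fun q => a q) =
    asum (fun k => \sum_(a : {ffun 'I_m -> 'I_N}) s a * pairing w (coef k (fun q => a q))).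
  rewrite asum_sum => [|a]; last by apply/abs_summableZ/coef_summable.
  apply: eq_bigr => a _; rewrite asumZ; last exact: coef_summable.
  by rewrite normrEsg /s mulrAC.
apply: le_trans (ler_norm _) _; apply: asum_norm_le => N'.
apply: le_trans (psum_le_asum N' (fun k => B_ge0 k r0) (B_summable r0)).
apply: ler_sum => k _; apply: sum_coef_le => // a.
rewrite /s normrM [X in _ * X]ger0_norm ?mon_ge0 // ler_piMl ?mon_ge0 //.
by rewrite normr_sg lern1 leq_b1.
Qed.

(** By [coef_eval] the terms with k < N agree exactly with those of the limit; each later term
    differs by at most 2 B r k, so the error is controlled by a tail of the majorant. *)
Lemma ser_coef_cvg r (h : 'rV[R]_m) : 0 <= r -> (forall q, `|h ord0 q| <= r) ->
  (fun N => \sum_(a : {ffun 'I_m -> 'I_N})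
     ser_coef (fun q => a q) * mon (fun q => h ord0 q) (fun q => a q)) @ \oo -->
  asum (fun k => pairing w (zrec (aff th0 th h) z k)).
Proof.
move=> r0 hr; pose mh N (a : {ffun 'I_m -> 'I_N}) := mon (fun q => h ord0 q) (fun q => a q).
have mhr N a : `|@mh N a| <= mon (fun=> r) (fun q => a q).
  by rewrite /mh mon_norm; apply: mon_le => q; rewrite normr_ge0 hr.
have zE N k : (k < N)%N -> pairing w (zrec (aff th0 th h) z k) =
    \sum_(a : {ffun 'I_m -> 'I_N}) mh N a * pairing w (coef k (fun q => a q)).
  move=> kN; rewrite /pairing; under [RHS]eq_bigr do rewrite mulr_sumr.
  rewrite exchange_big; apply: eq_bigr => i _ /=.
  rewrite -(coef_eval h i kN) mulr_sumr; apply: eq_bigr => a _.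
  by rewrite mulrCA [in RHS]mulrC -mulrA mulrCA.
have zB k : `|pairing w (zrec (aff th0 th h) z k)| <= B r k.
  by rewrite (zE k.+1) //; apply: sum_coef_le.
have zS : abs_summable (fun k => pairing w (zrec (aff th0 th h) z k)).
  by apply: abs_summable_le (B_summable r0) => k; rewrite [leRHS]ger0_norm ?B_ge0.
apply/cvgrPdist_le => e e0; have e2 : 0 < e / 2 by rewrite divr_gt0.
have [M HM] := abs_summable_tail (B_summable r0) e2.
exists M => // N /= MN.
have cS a : abs_summable (fun k => mh N a * pairing w (coef k (fun q => a q))).
  by apply/abs_summableZ/coef_summable.
have -> : \sum_(a : {ffun 'I_m -> 'I_N}) ser_coef (fun q => a q) *
      mon (fun q => h ord0 q) (fun q => a q) =
    asum (fun k => \sum_(a : {ffun 'I_m -> 'I_N}) mh N a * pairing w (coef k (fun q => a q))).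
  rewrite asum_sum //; apply: eq_bigr => a _.
  by rewrite (asumZ (mh N a) (coef_summable (fun q => a q))) mulrC.
have sS := abs_summable_sum (index_enum _) cS.
rewrite -[X in _ - X]mul1r -mulNr -asumZ // -asumD //; last exact: abs_summableZ.
apply: asum_norm_le => N'.
set t := fun k : nat => `|pairing w (zrec (aff th0 th h) z k) + -1 *
  \sum_(a : {ffun 'I_m -> 'I_N}) mh N a * pairing w (coef k (fun q => a q))|.
have t0 k : (k < N)%N -> t k = 0 by move=> kN; rewrite /t (zE N) // mulN1r subrr normr0.
have tB k : t k <= 2 * B r k.
  rewrite /t mulN1r mulrDl mul1r; apply: le_trans (ler_normB _ _) (lerD (zB k) _).
  exact: sum_coef_le.
rewrite -(big_mkord predT t); have [N'N|NN'] := leqP N' N.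
  by rewrite big_nat big1 ?(ltW e0) // => k /andP[_ kN']; apply/t0/(leq_trans kN').
rewrite (big_cat_nat (n := N)) ?(ltnW NN') //= big_nat big1 ?add0r; last first.
  by move=> k /andP[_]; exact: t0.
apply: (@le_trans _ _ (2 * \sum_(N <= k < N') `|B r k|)).
  by rewrite mulr_sumr; apply: ler_sum => k _; rewrite ger0_norm ?B_ge0.
apply: le_trans (ler_wpM2l _ (HM N N' MN (ltnW NN'))) _ => //.
by rewrite mulrC divfK.
Qed.

End Expansion.

(** The coefficients are chosen before r, so a single expansion is valid on the whole space;
    [rec_class_entire] relies on this. *)
Lemma rec_class_expansion (R : realType) (m : nat) (g : 'rV[R]_m -> R) (x : 'rV[R]_m) :
  rec_class g -> exists c : ('I_m -> nat) -> R, forall r : R, 0 < r ->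
  (exists M : R, forall N, \sum_(a : {ffun 'I_m -> 'I_N})
     `|c (fun i => a i)| * \prod_(i < m) r ^+ a i <= M) /\
  forall h : 'rV[R]_m, (forall i, `|h ord0 i| < r) ->
     (fun N => \sum_(a : {ffun 'I_m -> 'I_N})
       c (fun i => a i) * \prod_(i < m) h ord0 i ^+ a i) @ \oo --> g (x + h).
Proof.
move=> /(rec_class_shift x)[I [th0 [th [z [w [K [K0 t0 t gE]]]]]]].
exists (ser_coef th0 th z w) => r r0; split.
  by have [M HM] := ser_coef_bound z w K0 t0 t (ltW r0); exists M => N; exact: HM.
move=> h hr; rewrite gE.
exact: (ser_coef_cvg K0 t0 t (ltW r0) (fun q => ltW (hr q))).
Qed.

Lemma rec_class_analytic (R : realType) (m : nat) (g : 'rV[R]_m -> R) :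
  rec_class g -> real_analytic g.
Proof.
move=> cg x; have [c Hc] := rec_class_expansion x cg.
by exists 1, c; have [M cvg] := Hc 1 ltr01; split=> //; exact: ltr01.
Qed.

Section CoordFamilies.
Variables (R : realType) (U : lmodType R).

Lemma rec_coord (m : nat) (I : finType) (b : I -> U)
    (th0 : nat -> I -> I -> R) (th : nat -> 'I_m -> I -> I -> R) (z : I -> R) (K : R)
    (u : 'rV[R]_m -> nat -> U) :
  0 <= K -> decays K th0 -> (forall p, decays K (th^~ p)) ->
  (forall x k, u x k = \sum_i zrec (aff th0 th x) z k i *: b i) ->
  (forall x, coord_sum (u x) (vsum (u x))) /\
  forall l : {scalar U}, rec_class (fun x => l (vsum (u x))).
Proof.
move=> K0 t0 t uE.
have cS x i : abs_summable (fun k => zrec (aff th0 th x) z k i).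
  have -> : (fun k => zrec (aff th0 th x) z k i) =
      (fun k => pairing (fun j => (j == i)%:R) (zrec (aff th0 th x) z k)).
    apply/funext => k; rewrite /pairing (bigD1 i) //= eqxx mul1r big1 ?addr0 //.
    by move=> j /negbTE ->; rewrite mul0r.
  apply: zrec_summable (decays_aff x K0 t0 t).
  by rewrite addr_ge0 // !mulr_ge0 ?row_bound_ge0.
have uS x : coord_sum (u x) (\sum_i asum (fun k => zrec (aff th0 th x) z k i) *: b i).
  by exists I, b, (zrec (aff th0 th x) z); split.
have uV x : vsum (u x) = \sum_i asum (fun k => zrec (aff th0 th x) z k i) *: b i.
  exact: coord_sum_vsum.
split=> [x|l]; first by rewrite uV.
exists I, th0, th, z, (fun i => l (b i)), K; split=> // x.
rewrite uV linear_sum /=.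
transitivity (asum (fun k => \sum_i l (b i) * zrec (aff th0 th x) z k i)) => //.
rewrite asum_sum => [|i]; last exact: abs_summableZ.
by apply: eq_bigr => i _; rewrite linearZ asumZ // mulrC.
Qed.

(* multipliers mu cover the series sum_k c_k T^k with |c_k| <= 1 / k! *)
Lemma exp_coord_sum (T : U -> U) (b : seq U) (x : U) (mu : nat -> R) :
  linear T -> in_span b x -> {in b, forall y, in_span b (T y)} ->
  (forall k, `|mu k| <= 1) ->
  let u k := mu k *: ((k`!%:R^-1 : R) *: iter k T x) in coord_sum u (vsum u).
Proof.
move=> lT [z0 xE] bT mu1 u.
pose bi (i : 'I_(size b)) := b`_i.
have [t tE] : {t : 'I_(size b) -> 'I_(size b) -> R & forall i, T (bi i) = \sum_j t j i *: bi j}.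
  have ex (i : 'I_(size b)) : exists t : 'I_(size b) -> R, T (bi i) = \sum_j t j *: bi j.
    have [c cE] := bT _ (mem_nth 0 (ltn_ord i)); exists (fun j => c j).
    by rewrite -cE.
  by have /choice[t tE] := ex; exists (fun j i => t i j).
pose K := \sum_i \sum_j `|t i j|.
have tK i j : `|t i j| <= K.
  rewrite /K (bigD1 i) //= (bigD1 j) //= -addrA lerDl addr_ge0 // sumr_ge0 // => k _.
  exact: sumr_ge0.
have K0 : 0 <= K by apply: sumr_ge0 => i _; exact: sumr_ge0.
pose th0 (k : nat) i j := t i j / k.+1%:R.
have t0K : decays K th0 by move=> k i j; rewrite normrM normfV normr_nat ler_wpM2r.
pose z (i : 'I_(size b)) := z0 i.
have uE k : (k`!%:R^-1 : R) *: iter k T x = \sum_i zrec th0 z k i *: bi i.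
  elim: k => [|k IH]; first by rewrite fact0 invr1 scale1r /= xE.
  rewrite factS natrM invfM -scalerA iterS -(lin_funZ lT) IH (lin_fun_sum lT).
  rewrite scaler_sumr /= /mxv; under [RHS]eq_bigr do rewrite scaler_suml.
  rewrite exchange_big; apply: eq_bigr => j _ /=.
  rewrite (lin_funZ lT) tE !scaler_sumr; apply: eq_bigr => i _.
  rewrite !scalerA /th0; congr (_ *: _).
  by rewrite [t i j / _]mulrC -!mulrA [zrec _ _ _ _ * _]mulrC.
suff uS : coord_sum u (\sum_i asum (fun k => mu k * zrec th0 z k i) *: bi i).
  by rewrite (coord_sum_vsum uS).
exists 'I_(size b), bi, (fun k i => mu k * zrec th0 z k i); split=> // [k|i].
  rewrite /u uE scaler_sumr; apply: eq_bigr => i _; by rewrite scalerA.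
have S : abs_summable (fun k => pairing (fun j => (j == i)%:R) (zrec th0 z k)).
  exact: zrec_summable t0K.
apply: abs_summable_le S => k; rewrite /pairing (bigD1 i) //= eqxx mul1r big1 ?addr0.
  by rewrite normrM ler_piMl.
by move=> j /negbTE ->; rewrite mul0r.
Qed.

Lemma is_vsumD (u v : nat -> U) x y : is_vsum u x -> is_vsum v y ->
  is_vsum (fun k => u k + v k) (x + y).
Proof.
move=> ux vy l; rewrite linearD /=.
have -> : (fun N => \sum_(k < N) l (u k + v k)) =
    (fun N => \sum_(k < N) l (u k) + \sum_(k < N) l (v k)).
  by apply/funext => N; rewrite -big_split; apply: eq_bigr => k _; rewrite linearD.
exact: cvgD (ux l) (vy l).
Qed.

Lemma is_vsum0 : is_vsum (fun=> 0) (0 : U).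
Proof.
move=> l; rewrite linear0; under eq_fun do rewrite big1 ?linear0 //.
  exact: cvg_cst.
Qed.

End CoordFamilies.

Lemma linear_pack (R : realType) (U W : lmodType R) (f : U -> W) : linear f ->
  exists L : {linear U -> W}, L =1 f.
Proof.
move=> fl; pose H := GRing.isLinear.Build R U W *:%R f fl.
by exists (HB.pack_for {linear U -> W} f H).
Qed.

(** * The series S *)

Section SSeries.
Variables (R : realType) (V : vectType R) (Q : V -> R).
Hypotheses (HQ : is_qform Q) (Qnd : nondegenerate_qform Q).
Local Notation iv := (Defs.contraction Q).
Local Notation cv := (clvar (@zero_form R V)).

Section Basis.
Variables (n : nat) (e e' : n.-tuple V).
Hypothesis ee' : dual_bases Q e e'.
Implicit Types (A : 'End(V)).

Lemma lambda_linear : linear (lambda e e').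
Proof.
move=> c A C; rewrite /lambda scalerA mulrC -scalerA -scalerDr; congr (_ *: _).
rewrite scaler_sumr -big_split; apply: eq_bigr => a _ /=.
by rewrite !lfunE /= lfunE /= linearP mulr_linear.
Qed.

Definition S_step A (x : ext V) : ext V :=
  contr Q (lambda e e' A) x + 4^-1 *: (lambda e e' A * x).

Lemma S_step_linear A : linear (S_step A).
Proof.
apply: linear_addf; first exact: contr_linear.
exact/linear_scalef/mul_linear.
Qed.

Lemma S_step_linearl x : linear (fun A => S_step A x).
Proof.
apply: linear_addf; first exact: (linear_comp (contr_linearl HQ x) lambda_linear).
apply: linear_scalef => c B C; rewrite lambda_linear; exact: mulr_linear.
Qed.

(* coefficient of t^k in S(t A): the solution of (k + N) s_k = D s_(k - 1), with
   N the degree operator and D = S_step A *)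
Fixpoint S_coef A (k : nat) : ext V :=
  if k is k'.+1 then resolv n k (S_step A (S_coef A k')) else 1.

Lemma S_coefS A k : k.+1%:R *: S_coef A k.+1 + euler Q e e' (S_coef A k.+1) = S_step A (S_coef A k).
Proof. exact: (resolvK HQ ee'). Qed.

Lemma S_coef_parity A k : parity (S_coef A k) = S_coef A k.
Proof.
elim: k => [|k IH] /=; first exact: parity1.
rewrite resolv_parity /S_step parityD parityZ parityM -(contr_parity HQ).
by rewrite !lambda_parity IH.
Qed.

Lemma S_coefZ t A k : S_coef (t *: A) k = t ^+ k *: S_coef A k.
Proof.
elim: k => [|k IH]; first by rewrite expr0 scale1r.
rewrite /= IH (lin_funZ (S_step_linear _)) (lin_funZ (S_step_linearl _)) scalerA.
by rewrite -exprSr (lin_funZ (@resolv_linear _ _ _ _)).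
Qed.

Definition S_fun A : ext V := vsum (S_coef A).

(** In a finite generating list the degree components of [S_step] become fixed matrices, linear in
    A, so the constant part th0 is 0. The resolvent contributes 1/(k + 1 + d), at most 1/(k + 1),
    which is the decay that is required. *)
Lemma S_coef_coord (m : nat) (L : {linear 'rV[R]_m -> 'End(V)}) :
  (forall x, coord_sum (S_coef (L x)) (S_fun (L x))) /\
  forall l : {scalar ext V}, rec_class (fun x => l (S_fun (L x))).
Proof.
have [b [bx _]] := ext_span HQ ee'.
pose bi (i : 'I_(size b)) := b`_i.
have /choice[co coE] : forall x, exists c : 'I_(size b) -> R, x = \sum_i c i *: bi i.
  by move=> x; have [c ->] := bx x; exists (fun j => c j).
pose Lp (p : 'I_m) := L (delta_mx ord0 p).
pose t (d : nat) p i j : R := co (grade (S_step (Lp p) (bi j)) d) i.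
pose th (k : nat) p i j : R := \sum_(d < n.+1) (k.+1 + d)%:R^-1 * t d p i j.
pose K : R := \sum_(d < n.+1) \sum_p \sum_i \sum_j `|t d p i j|.
have tK (d : 'I_n.+1) p i j : `|t d p i j| <= \sum_p \sum_i \sum_j `|t d p i j|.
  rewrite (bigD1 p) //= (bigD1 i) //= (bigD1 j) //= -!addrA lerDl.
  by rewrite !addr_ge0 // !sumr_ge0 // => *; rewrite ?sumr_ge0 // => *; rewrite sumr_ge0.
have K0 : 0 <= K.
  by do 4 (apply: sumr_ge0 => ? _).
have thK p : decays K (th^~ p).
  move=> k i j; apply: le_trans (ler_norm_sum _ _ _) _.
  rewrite /K mulr_suml; apply: ler_sum => d _; rewrite normrM normfV normr_nat mulrC.
  apply: ler_pM; [exact: normr_ge0|by rewrite invr_ge0 ler0n|exact: tK|].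
  by rewrite lef_pV2 ?posrE ?ltr0n ?addn_gt0 // ler_nat leq_addr.
pose th0 (k : nat) (i j : 'I_(size b)) : R := 0.
have t0K : decays K th0 by move=> k i j; rewrite normr0 divr_ge0.
apply: (rec_coord (b := bi) (z := co 1) K0 t0K thK) => x k.
elim: k => [|k IH]; first by rewrite /= -coE.
have LE : L x = \sum_p x ord0 p *: Lp p.
  rewrite {1}[x]row_sum_delta linear_sum; apply: eq_bigr => p _.
  by rewrite linearZ.
rewrite /= IH (lin_fun_sum (S_step_linear _)) (lin_fun_sum (@resolv_linear _ _ _ _)).
rewrite /mxv; under [RHS]eq_bigr do rewrite scaler_suml.
rewrite [RHS]exchange_big; apply: eq_bigr => j _ /=.
rewrite (lin_funZ (S_step_linear _)) (lin_funZ (@resolv_linear _ _ _ _)).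
under [RHS]eq_bigr do rewrite mulrC -scalerA.
rewrite -scaler_sumr; congr (_ *: _).
rewrite LE (lin_fun_sum (S_step_linearl _)) (lin_fun_sum (@resolv_linear _ _ _ _)).
under [RHS]eq_bigr do rewrite /aff /th0 add0r /lin_part scaler_suml.
rewrite [RHS]exchange_big; apply: eq_bigr => p _ /=.
rewrite (lin_funZ (S_step_linearl _)) (lin_funZ (@resolv_linear _ _ _ _)).
under [RHS]eq_bigr do rewrite -scalerA.
rewrite -scaler_sumr; congr (_ *: _).
under [RHS]eq_bigr do rewrite /th scaler_suml.
rewrite [RHS]exchange_big /resolv; apply: eq_bigr => d _ /=.
rewrite {1}[grade _ d]coE scaler_sumr; apply: eq_bigr => i _.
by rewrite scalerA.
Qed.

Lemma S_coef_sum A : coord_sum (S_coef A) (S_fun A).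
Proof.
have lL : linear (fun x : 'rV[R]_1 => x ord0 ord0 *: A).
  by move=> c x y; rewrite !mxE scalerDl scalerA.
have [L LE] := linear_pack lL.
have [/(_ (const_mx 1)) + _] := S_coef_coord L.
suff -> : L (const_mx 1) = A by [].
by rewrite LE mxE scale1r.
Qed.

Lemma S_fun_parity A : parity (S_fun A) = S_fun A.
Proof.
have H := coord_sum_lin (linear_of (@parity _ _ (@zero_form R V))) (S_coef_sum A).
rewrite -(coord_sum_vsum H); congr vsum; apply/funext => k.
exact: S_coef_parity.
Qed.

Lemma S_fun_analytic : analytic_on (orthogonal_lie Q) S_fun.
Proof. by move=> m L _ l; apply: rec_class_analytic; apply: (S_coef_coord L).2. Qed.

End Basis.

(** The bases enter the recursion only through [lambda], which is canonical by [dual_change], and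
    through their length in [resolv]. *)
Lemma S_coef_change (n m : nat) (e e' : n.-tuple V) (g g' : m.-tuple V) A :
  dual_bases Q e e' -> dual_bases Q g g' -> S_fun e e' A = S_fun g g' A.
Proof.
move=> ee' gg'.
have nm : n = m.
  by rewrite -(size_basis ee'.1) -(size_basis gg'.1).
have lE : lambda e e' A = lambda g g' A.
  rewrite /lambda; congr (_ *: _).
  have Fb : bilinear_fun (fun u w => cv (A u) * cv w).
    split=> [u|w] c x y; first by rewrite linearP mul_linear.
    by rewrite !linearP mulr_linear.
  exact: (dual_change HQ Qnd ee' Fb gg').
rewrite /S_fun; congr vsum; apply/funext; elim=> [//|k IH] /=.
by rewrite IH /S_step lE nm.
Qed.

(** * The operators that annihilate S(A) *)

Section WIdentity.
Variables (n : nat) (e e' : n.-tuple V).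
Hypothesis ee' : dual_bases Q e e'.
Variable A : 'End(V).
Hypothesis oA : orthogonal_lie Q A.
Local Notation s := (S_coef e e' A).
Local Notation sA := (S_step e e' A).
Local Notation eul := (euler Q e e').
Local Notation j := (@j_coef R).
Local Notation dj := (@dj_coef R).

Lemma S_step_iv v x : sA (iv v x) = iv v (sA x) + 4^-1 *: (cv (A v) * x).
Proof.
rewrite /S_step (lin_funD (iv_linear HQ v)) (lin_funZ (iv_linear HQ v)).
rewrite (iv_lambdaM HQ Qnd ee' oA) (contr_lambda_iv HQ) -addrA -scalerDr.
by rewrite subrK.
Qed.

Lemma S_step_var v x : sA (cv v * x) = cv v * sA x + iv (A v) x.
Proof.
rewrite /S_step mulrDr mulZr (contr_lambda_varM HQ Qnd ee' oA) addrAC.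
by rewrite !mulrA lambdaC.
Qed.

(** Coefficientwise form of (z j)'' = z j / 4, which holds because z j(z) = 2 sinh(z/2). *)
Lemma j_coef_rec k : (k.+2 * k.+3)%:R * j k.+2 = 4^-1 * j k.
Proof.
rewrite /j_coef !oddS negbK; case: (odd k); first by rewrite !mulr0.
have f0 : (k.+1)`!%:R != 0 :> R by rewrite pnatr_eq0 -lt0n fact_gt0.
have p0 : (2 : R) ^+ k != 0 by rewrite expf_neq0 // pnatr_eq0.
rewrite [(k.+3)`!]factS [(k.+2)`!]factS !exprS.
move: f0 p0; move: (k.+1)`! (2 ^+ k : R) => f p f0 p0; rewrite !natrM.
have a0 : k.+2%:R != 0 :> R by rewrite pnatr_eq0.
have b0 : k.+3%:R != 0 :> R by rewrite pnatr_eq0.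
move: f0 a0 b0; move: (f%:R : R) (k.+2%:R : R) (k.+3%:R : R) => a c d a0 c0 d0; field.
by rewrite a0 p0 c0 d0.
Qed.

(* part of degree k in A of iota_{j(A) u} S(A) + j'(A) u S(A) *)
Definition Wterm u k : ext V := \sum_(i < k.+1)
  (iv (j i *: iter i A u) (s (k - i)%N) + cv (dj i *: iter i A u) * s (k - i)%N).

(** The terms satisfy (k + 2 + N) W_(k+1) = D W_k with W_0 = 0. Contraction lowers the degree by one
    and multiplication raises it, which produces the weights i and i + 2. The leftovers come from
    the commutators of D: with iota_v it gives A v / 4, with v it gives iota_{A v}. They cancel by
    the definition of j' ([T1]) and by [j_coef_rec] ([T2]). *)
Lemma Wterm0 u k : Wterm u k = 0.
Proof.
elim: k => [|k IH].
  rewrite /Wterm big_ord_recl big_ord0 addr0 subnn /= (iv1 HQ) add0r mulr1.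
  rewrite /dj_coef /pseries_diffs {1}/j_coef /= mulr0 scale0r.
  by rewrite linear0.
rewrite -[LHS](resolvK' HQ ee' _ (ltn0Sn k.+1)).
suff -> : k.+2%:R *: Wterm u k.+1 + eul (Wterm u k.+1) = sA (Wterm u k).
  rewrite IH (lin_fun0 (S_step_linear _ _ _)) (lin_fun0 (@resolv_linear _ _ _ _)) //.
pose a i := iter i A u; pose w i := j i *: a i; pose w' i := dj i *: a i.
pose P i := iv (w i) (s (k.+1 - i)%N); pose P' i := cv (w' i) * s (k.+1 - i)%N.
have eulS r : eul (s r) + r%:R *: s r = if r is r'.+1 then sA (s r') else 0.
  case: r => [|r]; first by rewrite (euler1 HQ) scale0r addr0.
  by rewrite addrC S_coefS.
have E1 (i : 'I_k.+2) : k.+2%:R *: P i + eul (P i) = i%:R *: P i +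
    iv (w i) (eul (s (k.+1 - i)%N) + (k.+1 - i)%:R *: s (k.+1 - i)%N).
  rewrite /P (euler_iv HQ ee') (lin_funD (iv_linear HQ _)) (lin_funZ (iv_linear HQ _)).
  have -> : k.+2%:R = i%:R + (k.+1 - i)%:R + 1 :> R by rewrite -natrD subnKC ?natr1 // -ltnS.
  move: (iv _ (eul _)) (iv _ (s _)) => y x; rewrite !scalerDl scale1r.
  by rewrite [y - x]addrC addrA addrK -addrA [_ *: x + y]addrC.
have E2 (i : 'I_k.+2) : k.+2%:R *: P' i + eul (P' i) = i.+2%:R *: P' i +
    cv (w' i) * (eul (s (k.+1 - i)%N) + (k.+1 - i)%:R *: s (k.+1 - i)%N).
  rewrite /P' (euler_varM HQ ee') mulrDr mulZr.
  have -> : k.+2%:R = i%:R + (k.+1 - i)%:R + 1 :> R by rewrite -natrD subnKC ?natr1 // -ltnS.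
  move: (cv _ * eul _) (cv _ * s _) => y x.
  rewrite -[i.+2%:R]natr1 -[i.+1%:R]natr1 !scalerDl scale1r.
  by rewrite [RHS](AC (3*2) (1*5*2*(3*4))%AC).
have S1 : \sum_(i < k.+2) iv (w i) (eul (s (k.+1 - i)%N) + (k.+1 - i)%:R *: s (k.+1 - i)%N) =
    \sum_(i < k.+1) (sA (iv (w i) (s (k - i)%N)) - 4^-1 *: (cv (A (w i)) * s (k - i)%N)).
  rewrite big_ord_recr /= subnn eulS (lin_fun0 (iv_linear HQ _)) addr0.
  apply: eq_bigr => i _; have ik : (i <= k)%N by rewrite -ltnS.
  by rewrite eulS (subSn ik) S_step_iv addrK.
have S2 : \sum_(i < k.+2) cv (w' i) * (eul (s (k.+1 - i)%N) + (k.+1 - i)%:R *: s (k.+1 - i)%N) =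
    \sum_(i < k.+1) (sA (cv (w' i) * s (k - i)%N) - iv (A (w' i)) (s (k - i)%N)).
  rewrite big_ord_recr /= subnn eulS mulr0 addr0.
  apply: eq_bigr => i _; have ik : (i <= k)%N by rewrite -ltnS.
  by rewrite eulS (subSn ik) S_step_var addrK.
have T1 : \sum_(i < k.+2) i%:R *: P i = \sum_(i < k.+1) iv (A (w' i)) (s (k - i)%N).
  rewrite big_ord_recl scale0r add0r; apply: eq_bigr => i _ /=.
  rewrite /P /w /w' /bump /= add1n subSS linearZ /= /dj_coef /pseries_diffs -[A (a i)]/(a i.+1).
  by rewrite !(bilinear_funZl (iv_bilinear HQ)) scalerA.
have T2 : \sum_(i < k.+2) i.+2%:R *: P' i =
    \sum_(i < k.+1) 4^-1 *: (cv (A (w i)) * s (k - i)%N).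
  rewrite big_ord_recl {1}/P' /w' {1}/dj_coef /pseries_diffs {1}/j_coef /= mulr0 scale0r.
  rewrite linear0 mul0r scaler0 add0r; apply: eq_bigr => i _ /=.
  rewrite /P' /w /w' /bump /= add1n subSS !linearZ /= -[A (a i)]/(a i.+1) !mulZl !scalerA.
  rewrite -j_coef_rec /dj_coef /pseries_diffs mulrA -natrM.
  by rewrite mulnC.
transitivity (\sum_(i < k.+2) (k.+2%:R *: P i + eul (P i)) +
              \sum_(i < k.+2) (k.+2%:R *: P' i + eul (P' i))).
  rewrite /Wterm (lin_fun_sum (euler_linear HQ _ _)) scaler_sumr -!big_split.
  apply: eq_bigr => i _ /=; rewrite (lin_funD (euler_linear HQ _ _)) scalerDr.
  exact: addrACA.
under eq_bigr do rewrite E1; under [X in _ + X]eq_bigr do rewrite E2.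
rewrite !big_split /= S1 S2 T1 T2 !sumrB /Wterm (lin_fun_sum (S_step_linear _ _ _)).
under [RHS]eq_bigr do rewrite (lin_funD (S_step_linear _ _ _)).
rewrite [RHS]big_split /=.
set x1 := \sum_(i < _) iv (A _) _; set x2 := \sum_(i < _) sA (iv _ _).
set x3 := \sum_(i < _) _ *: _; set x4 := \sum_(i < _) sA (cv _ * _).
rewrite [x1 + _]addrC [x3 + _]addrC [LHS](AC (3*3) (1*2*6*(4*5*3))%AC).
by rewrite /= !subrK.
Qed.

End WIdentity.
End SSeries.

Section PowerSeries.
Variables (R : realType) (V : vectType R).
Implicit Type A : 'End(V).

Lemma iter_comp_lfunE A k u : iter k (comp_lfun A) \1%VF u = iter k A u.
Proof. by elim: k => [|k IH] /=; rewrite lfunE /= ?IH. Qed.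

Lemma comp_lfun_linear A : linear (comp_lfun A : 'End(V) -> 'End(V)).
Proof. by move=> c B C; rewrite comp_lfunDr comp_lfunZr. Qed.

Lemma vect_span (U : vectType R) (x : U) : in_span (vbasis {:U}) x.
Proof.
rewrite (coord_vbasis (memvf x)); apply: in_span_sum => i _.
by apply/in_spanZ/in_span_mem/mem_nth; rewrite size_tuple.
Qed.

(** The bound says that c is dominated by the exponential series; c k * k! plays the part of the
    multipliers in [exp_coord_sum]. *)
Lemma power_series_sum (c : nat -> R) A : (forall k, `|c k * k`!%:R| <= 1) ->
  coord_sum (fun k => c k *: iter k (comp_lfun A) \1%VF) (power_series c A).
Proof.
move=> c1; have := exp_coord_sum (comp_lfun_linear A) (vect_span \1%VF)
  (fun y _ => vect_span (comp_lfun A y)) c1.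
congr (coord_sum _ (vsum _)); apply/funext => k; rewrite scalerA mulfK //;
  by rewrite pnatr_eq0 -lt0n fact_gt0.
Qed.

Lemma power_series_app_sum (c : nat -> R) A u : (forall k, `|c k * k`!%:R| <= 1) ->
  coord_sum (fun k => c k *: iter k A u) (power_series c A u).
Proof.
move=> /(@power_series_sum _ A) H.
have lu : linear (fun B : 'End(V) => B u) by move=> a B C; rewrite !lfunE /= lfunE.
have := coord_sum_lin lu H; congr coord_sum; apply/funext => k.
by rewrite lfunE /= iter_comp_lfunE.
Qed.

Lemma j_coef_bound k : `|j_coef R k * k`!%:R| <= 1.
Proof.
rewrite /j_coef; case: (odd k); first by rewrite mul0r normr0.
have f0 : k`!%:R != 0 :> R by rewrite pnatr_eq0 -lt0n fact_gt0.
rewrite factS natrM !invfM -!mulrA mulVf // mulr1 -invfM ger0_norm ?invr_ge0 ?mulr_ge0 ?exprn_ge0 //.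
by rewrite invf_le1 ?mulr_gt0 ?exprn_gt0 // -natrX -natrM ler1n muln_gt0 expn_gt0.
Qed.

Lemma dj_coef_bound k : `|dj_coef R k * k`!%:R| <= 1.
Proof.
rewrite /dj_coef /pseries_diffs -mulrA mulrCA -natrM -factS.
exact: j_coef_bound.
Qed.

Lemma j_of_sum A u : coord_sum (fun k => j_coef R k *: iter k A u) (j_of A u).
Proof. exact: power_series_app_sum j_coef_bound. Qed.

Lemma dj_of_sum A u : coord_sum (fun k => dj_coef R k *: iter k A u) (dj_of A u).
Proof. exact: power_series_app_sum dj_coef_bound. Qed.

End PowerSeries.

Section SIdentity.
Variables (R : realType) (V : vectType R) (Q : V -> R).
Hypotheses (HQ : is_qform Q) (Qnd : nondegenerate_qform Q).
Local Notation iv := (Defs.contraction Q).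
Local Notation cv := (clvar (@zero_form R V)).
Variables (n : nat) (e e' : n.-tuple V).
Hypothesis ee' : dual_bases Q e e'.
Variable A : 'End(V).
Hypothesis oA : orthogonal_lie Q A.

Lemma S_fun_killed u : iv (j_of A u) (S_fun Q e e' A) + cv (dj_of A u) * S_fun Q e e' A = 0.
Proof.
have SS := S_coef_sum HQ ee' A.
have cb : bilinear_fun (fun v x => cv v * x).
  split=> [v|x] c y z; first by rewrite mul_linear.
  by rewrite linearP mulr_linear.
have W1 := coord_sum_is_vsum (coord_sum_bil (iv_bilinear HQ) (j_of_sum A u) SS).
have W2 := coord_sum_is_vsum (coord_sum_bil cb (dj_of_sum A u) SS).
have := is_vsumD W1 W2; set w := (X in is_vsum X _) => wE.
have w0 : w = fun=> 0.
  apply/funext => k; rewrite /w -big_split /=.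
  exact: (Wterm0 HQ Qnd ee' oA).
rewrite -(vsumE wE) w0; exact: vsumE (@is_vsum0 _ _).
Qed.

End SIdentity.

Section Shift.
Variables (R : realType) (U : lmodType R).

Lemma is_vsum_shift (u : nat -> U) y : is_vsum u y ->
  is_vsum (fun k => u k.+1) (y - u 0%N).
Proof.
move=> uy l; rewrite linearB /=; have := uy l; rewrite -cvg_shiftS.
have -> : (fun N => \sum_(k < N) l (u k.+1)) =
    (fun N => \sum_(k < N.+1) l (u k) - l (u 0%N)).
  by apply/funext => N; rewrite big_ord_recl addrAC subrr add0r.
by move=> /cvgB; apply; exact: cvg_cst.
Qed.

End Shift.

(** * Closed form of S away from the poles *)

Section ExpDegreeTwo.
Variables (R : realType) (V : vectType R) (Q : V -> R).
Hypotheses (HQ : is_qform Q) (Qnd : nondegenerate_qform Q).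
Local Notation iv := (Defs.contraction Q).
Local Notation cv := (clvar (@zero_form R V)).
Variables (n : nat) (e e' : n.-tuple V).
Hypothesis ee' : dual_bases Q e e'.
Variable C : 'End(V).
Local Notation r := (lambda e e' C).
Local Notation eul := (euler Q e e').

Lemma euler_lambdaM x : eul (r * x) = 2 *: (r * x) + r * eul x.
Proof.
rewrite /lambda !mulZl !mulr_suml (lin_funZ (euler_linear HQ _ _)).
rewrite (lin_fun_sum (euler_linear HQ _ _)) scalerA mulrC -scalerA -scalerDr.
congr (_ *: _); rewrite scaler_sumr -big_split; apply: eq_bigr => a _ /=.
rewrite -!mulrA !(euler_varM HQ ee') mulrDr addrA.
by rewrite scaler_nat mulr2n.
Qed.

Lemma grade_lambdaM x d : grade (r * x) d = if d is d'.+2 then r * grade x d' else 0.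
Proof.
rewrite /lambda mulZl mulr_suml gradeZ (lin_fun_sum (@grade_linear _ _ d)).
case: d => [|[|d]].
- by rewrite big1 ?scaler0 // => a _; rewrite -mulrA grade_varM0.
- by rewrite big1 ?scaler0 // => a _; rewrite -mulrA grade_varMS grade_varM0 mulr0.
rewrite mulZl mulr_suml; congr (_ *: _); apply: eq_bigr => a _.
by rewrite -!mulrA !grade_varMS.
Qed.

Lemma eps_lambdaM x : eps (r * x) = 0.
Proof.
rewrite /lambda mulZl mulr_suml epsZ.
rewrite (lin_fun_sum (@eps_scalar R V : linear (_ : _ -> R^o))) big1 ?mulr0 // => a _.
by rewrite -mulrA eps_varM.
Qed.

Lemma lambda_exp_sum :
  coord_sum (fun k => (k`!%:R^-1 : R) *: r ^+ k) (Cl_exp r).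
Proof.
have [b [bx _]] := ext_span HQ ee'.
have := exp_coord_sum (mu := fun=> 1) (mul_linear r) (bx 1) (fun y _ => bx (r * y)).
have E : (fun k => 1 *: ((k`!%:R^-1 : R) *: iter k ( *%R r) 1)) =
    (fun k => (k`!%:R^-1 : R) *: r ^+ k).
  apply/funext => k; rewrite scale1r; congr (_ *: _).
  by elim: k => [//|k IH]; rewrite exprS -IH.
by rewrite E; apply=> k; rewrite normr1.
Qed.

Lemma euler_exp : eul (Cl_exp r) = 2 *: (r * Cl_exp r).
Proof.
have H := coord_sum_lin (linear_scalef 2 (mul_linear r)) lambda_exp_sum.
have := is_vsum_shift (coord_sum_is_vsum (coord_sum_lin (euler_linear HQ e e') lambda_exp_sum)).
rewrite fact0 invr1 scale1r expr0 (euler1 HQ) subr0 => /vsumE <-.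
rewrite -(coord_sum_vsum H); congr vsum; apply/funext => k.
have eul_pow i : eul (r ^+ i) = (2 * i%:R) *: r ^+ i.
  elim: i => [|i IH]; first by rewrite expr0 (euler1 HQ) mulr0 scale0r.
  rewrite exprS euler_lambdaM IH mulZr -scalerDl -[i.+1%:R]natr1 mulrDr mulr1.
  by rewrite addrC.
rewrite (lin_funZ (euler_linear HQ _ _)) eul_pow mulZr !scalerA exprS.
congr (_ *: _); rewrite factS natrM.
have a0 : k.+1%:R != 0 :> R by rewrite pnatr_eq0.
have f0 : k`!%:R != 0 :> R by rewrite pnatr_eq0 -lt0n fact_gt0.
by move: a0 f0; move: (k.+1%:R : R) (k`!%:R : R) => a f a0 f0; field; rewrite a0 f0.
Qed.

Lemma eps_exp : eps (Cl_exp r) = 1.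
Proof.
have el : linear (@eps R V : ext V -> R^o) by exact: eps_scalar.
have := is_vsum_shift (coord_sum_is_vsum (coord_sum_lin el lambda_exp_sum)).
rewrite fact0 invr1 scale1r expr0 eps1 => /vsumE H.
apply/eqP; rewrite -subr_eq0 -H; apply/eqP.
have -> : (fun k => eps (((k.+1)`!%:R^-1 : R) *: r ^+ k.+1) : R^o) = fun=> 0.
  by apply/funext => k; rewrite exprS epsZ eps_lambdaM mulr0.
exact: vsumE (@is_vsum0 _ _).
Qed.

(** In degrees the equation reads (d + 2) x_(d+2) = 2 r x_d and x_1 = 0, so a solution is determined
    by its scalar part; the difference from the expected multiple of exp(r) has scalar part 0. *)
Lemma euler_exp_uniq x : eul x = 2 *: (r * x) -> x = eps x *: Cl_exp r.
Proof.
move=> xE; pose z := x - eps x *: Cl_exp r.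
have zE : eul z = 2 *: (r * z).
  rewrite /z (lin_funB (euler_linear HQ _ _)) (lin_funZ (euler_linear HQ _ _)).
  by rewrite xE euler_exp mulrBr mulZr scalerBr !scalerA mulrC.
have z0 : eps z = 0.
  rewrite /z -scaleN1r epsD !epsZ eps_exp.
  by rewrite mulN1r mulr1 subrr.
suff : z = 0 by move=> /eqP; rewrite subr_eq0 => /eqP.
apply: (grade_inj HQ ee') => d.
rewrite (lin_fun0 (@grade_linear _ _ d)).
have [m] := ubnP d; elim: m d => // m IH [|[|d]] dm.
- by rewrite grade0E z0 scale0r.
- by rewrite -[LHS]scale1r -(grade_euler HQ ee' z 1) zE gradeZ grade_lambdaM scaler0.
apply/eqP; have := grade_euler HQ ee' z d.+2.
rewrite zE gradeZ grade_lambdaM IH ?mulr0 ?scaler0; last exact: ltnW.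
by move/esym/eqP; rewrite scaler_eq0 pnatr_eq0.
Qed.

End ExpDegreeTwo.

Section PoleFree.
Variables (R : realType) (V : vectType R) (Q : V -> R).
Hypotheses (HQ : is_qform Q) (Qnd : nondegenerate_qform Q).
Local Notation cv := (clvar (@zero_form R V)).
Variables (n : nat) (e e' : n.-tuple V).
Hypothesis ee' : dual_bases Q e e'.
Variable A : 'End(V).
Hypothesis oA : orthogonal_lie Q A.
Local Notation S := (S_fun Q e e' A).

Lemma S_fun_exp : lker (j_of A) == 0%VS -> S = eps S *: Cl_exp (frak_r e e' A).
Proof.
move=> j0; apply: (euler_exp_uniq HQ ee'); rewrite /euler.
have ivS w : Defs.contraction Q w S = - (cv (f_of A w) * S).
  have := S_fun_killed HQ Qnd ee' oA ((j_of A)^-1%VF w).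
  rewrite -[j_of A _]comp_lfunE lker0_compfV // id_lfunE -[dj_of A _]comp_lfunE.
  by move/eqP; rewrite addr_eq0 => /eqP.
have Fb : bilinear_fun (fun u w => cv (f_of A u) * cv w).
  split=> [u|w] c x y; first by rewrite linearP mul_linear.
  by rewrite !linearP mulr_linear.
rewrite /frak_r /lambda mulZl scalerA divff ?pnatr_eq0 // scale1r.
have /= -> := dual_swap HQ Qnd ee' Fb; rewrite mulr_suml; apply: eq_bigr => a _.
by rewrite ivS mulrN mulrA [X in X * _]ext_anticomm mulNr opprK.
Qed.

End PoleFree.

(** * Summation of the exponential identity *)

Section FinalIdentity.
Variables (R : realType) (V : vectType R) (Q : V -> R).
Hypotheses (HQ : is_qform Q) (Qnd : nondegenerate_qform Q).
Variables (n : nat) (e e' : n.-tuple V).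
Hypothesis ee' : dual_bases Q e e'.
Variable A : 'End(V).
Hypothesis oA : orthogonal_lie Q A.
Variables (E : lmodType R) (phi : {linear V -> E}).
Local Notation lam := (lambda e e' A).
Local Notation S := (S_fun Q e e' A).
Local Notation expV := (expo e e' phi).

(** E may be infinite-dimensional, but only products of the phi^a occur. [Cl_span] applied to these
    vectors gives a finite list which, tensored with one for V, spans a space stable under
    multiplication by the exponent. *)
Lemma expo_term_sum : coord_sum (expo_term e e' A phi) (gtensor_exp (expV lam)).
Proof.
have [b [bx _]] := ext_span HQ ee'.
have [||c [c1 cM _]] := @Cl_span R E (@zero_form R E)
  [seq phi v | v <- e'] (fun _ _ => True) => //.
pose d := [seq (pure x y : gtensor (@zero_form R V) (@zero_form R E)) | x <- b, y <- c].
have dP x y : in_span c y -> in_span d (pure x y).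
  have [cx ->] := bx x; rewrite (lin_fun_sum (pure_linearl _)) => cy.
  apply: in_span_sum => i _; rewrite pureZl; apply: in_spanZ.
  apply: in_span_lin cy; first exact: pure_linearr.
  move=> z zc; apply: in_span_mem; apply: allpairs_f => //.
  exact: mem_nth.
have dM : {in d, forall z, in_span d (expV lam * z)}.
  move=> z /allpairsP[[x y] [_ /= yc ->]]; rewrite expo_mul_pure.
  apply: in_spanD; first exact/dP/in_span_mem.
  apply/in_spanN/in_span_sum => i _; apply/dP/cM; last exact: in_span_mem.
  exact/map_f/mem_tnth.
pose u k : gtensor (@zero_form R V) (@zero_form R E) :=
  1 *: ((k`!%:R^-1 : R) *: iter k ( *%R (expV lam)) 1).
have uS : coord_sum u (vsum u).
  apply: (exp_coord_sum (mu := fun=> 1) (gtensor_mul_linear _) (dP 1 1 c1) dM) => k.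
  by rewrite normr1.
suff uE : u = expo_term e e' A phi by move: uS; rewrite uE.
apply/funext => k; rewrite /u scale1r; congr (_ *: _).
by elim: k => [//|k IH]; rewrite exprS -IH.
Qed.

Lemma quant_contr_exp :
  tmap1 (quant Q) (tmap1 (contr Q S) (gtensor_exp (gtl _ lam - ephi e e' _ phi))) =
  gtensor_exp (gtl _ (gamma Q e e' A) - ephi e e' Q phi).
Proof.
rewrite /gamma !(quantE HQ).
have lq : linear (tmap1 (qmap Q) : gtensor _ (@zero_form R E) -> gtensor Q (@zero_form R E)).
  exact: tmap1_linear (qmap_linear Q).
have lc a : linear (tmap1 (contr Q a) : _ -> gtensor _ (@zero_form R E)).
  exact: tmap1_linear (contr_linear HQ a).
have Fb : bilinear_fun (fun a (y : gtensor _ (@zero_form R E)) =>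
    (tmap1 (qmap Q) (tmap1 (contr Q a) y) : gtensor Q (@zero_form R E))).
  split=> [a|y] t x z; first by rewrite lc lq.
  rewrite -lq; congr tmap1; move: y; apply: tensor_lin_ext => //.
    by apply: linear_addf => //; exact: linear_scalef.
  move=> a b; rewrite !(tmap1_pure (contr_linear HQ _)).
  by rewrite (contr_linearl HQ) (pure_linearl _ t).
have H := coord_sum_bil Fb (S_coef_sum HQ ee' A) expo_term_sum.
rewrite -(coord_sum_vsum H) /gtensor_exp; congr vsum; apply/funext => k.
rewrite (@expoX_conv _ _ _ HQ Qnd _ _ _ ee' _ oA _ _ (S_coef Q e e' A)) //.
- by rewrite /conv_term (lin_fun_sum lq).
- exact: S_coef_parity.
- exact: S_coefS.
Qed.

End FinalIdentity.

(** * Poles of r and zeros of j *)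

Section ComplexExp.
Variable R : realType.
Local Notation C := (Rcomplex R).
Implicit Types z w : C.

(** [Rcomplex] is the complex field as a real vector space, so the same summation serves for complex
    numbers, endomorphisms and exterior elements. *)
Definition cexp z : C := vsum (fun k => (k`!%:R^-1 : R) *: z ^+ k).

Lemma scalecE (a : R) z : a *: z = (real_complex R a : C) * z.
Proof. by case: z => x y; rewrite /GRing.mul /=; congr Complex; ring. Qed.

Lemma cmul_bilinear : bilinear_fun (fun z w : C => z * w).
Proof.
by split=> z a x y; rewrite !scalecE ?mulrDr ?mulrDl ?mulrA // [z * _]mulrC.
Qed.

Lemma cexp_sum z : coord_sum (fun k => (k`!%:R^-1 : R) *: z ^+ k) (cexp z).
Proof.
pose b : seq C := [:: 1; Complex 0 1].
have bx w : in_span b w.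
  exists (fun k => if k is 0 then complex.Re w else complex.Im w).
  rewrite !big_ord_recl big_ord0 /= addr0; case: w => x y.
  by rewrite /GRing.scale /= /GRing.add /=; congr Complex; ring.
have := exp_coord_sum (mu := fun=> 1) (cmul_bilinear.1 z) (bx 1) (fun w _ => bx (z * w)).
have E : (fun k => 1 *: ((k`!%:R^-1 : R) *: iter k ( *%R z) 1)) =
    (fun k => (k`!%:R^-1 : R) *: z ^+ k).
  apply/funext => k; rewrite scale1r; congr (_ *: _).
  by elim: k => [//|k IH]; rewrite exprS -IH.
by rewrite E; apply=> k; rewrite normr1.
Qed.

Lemma cexpD z w : cexp (z + w) = cexp z * cexp w.
Proof.
have H := coord_sum_bil cmul_bilinear (cexp_sum z) (cexp_sum w).
rewrite -(coord_sum_vsum H) /cexp; congr vsum; apply/funext => k.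
rewrite addrC exprDn scaler_sumr; apply: eq_bigr => i _.
have ik : (i <= k)%N by rewrite -ltnS.
have f0 m : m`!%:R != 0 :> R by rewrite pnatr_eq0 -lt0n fact_gt0.
rewrite (bilinear_funZl cmul_bilinear) (bilinear_funZr cmul_bilinear) scalerA.
rewrite -(scaler_nat _ (w ^+ _ * _)) [w ^+ _ * _]mulrC.
have -> : 'C(k, i)%:R *: (z ^+ i * w ^+ (k - i)) = ('C(k, i)%:R : R) *: (z ^+ i * w ^+ (k - i)).
  by rewrite !scaler_nat.
rewrite scalerA; congr (_ *: _); rewrite -(bin_fact ik) !natrM !invfM.
by rewrite mulrC mulVKf // pnatr_eq0 -lt0n bin_gt0.
Qed.

Lemma cexp0 : cexp 0 = 1.
Proof.
apply: vsumE => l; have H : (fun N => \sum_(k < N.+1) l ((k`!%:R^-1 : R) *: (0 : C) ^+ k)) = fun=> l 1.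
  apply/funext => N; rewrite big_ord_recl big1 ?addr0 ?fact0 ?invr1 ?scale1r ?expr0 //.
  by move=> i _; rewrite expr0n /= scaler0 linear0.
by rewrite -cvg_shiftS H; exact: cvg_cst.
Qed.

Lemma complex_ReIm z : z = Complex (complex.Re z) (complex.Im z).
Proof. by case: z. Qed.

Lemma Re_cexp z : complex.Re (cexp z) = asum (fun k => complex.Re (z ^+ k) / k`!%:R).
Proof.
have lr : linear (@complex.Re R : C -> R^o) by move=> a [b c] [d f].
have [_ <-] := coord_sum_scalar (coord_sum_lin lr (cexp_sum z)).
by congr asum; apply/funext => k; rewrite mulrC; case: (z ^+ k).
Qed.

Lemma Im_cexp z : complex.Im (cexp z) = asum (fun k => complex.Im (z ^+ k) / k`!%:R).
Proof.
have lr : linear (@complex.Im R : C -> R^o) by move=> a [b c] [d f].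
have [_ <-] := coord_sum_scalar (coord_sum_lin lr (cexp_sum z)).
by congr asum; apply/funext => k; rewrite mulrC; case: (z ^+ k).
Qed.

Lemma asum_series (u : nat -> R) : asum u = limn (series u).
Proof.
by rewrite /asum /series /=; congr (limn _); apply/funext => N; rewrite big_mkord.
Qed.

Lemma cexp_real (a : R) : cexp (Complex a 0) = Complex (expR a) 0.
Proof.
have X k : (Complex a 0 : C) ^+ k = Complex (a ^+ k) 0 by exact: (esym (rmorphXn (real_complex R) k a)).
rewrite [LHS]complex_ReIm; congr Complex.
  by rewrite Re_cexp asum_series; congr (limn (series _)); apply/funext => k; rewrite X.
rewrite Im_cexp; apply: asumE; under eq_fun do under eq_bigr do rewrite X /= mul0r.
by under eq_fun do rewrite big1_eq; exact: cvg_cst.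
Qed.

Lemma cexp_imag (b : R) : cexp (Complex 0 b) = Complex (cos b) (sin b).
Proof.
have X k : (Complex 0 b : C) ^+ k = Complex ((~~ odd k)%:R * (-1) ^+ k./2 * b ^+ k)
    ((odd k)%:R * (-1) ^+ k.-1./2 * b ^+ k).
  elim: k => [|k IH]; first by rewrite !expr0 /= mul0r !mulr1.
  rewrite exprS IH {1}/GRing.mul /= !mul0r sub0r add0r negbK !exprS; congr Complex; last by ring.
  case: k {IH} => [|k] /=; first by rewrite !mul0r mulr0 oppr0.
  by rewrite [(-1) ^+ _.+1]exprS; ring.
rewrite [LHS]complex_ReIm; congr Complex.
  rewrite Re_cexp asum_series cos.unlock; congr (limn (series _)).
  by apply/funext => k; rewrite X.
rewrite Im_cexp asum_series sin.unlock; congr (limn (series _)).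
by apply/funext => k; rewrite X.
Qed.

Lemma sin_eq0 (x : R) : sin x = 0 -> exists k : int, x = pi * k%:~R.
Proof.
move=> sx; have pi0 := pi_gt0 R.
have sD (y : R) (k : nat) : sin (y + pi * k%:R) = (-1) ^+ k * sin y.
  elim: k => [|k IH]; first by rewrite mulr0 addr0 mul1r.
  by rewrite -natr1 mulrDr mulr1 addrA sinDpi IH exprS mulN1r mulNr.
have sDz (y : R) (k : int) : sin y = 0 -> sin (y + pi * k%:~R) = 0.
  move=> sy; case: k => k; first by rewrite sD sy mulr0.
  have := sD (y - pi * k.+1%:R) k.+1; rewrite subrK sy => /esym/eqP.
  by rewrite mulf_eq0 signr_eq0 /= NegzE mulrNz mulrN => /eqP.
pose k := Num.floor (x / pi).
have := floor_itv (x / pi); rewrite -/k => /andP[kx xk].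
have := sDz _ (- k) sx; rewrite mulrNz mulrN => s0.
exists k; apply/eqP; rewrite -subr_eq0; apply: contrapT => /negP ne.
have : 0 < sin (x - pi * k%:~R).
  apply: sin_gt0_pi; rewrite lt_def ne /= subr_ge0 mulrC -ler_pdivlMr // kx /=.
  by rewrite ltrBlDr -[X in _ < X + _]mul1r -mulrDl -ltr_pdivrMr // addrC -intrD1.
by rewrite s0 ltxx.
Qed.

Lemma cexp_eq1 z : cexp z = 1 -> exists k : int, z = Complex 0 (2 * pi * k%:~R).
Proof.
case: z => a b; have abE : Complex a b = (Complex a 0 : C) + Complex 0 b.
  by rewrite /GRing.add /= addr0 add0r.
rewrite {1}abE cexpD cexp_real cexp_imag -[_ * _]scalecE => -[ec es].
have sb : sin b = 0 by move/eqP: es; rewrite mulf_eq0 gt_eqF ?expR_gt0 //= => /eqP.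
have cb2 : cos b ^+ 2 = 1 by have := cos2Dsin2 b; rewrite sb expr0n addr0.
have cb : cos b = 1.
  move/eqP: cb2; rewrite sqrf_eq1 => /orP[/eqP //|/eqP cb].
  by have := expR_gt0 a; rewrite ltNge -oppr_ge0 -mulrN1 -cb ec ler01.
have a0 : a = 0 by apply: expR_inj; rewrite expR0 -ec cb mulr1.
have /sin_eq0[k bk] : sin (b / 2) = 0.
  have := cosD (b / 2) (b / 2); rewrite -splitr cb -!expr2 => c1.
  have := cos2Dsin2 (b / 2) => c2; apply/eqP; rewrite -sqrf_eq0; apply/eqP; lra.
exists k; rewrite a0; congr Complex.
by rewrite -mulrA -bk mulrCA divff ?mulr1 ?pnatr_eq0.
Qed.

End ComplexExp.

Section PoleFreeInjective.
Variables (R : realType) (V : vectType R).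
Implicit Type A : 'End(V).
Local Notation C := (Rcomplex R).
Local Notation toC := (map_mx (real_complex R)).
Local Notation N := (\dim {:V}).

Lemma power_series_comm (c : nat -> R) A : (forall k, `|c k * k`!%:R| <= 1) ->
  (A \o power_series c A = power_series c A \o A)%VF.
Proof.
move=> c1; have H := power_series_sum A c1.
have lr : linear (fun B : 'End(V) => (B \o A)%VF).
  by move=> a B D; rewrite comp_lfunDl comp_lfunZl.
rewrite -(coord_sum_vsum (coord_sum_lin (comp_lfun_linear A) H)).
rewrite -(coord_sum_vsum (coord_sum_lin lr H)); congr vsum; apply/funext => k.
rewrite -comp_lfunZr -comp_lfunZl; congr (_ *: _).
elim: k => [|k IH] /=; first by rewrite comp_lfun1r comp_lfun1l.
by rewrite {1}IH comp_lfunA.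
Qed.

Lemma endmx_comp (A B : 'End(V)) : endmx (A \o B)%VF = endmx B *m endmx A.
Proof. exact/passmx.mxof_comp/vbasisP. Qed.

(** j(A) commutes with A, so its complexified kernel is stable under A; being nonzero, it contains
    an eigenvector. *)
Lemma j_kernel_eigenvector A : lker (j_of A) != 0%VS ->
  exists (z : R[i]) (v : 'rV[R[i]]_N), [/\ v != 0,
    v *m toC (endmx A) = z *: v & v *m toC (endmx (j_of A)) = 0].
Proof.
move=> kj; set Jc := toC (endmx (j_of A)); set a := toC (endmx A).
have k0 : kermx Jc != 0.
  rewrite kermx_eq0 row_free_unit; apply: contra kj => Ju.
  have /row_free_inj Ji : row_free (endmx (j_of A)).
    by rewrite row_free_unit -(map_unitmx (real_complex R)).
  have bb := vbasisP {:V}.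
  apply/lker0P => u w juw; apply: (can_inj (passmx.rVofK bb)); apply: Ji.
  by rewrite -!(passmx.rVof_app _ bb) juw.
have aJ : a *m Jc = Jc *m a.
  by rewrite -!map_mxM -!endmx_comp power_series_comm //; exact: j_coef_bound.
pose b := row_base (kermx Jc).
have bst : stablemx b a.
  rewrite (eqmxMr _ (eq_row_base _)) eq_row_base.
  by apply/sub_kermxP; rewrite -mulmxA aJ mulmxA mulmx_ker mul0mx.
have [z /eigenvalueP[w wz w0]] := @eigenvalue_closed R[i] _ (b *m a *m pinvmx b)
  ltac:(by rewrite lt0n mxrank_eq0).
exists z, (w *m b); split.
- by rewrite mulmx_free_eq0 // row_base_free.
- by rewrite -mulmxA -[b *m a](mulmxKpV bst) mulmxA wz scalemxAl.
- apply/sub_kermxP; apply: submx_trans (submxMl _ _) _.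
  by rewrite eq_row_base.
Qed.

(** On an eigenvector of eigenvalue z in the kernel, j(A) acts as j(z), so j(z) = 0. Since j(0) = 1,
    z is nonzero, and z j(z) = exp(z/2) - exp(-z/2) gives exp(z) = 1; hence z is one of the excluded
    eigenvalues. *)
Lemma pole_free_lker A : pole_free A -> lker (j_of A) == 0%VS.
Proof.
move=> pf; apply: contrapT => /negP /j_kernel_eigenvector[z [v [v0 vz vj]]].
have [q vq] : exists q, v ord0 q != 0 by apply/rV0Pn.
(* If v is an eigenvector of X, then F X is its eigenvalue, read off at a nonzero entry of v. Being
   linear, F carries the series of j(A) to that of j(z) term by term. *)
pose F (X : 'End(V)) : C := (v ord0 q)^-1 * (v *m toC (endmx X)) ord0 q.
have Fl : linear F.
  move=> c X Y; rewrite /F /endmx passmx.mxof_linear map_mxD map_mxZ mulmxDr -scalemxAr !mxE.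
  by rewrite mulrDr scalecE mulrCA.
have Fk k : F (iter k (comp_lfun A) \1%VF) = z ^+ k.
  have -> : iter k (comp_lfun A) \1%VF = iter k (fun B => B \o A)%VF \1%VF.
    elim: k => [//|k IH] /=; rewrite -IH; elim: k {IH} => [|k IH] /=.
      by rewrite comp_lfun1r comp_lfun1l.
    by rewrite {1}IH comp_lfunA.
  suff E : v *m toC (endmx (iter k (fun B => B \o A)%VF \1%VF)) = z ^+ k *: v.
    by rewrite /F E mxE mulrCA mulVf // mulr1.
  elim: k => [|k IH] /=.
    by rewrite expr0 scale1r /endmx passmx.mxof1 ?map_mx1 ?mulmx1 // (basis_free (vbasisP _)).
  rewrite endmx_comp map_mxM mulmxA vz -scalemxAl IH scalerA.
  by rewrite -exprS.
have js : coord_sum (fun k => j_coef R k *: (z : C) ^+ k) 0.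
  have := coord_sum_lin Fl (power_series_sum A (@j_coef_bound R)).
  have -> : F (power_series (j_coef R) A) = 0.
    by rewrite /F -/(j_of A) vj mxE mulr0.
  by congr coord_sum; apply/funext => k; rewrite (lin_funZ Fl) Fk.
have z0 : z != 0.
  apply/eqP => z0; have := is_vsum_shift (coord_sum_is_vsum js).
  have -> : j_coef R 0 *: (z : C) ^+ 0 = 1.
    by rewrite /j_coef /= mul1r invr1 scale1r.
  have -> : (fun k => j_coef R k.+1 *: (z : C) ^+ k.+1) = fun=> 0.
    by apply/funext => k; rewrite z0 exprS mul0r scaler0.
  move=> /vsumE; rewrite (vsumE (@is_vsum0 _ _)) sub0r => /esym/eqP.
  by rewrite oppr_eq0 oner_eq0.
pose h : C := (2^-1 : R) *: (z : C).
have : cexp h - cexp (- h) = 0.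
  have := is_vsum_shift (is_vsumD (coord_sum_is_vsum (cexp_sum h))
    (coord_sum_is_vsum (coord_sum_lin (linear_oppf (@linear_of _ _ _ idfun)) (cexp_sum (- h))))).
  rewrite /= !expr0 subrr subr0 => /vsumE <-.
  have [cr _] := cmul_bilinear R; have H := coord_sum_lin (cr (z : C)) js.
  rewrite mulr0 in H; rewrite -(coord_sum_vsum H); congr vsum; apply/funext => k.
  rewrite -scalerBr exprNn (bilinear_funZr (cmul_bilinear R)) -exprS.
  have -> : h ^+ k.+1 = ((2 ^+ k.+1)^-1 : R) *: (z : C) ^+ k.+1.
    elim: (k.+1) => [|i IH]; first by rewrite !expr0 invr1 scale1r.
    rewrite exprS IH /h (bilinear_funZl (cmul_bilinear R)) (bilinear_funZr (cmul_bilinear R)).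
    by rewrite scalerA -!exprS -invfM -exprS.
  rewrite -signr_odd /= /j_coef; move: ((z : C) ^+ k.+1) => y.
  case: (odd k) => /=; first by rewrite expr0 mul1r subrr scaler0 scale0r.
  rewrite expr1 mulN1r opprK scalerDr -mulr2n -scaler_nat !scalerA; congr (_ *: _).
  rewrite exprS [(2 : R) * 2 ^+ k]mulrC !invfM.
  by rewrite [_ / 2]mulrC mulrACA divff ?pnatr_eq0 // mul1r mulrC.
move=> /subr0_eq hh.
have : cexp z = 1.
  have -> : z = h + h by rewrite -(@Defs.half_double _ _ (z : C)) scalerDr.
  by rewrite cexpD {2}hh -cexpD subrr cexp0.
move=> /cexp_eq1[k zk]; have k0 : k != 0.
  by apply: contraNneq z0 => k0; rewrite zk k0 mulr0.
have /negP[] := pf k k0; apply/eigenvalueP; exists v => //.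
by rewrite -zk.
Qed.

End PoleFreeInjective.

(** * Entire functions of one variable *)

Section Entire.
Variable R : realType.
Implicit Types (c d : nat -> R) (f g : R -> R).

Definition entire c f :=
  forall t, abs_summable (fun k => c k * t ^+ k) /\ asum (fun k => c k * t ^+ k) = f t.

Definition dser c k := k.+1%:R * c k.+1.

Lemma entireD c d f g : entire c f -> entire d g ->
  entire (fun k => c k + d k) (fun t => f t + g t).
Proof.
move=> cf dg t; have [sc <-] := cf t; have [sd <-] := dg t.
have E : (fun k => (c k + d k) * t ^+ k) = (fun k => c k * t ^+ k + d k * t ^+ k).
  by apply/funext => k; rewrite mulrDl.
by rewrite E asumD //; split=> //; exact: abs_summableD.
Qed.

Lemma entire_at0 c f : entire c f -> c 0%N = f 0.
Proof.
move=> cf; have [_ <-] := cf 0; symmetry; apply: asumE; rewrite -cvg_shiftS.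
suff -> : (fun N => \sum_(k < N.+1) c k * 0 ^+ k) = fun=> c 0%N by exact: cvg_cst.
apply/funext => N; rewrite big_ord_recl mulr1 big1 ?addr0 // => i _.
by rewrite expr0n mulr0.
Qed.

Lemma entireZ a c f : entire c f -> entire (fun k => a * c k) (fun t => a * f t).
Proof.
move=> cf t; have [sc <-] := cf t.
have E : (fun k => a * c k * t ^+ k) = (fun k => a * (c k * t ^+ k)).
  by apply/funext => k; rewrite mulrA.
by rewrite E asumZ //; split=> //; exact: abs_summableZ.
Qed.

Lemma entireM c d f g : entire c f -> entire d g ->
  entire (cauchy_prod c d) (fun t => f t * g t).
Proof.
move=> cf dg t; have [sc <-] := cf t; have [sd <-] := dg t.
have E : (fun k => cauchy_prod c d k * t ^+ k) = cauchy_prod (fun k => c k * t ^+ k) (fun k => d k * t ^+ k).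
  apply/funext => k; rewrite /cauchy_prod mulr_suml; apply: eq_bigr => i _.
  by rewrite mulrACA -exprD subnKC // -ltnS.
by rewrite E conv_asum //; split=> //; exact: conv_abs_summable.
Qed.

Lemma entire_cst a : entire (fun k => (k == 0)%N%:R * a) (fun=> a).
Proof.
move=> t; have S N : \sum_(k < N.+1) ((k == 0 :> nat)%:R * a) * t ^+ k = a.
  by rewrite big_ord_recl mul1r mulr1 big1 ?addr0 // => i _; rewrite !mul0r.
split; last by apply: asumE; rewrite -cvg_shiftS; under eq_fun do rewrite S; exact: cvg_cst.
exists `|a| => -[|N]; first by rewrite big_ord0.
by rewrite big_ord_recl mul1r mulr1 big1 ?addr0 // => i _; rewrite !mul0r normr0.
Qed.

Lemma dserM c d k : dser (cauchy_prod c d) k = cauchy_prod (dser c) d k + cauchy_prod c (dser d) k.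
Proof.
rewrite /dser /cauchy_prod mulr_sumr.
have E (i : 'I_k.+2) : k.+1%:R * (c i * d (k.+1 - i)%N) =
    i%:R * c i * d (k.+1 - i)%N + c i * ((k.+1 - i)%:R * d (k.+1 - i)%N).
  have -> : k.+1%:R = i%:R + (k.+1 - i)%:R :> R by rewrite -natrD subnKC // -ltnS.
  by rewrite mulrDl mulrA [in X in _ + X]mulrCA.
rewrite (eq_bigr _ (fun i _ => E i)) big_split /=; congr (_ + _).
  rewrite big_ord_recl !mul0r add0r; apply: eq_bigr => i _.
  by rewrite lift0 subSS.
rewrite big_ord_recr /= subnn mul0r mulr0 addr0; apply: eq_bigr => i _.
have ik : (i <= k)%N by rewrite -ltnS.
by rewrite (subSn ik).
Qed.

(** For [|t| <= 1] each term beyond k is at most |c_i| |t|^(k+1), so a bound for the absolute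
    partial sums at t = 1 serves as M. *)
Lemma entire_leading c f k : entire c f -> (forall i, (i < k)%N -> c i = 0) ->
  exists M : R, forall t, `|t| <= 1 -> `|f t - c k * t ^+ k| <= M * `|t| ^+ k.+1.
Proof.
move=> cf c0; have [[M HM] _] := cf 1; exists M => t t1.
have [S <-] := cf t; have M0 : 0 <= M by have := HM 0%N; rewrite big_ord0.
have H' : (fun N => `|\sum_(i < N) c i * t ^+ i - c k * t ^+ k|) @ \oo -->
    `|asum (fun i => c i * t ^+ i) - c k * t ^+ k|.
  by apply: cvg_norm; apply: cvgB (abs_summable_cvg S) (cvg_cst _).
rewrite -(cvg_lim (@Rhausdorff _) H'); apply: limr_le; first by apply: cvgP H'.
exists k.+1 => // N /= kN.
have -> : \sum_(i < N) c i * t ^+ i - c k * t ^+ k =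
    \sum_(i < N | (i != k :> nat)) c i * t ^+ i.
  by rewrite (bigD1 (Ordinal kN)) //= addrAC subrr add0r.
apply: le_trans (ler_norm_sum _ _ _) _.
apply: le_trans (ler_wpM2r _ (HM N)); last by rewrite exprn_ge0.
rewrite mulr_suml [leLHS]big_mkcond; apply: ler_sum => i _.
case: ifP => [ik|_]; last by rewrite mulr_ge0 // exprn_ge0.
have [ltik|] := ltnP i k; first by rewrite (c0 _ ltik) mul0r normr0 mulr_ge0 // exprn_ge0.
rewrite leq_eqVlt eq_sym (negbTE ik) /= => ltki.
rewrite expr1n mulr1 normrM ler_wpM2l // normrX.
by apply: ler_wiXn2l.
Qed.

Lemma entire0_coef c f : entire c f -> (forall t, f t = 0) -> forall k, c k = 0.
Proof.
move=> cf f0 k; have [m] := ubnP k; elim: m k => // m IH k km.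
have [i ik|M HM] := entire_leading cf (k := k); first by exact/IH/(leq_trans ik km).
apply/eqP; apply: contrapT => /negP ck.
have c0 : 0 < `|c k| by rewrite normr_gt0.
have M0 : 0 <= M.
  by have := HM 1; rewrite normr1 !expr1n !mulr1 => /(_ (lexx _)) H; exact: le_trans H.
(* Chosen so that M t < |c_k|, against the estimate |c_k| t^k <= M t^(k+1). *)
pose t := `|c k| / (`|c k| + M + 1).
have D0 : 0 < `|c k| + M + 1 by rewrite ltr_wpDl // addr_ge0.
have t0 : 0 < t by rewrite divr_gt0.
have t1 : t <= 1 by rewrite ler_pdivrMr // mul1r -addrA lerDl addr_ge0.
have := HM t; rewrite ger0_norm ?(ltW t0) // => /(_ t1).
rewrite f0 sub0r normrN normrM (ger0_norm (exprn_ge0 _ (ltW t0))) exprS mulrA.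
rewrite ler_pM2r ?exprn_gt0 // /t mulrA ler_pdivlMr // mulrC.
by rewrite ler_pM2r // leNgt; rewrite ltr_pwDr // lerDr ltW.
Qed.

Lemma entire_coef_uniq c d f g : entire c f -> entire d g -> f =1 g -> c =1 d.
Proof.
move=> cf dg fg k; have H := entireD cf (entireZ (-1) dg).
have := entire0_coef H (fun t => _) k; rewrite mulN1r => H0.
by apply/eqP; rewrite -subr_eq0 H0 // => t; rewrite fg mulN1r subrr.
Qed.

(* f is entire with derivative df, differentiated formally *)
Definition diffent f df := exists2 c, entire c f & entire (dser c) df.

Lemma diffent_ext f df g dg : diffent f df -> f =1 g -> df =1 dg -> diffent g dg.
Proof. by move=> H /funext <- /funext <-. Qed.

Lemma diffentD f df g dg : diffent f df -> diffent g dg ->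
  diffent (fun t => f t + g t) (fun t => df t + dg t).
Proof.
move=> [c cf cdf] [d dg' ddg]; exists (fun k => c k + d k); first exact: entireD.
have -> : dser (fun k => c k + d k) = (fun k => dser c k + dser d k).
  by apply/funext => k; rewrite /dser mulrDr.
exact: entireD.
Qed.

Lemma diffentM f df g dg : diffent f df -> diffent g dg ->
  diffent (fun t => f t * g t) (fun t => df t * g t + f t * dg t).
Proof.
move=> [c cf cdf] [d dg' ddg]; exists (cauchy_prod c d); first exact: entireM.
have -> : dser (cauchy_prod c d) = (fun k => cauchy_prod (dser c) d k + cauchy_prod c (dser d) k).
  by apply/funext => k; rewrite dserM.
by apply: entireD; exact: entireM.
Qed.

Lemma diffent_cst a : diffent (fun=> a) (fun=> 0).
Proof.
exists (fun k => (k == 0)%N%:R * a); first exact: entire_cst.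
have -> : dser (fun k => (k == 0)%N%:R * a) = (fun k => (k == 0)%N%:R * 0).
  by apply/funext => k; rewrite /dser mul0r !mulr0.
exact: entire_cst.
Qed.

Lemma diffentZ a f df : diffent f df -> diffent (fun t => a * f t) (fun t => a * df t).
Proof.
move=> H; apply: diffent_ext (diffentM (diffent_cst a) H) _ _ => t //.
by rewrite mul0r add0r.
Qed.

Lemma diffent_sum (I : Type) (r : seq I) (f df : I -> R -> R) :
  (forall i, diffent (f i) (df i)) ->
  diffent (fun t => \sum_(i <- r) f i t) (fun t => \sum_(i <- r) df i t).
Proof.
move=> H; elim: r => [|i r IH].
  by apply: diffent_ext (diffent_cst 0) _ _ => t; rewrite big_nil.
by apply: diffent_ext (diffentD (H i) IH) _ _ => t; rewrite big_cons.
Qed.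

Lemma diffent_prod n (f df : 'I_n -> R -> R) : (forall i, diffent (f i) (df i)) ->
  diffent (fun t => \prod_(i < n) f i t)
    (fun t => \sum_(i < n) \prod_(k < n) (if k == i then df k t else f k t)).
Proof.
elim: n f df => [|n IH] f df H.
  by apply: diffent_ext (diffent_cst 1) _ _ => t; rewrite big_ord0.
have := diffentM (H ord0) (IH _ _ (fun i => H (lift ord0 i))).
move=> /diffent_ext; apply=> t; first by rewrite big_ord_recl.
rewrite big_ord_recl big_ord_recl eqxx; congr (_ * _ + _).
rewrite mulr_sumr; apply: eq_bigr => i _; rewrite big_ord_recl; congr (_ * _).
Qed.

(** Jacobi's formula: the product rule differentiates one row at a time, and expanding along that
    row brings out its cofactors. *)
Lemma diffent_det n (M M' : R -> 'M[R]_n) :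
  (forall i j, diffent (fun t => M t i j) (fun t => M' t i j)) ->
  diffent (fun t => \det (M t)) (fun t => \tr (M' t *m \adj (M t))).
Proof.
move=> H.
have Hs (s : 'S_n) := diffentZ ((-1) ^+ s) (diffent_prod (fun i => H i (s i))).
apply: diffent_ext (diffent_sum (index_enum _) Hs) _ _ => t; first by [].
under eq_bigr do rewrite mulr_sumr.
rewrite exchange_big; apply: eq_bigr => i _ /=.
pose B := \matrix_(k < n, l < n) (if k == i then M' t k l else M t k l).
transitivity (\det B).
  by apply: eq_bigr => s _; congr (_ * _); apply: eq_bigr => k _; rewrite mxE.
rewrite (expand_det_row _ i) mxE; apply: eq_bigr => j _; rewrite !mxE eqxx; congr (_ * _).
rewrite /cofactor; congr (_ * \det _); apply/matrixP => k l; rewrite !mxE.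
by rewrite eq_sym (negbTE (neq_lift _ _)).
Qed.

(* Compare Taylor coefficients at 0. *)
Lemma diffent_ode_zero f df g dg : diffent f df -> diffent g dg -> f 0 = 0 -> g 0 != 0 ->
  (forall t, df t * g t = f t * dg t) -> forall t, f t = 0.
Proof.
move=> [c cf cdf] [d dg' ddg] f0 g0 E.
have CE := entire_coef_uniq (entireM cdf dg') (entireM cf ddg) E.
suff c0 k : c k = 0.
  move=> t; have [_ <-] := cf t; apply: asumE.
  suff -> : (fun N => \sum_(k < N) c k * t ^+ k) = fun=> 0 by exact: cvg_cst.
  by apply/funext => N; rewrite big1 // => i _; rewrite c0 mul0r.
have [m] := ubnP k; elim: m k => // m IH [|k] km; first by rewrite (entire_at0 cf).
have := CE k; rewrite /cauchy_prod [RHS]big1 => [|i _]; last first.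
  by rewrite IH ?mul0r //; apply: leq_trans (ltn_ord i) _.
rewrite big_ord_recr /= subnn big1 => [|i _]; last first.
  by rewrite /dser IH ?mulr0 ?mul0r //; apply: leq_ltn_trans (ltn_ord i) _.
rewrite add0r (entire_at0 dg') => /eqP; rewrite mulf_eq0 (negbTE g0) orbF.
by rewrite /dser mulf_eq0 pnatr_eq0 => /eqP.
Qed.

End Entire.

(** * The square of the scalar part of S *)

Section JacobianODE.
Variables (R : realType) (V : vectType R) (Q : V -> R).
Hypotheses (HQ : is_qform Q) (Qnd : nondegenerate_qform Q).
Local Notation B := (polar Q).
Local Notation iv := (Defs.contraction Q).
Local Notation cv := (clvar (@zero_form R V)).

Lemma coord_sum_entire (U : lmodType R) (u : R -> nat -> U) (y : R -> U) (v : nat -> U)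
    (l : U -> R^o) : linear l -> (forall t, coord_sum (u t) (y t)) ->
  (forall t k, u t k = t ^+ k *: v k) -> entire (fun k => l (v k)) (fun t => l (y t)).
Proof.
move=> ll uy uE t; have := coord_sum_scalar (coord_sum_lin ll (uy t)).
suff -> : (fun k => l (u t k)) = (fun k => l (v k) * t ^+ k) by [].
by apply/funext => k; rewrite uE (lin_funZ ll) mulrC.
Qed.

Lemma power_series_entire (c : nat -> R) (A : 'End(V)) (l : 'End(V) -> R^o) :
  (forall k, `|c k * k`!%:R| <= 1) -> linear l ->
  entire (fun k => l (c k *: iter k (comp_lfun A) \1%VF)) (fun t => l (power_series c (t *: A))).
Proof.
move=> c1 ll; apply: (coord_sum_entire ll (fun t => power_series_sum (t *: A) c1)) => t k.
rewrite scalerA mulrC -scalerA; congr (_ *: _).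
elim: k => [|k IH] /=; first by rewrite expr0 scale1r.
by rewrite IH -comp_lfunZl -comp_lfunZr scalerA exprS.
Qed.

Lemma j_diffent (A : 'End(V)) (l : 'End(V) -> R^o) : linear l ->
  diffent (fun t => l (j_of (t *: A))) (fun t => l (A \o dj_of (t *: A))%VF).
Proof.
move=> ll; exists (fun k => l (j_coef R k *: iter k (comp_lfun A) \1%VF)).
  exact: power_series_entire (@j_coef_bound R) ll.
have := power_series_entire A (@dj_coef_bound R) (linear_comp ll (comp_lfun_linear A)).
suff -> : (fun k => l (A \o dj_coef R k *: iter k (comp_lfun A) \1)%VF) =
    dser (fun k => l (j_coef R k *: iter k (comp_lfun A) \1%VF)) by [].
apply/funext => k; rewrite /dser /dj_coef /pseries_diffs -comp_lfunZr.
by rewrite -[LHS]/(l (_ *: iter k.+1 (comp_lfun A) \1%VF)) -scalerA (lin_funZ ll).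
Qed.

Variables (n : nat) (e e' : n.-tuple V).
Hypothesis ee' : dual_bases Q e e'.

Lemma mxtrace_endmx (Z : 'End(V)) :
  \tr (endmx Z) = \sum_b B (tnth e b) (Z (tnth e' b)).
Proof.
have E i : endmx Z i i = coord (vbasis {:V}) i (Z (vbasis {:V})`_i).
  by rewrite /endmx /passmx.mxof mxE /= passmx.vecof_delta mxE.
rewrite /mxtrace; under eq_bigr do rewrite E.
transitivity (\sum_(i < \dim {:V}) \sum_(b < n) B (Z (vbasis {:V})`_i) (tnth e b) * coord (vbasis {:V}) i (tnth e' b)).
  apply: eq_bigr => i _; rewrite {1}[Z _](dual_expand' HQ Qnd ee') linear_sum.
  by apply: eq_bigr => b _; rewrite linearZ.
rewrite exchange_big; apply: eq_bigr => b _ /=.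
rewrite {2}[tnth e' b](coord_vbasis (memvf _)) linear_sum polar_sumr //.
by apply: eq_bigr => i _; rewrite linearZ polarZr // mulrC polarC.
Qed.

Variable A : 'End(V).
Hypothesis oA : orthogonal_lie Q A.
Local Notation lam := (lambda e e' A).
Local Notation S t := (S_fun Q e e' (t *: A)).

Lemma orthogonal_lieZ t : orthogonal_lie Q (t *: A).
Proof.
by move=> v w; rewrite !scale_lfunE polarZl // polarZr // -mulrDr oA mulr0.
Qed.

Lemma S_entire (l : ext V -> R^o) : linear l ->
  entire (fun k => l (S_coef Q e e' A k)) (fun t => l (S t)).
Proof.
move=> ll; apply: (coord_sum_entire ll (fun t => S_coef_sum HQ ee' (t *: A))) => t k.
exact: S_coefZ.
Qed.

(** In the scalar part of the recursion only iota_lam survives, because N s and lam * s have scalar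
    part 0. *)
Lemma eps_S_diffent : diffent (fun t => eps (S t)) (fun t => eps (contr Q lam (S t))).
Proof.
have el : linear (@eps R V : ext V -> R^o) by exact: eps_scalar.
exists (fun k => eps (S_coef Q e e' A k)); first exact: S_entire el.
have := S_entire (linear_comp el (contr_linear HQ lam)).
suff -> : (fun k => eps (contr Q lam (S_coef Q e e' A k))) =
    dser (fun k => eps (S_coef Q e e' A k)) by [].
apply/funext => k; have /(congr1 (@eps R V)) := S_coefS HQ ee' A k.
rewrite /S_step !epsD !epsZ eps_euler eps_lambdaM mulr0 !addr0.
by move=> <-.
Qed.

(** The adjugate X replaces the inverse of j(tA), so the equation also holds where J vanishes.
    Inserting X in [S_fun_killed] expresses J iota_w S through a product, and taking scalar parts in
    iota_lam S leaves a trace. *)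
Lemma jacobian_ode t : 2 * eps (contr Q lam (S t)) * J_fun (t *: A) =
  eps (S t) * \tr (endmx (A \o dj_of (t *: A))%VF *m \adj (endmx (j_of (t *: A)))).
Proof.
have bb := vbasisP {:V}; set j := j_of (t *: A); set dj := dj_of (t *: A).
pose X : 'End(V) := passmx.hommx (vbasis {:V}) (vbasis {:V}) (\adj (endmx j)).
have XE : endmx X = \adj (endmx j) by exact: passmx.hommxK.
have jX u : j (X u) = J_fun (t *: A) *: u.
  rewrite -comp_lfunE; have -> : (j \o X)%VF = J_fun (t *: A) *: \1%VF.
    apply: (can_inj (passmx.mxofK bb bb)); rewrite -[LHS]/(endmx _) endmx_comp XE.
    rewrite mul_adj_mx (lin_funZ (@passmx.mxof_linear _ _ _ _ _)).
    by rewrite passmx.mxof1 ?(basis_free bb) // scale_scalar_mx mulr1.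
  by rewrite scale_lfunE id_lfunE.
have ivS w : J_fun (t *: A) *: iv w (S t) = - (cv (dj (X w)) * S t).
  have := S_fun_killed HQ Qnd ee' (orthogonal_lieZ t) (X w).
  rewrite -/j jX (bilinear_funZl (iv_bilinear HQ)) => /eqP.
  by rewrite addr_eq0 => /eqP.
have lamE : J_fun (t *: A) *: contr Q lam (S t) =
    - (2^-1 *: \sum_a iv (A (tnth e a)) (cv (dj (X (tnth e' a))) * S t)).
  rewrite (contr_lambdaE HQ) scalerA mulrC -scalerA -scalerN; congr (_ *: _).
  rewrite scaler_sumr -sumrN; apply: eq_bigr => a _.
  by rewrite -(lin_funZ (iv_linear HQ _)) ivS (lin_funN (iv_linear HQ _)).
rewrite -mulrA [eps _ * _]mulrC -epsZ lamE -scaleN1r !epsZ.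
rewrite mulrCA mulN1r mulVKf ?pnatr_eq0 //.
have el : linear (@eps R V : ext V -> R^o) by exact: eps_scalar.
rewrite (lin_fun_sum el) -sumrN -XE mxtrace_mulC -endmx_comp mxtrace_endmx mulr_sumr.
apply: eq_bigr => a _; rewrite (iv_varM HQ) epsD epsZ -scaleN1r epsZ eps_varM mulr0 addr0.
by rewrite (orth_skew oA) !comp_lfunE mulNr scaleN1r opprK mulrC.
Qed.

Lemma eps_S_sqr : eps (S_fun Q e e' A) ^+ 2 = J_fun A.
Proof.
pose h t := eps (S t); pose J t := J_fun (t *: A).
pose h' t := eps (contr Q lam (S t)).
pose J' t := \tr (endmx (A \o dj_of (t *: A))%VF *m \adj (endmx (j_of (t *: A)))).
have dJ : diffent J J'.
  apply: diffent_det => i k.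
  apply: (j_diffent A (l := fun Z => endmx Z i k : R^o)) => c Y Z.
  by rewrite /endmx passmx.mxof_linear !mxE.
have dD := diffentD (diffentM eps_S_diffent eps_S_diffent) (diffentZ (-1) dJ).
have h0 : h 0 = 1.
  have [c cf _] := eps_S_diffent.
  by rewrite /h -(entire_at0 (S_entire (@eps_scalar R V : linear (@eps R V : _ -> R^o)))) eps1.
have J0 : J 0 = 1.
  rewrite /J /J_fun; suff -> : endmx (j_of (0 *: A)) = 1%:M by rewrite det1.
  apply/matrixP => i k.
  have ll : linear (fun Z : 'End(V) => endmx Z i k : R^o).
    by move=> c Y Z; rewrite /endmx passmx.mxof_linear !mxE.
  rewrite -(entire_at0 (power_series_entire A (@j_coef_bound R) ll)) /=.
  rewrite /j_coef /= mul1r invr1 scale1r /endmx passmx.mxof1 //.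
  exact: basis_free (vbasisP _).
(* With D = h^2 - J, the relation 2 J h' = h J' becomes D' J = D J', where D(0) = 0 and J(0) = 1. *)
have ode t : (h' t * h t + h t * h' t + -1 * J' t) * J t = (h t * h t + -1 * J t) * J' t.
  have := jacobian_ode t; rewrite -/(h t) -/(h' t) -/(J' t) -/(J t).
  move: (h t) (h' t) (J t) (J' t) => x x' y y' E.
  transitivity (x * (2 * x' * y) - y * y'); first by ring.
  by rewrite E; ring.
have D00 : h 0 * h 0 + -1 * J 0 = 0 by rewrite h0 J0 mulr1 mulN1r subrr.
have J0' : J 0 != 0 by rewrite J0 oner_neq0.
have := diffent_ode_zero dD dJ D00 J0' ode 1; rewrite mulN1r /J scale1r => /eqP.
by rewrite subr_eq0 -expr2 => /eqP.
Qed.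

End JacobianODE.

(** * Uniqueness of the smooth square root *)

Section SmoothChains.
Variable R : realType.
Implicit Types (phi : nat -> R -> R) (t T : R).

(** A function of one variable packed with all its derivatives, so that inductions on the order
    simply shift the sequence. *)
Definition chain phi := forall k t, is_derive t (1 : R) (phi k : R -> R^o) (phi k.+1 t).

Lemma chain_near phi k t (eta : R) : chain phi -> 0 < eta ->
  exists2 del : R, 0 < del & forall u, `|u - t| < del -> `|phi k u - phi k t| < eta.
Proof.
move=> ch e0; have [dv _] := ch k t.
have ct : {for t, continuous (phi k : R -> R^o)}.
  by apply: differentiable_continuous; apply/derivable1_diffP.
have /cvgrPdist_lt/(_ _ e0)/nbhs_ballP[del /= d0 H] := ct; exists del => // u ud.
by rewrite distrC; apply: H; rewrite /ball /= distrC.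
Qed.

Lemma chain_diff phi k t (eta : R) : chain phi -> 0 < eta ->
  exists2 del : R, 0 < del & forall s, s != 0 -> `|s| < del ->
    `|phi k.+1 t - s^-1 * (phi k (t + s) - phi k t)| <= eta.
Proof.
move=> ch e0; have [dv <-] := ch k t.
have /cvgrPdist_le/(_ _ e0)/nbhs_ballP[del /= d0 H] := dv.
exists del => // s s0 sd; have := H s; rewrite /ball /= sub0r normrN => /(_ sd s0).
by rewrite [s%:A]mulr1 [s + t]addrC.
Qed.

(** Induction on k: the derivative vanishes on the same interval, and the mean value theorem on
    [T, T + s] turns its bound of order k into one of order k + 1. *)
Lemma chain_flat phi T : chain phi -> 0 < T -> (forall t, 0 < t <= T -> phi 0%N t = 0) ->
  forall k, exists C del : R, [/\ 0 <= C, 0 < del &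
    forall s, 0 <= s < del -> `|phi 0%N (T + s)| <= C * s ^+ k].
Proof.
move=> ch T0 z k; elim: k phi ch z => [|k IH] phi ch z.
  have [del d0 H] := chain_near 0 T ch ltr01.
  exists 1, del; split=> // s /andP[s0 sd]; rewrite expr0 mulr1 ltW //.
  have := H (T + s); rewrite addrAC subrr add0r ger0_norm // => /(_ sd).
  by rewrite (z T) ?T0 ?lexx // subr0.
have z1 t : 0 < t <= T -> phi 1%N t = 0.
  move=> /andP[t0 tT]; apply/eqP; rewrite -normr_le0; apply/ler_addgt0Pl => eta e0.
  have [del d0 H] := chain_diff 0 t ch e0.
  (* A negative increment, so that t + s stays in the interval where phi vanishes, even for t =
     T. *)
  pose s := - (Num.min del t / 2).
  have m0 : 0 < Num.min del t by rewrite lt_min d0 t0.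
  have s0 : s < 0 by rewrite oppr_lt0 divr_gt0.
  have sd : `|s| < del.
    rewrite ltr0_norm // opprK; apply: lt_le_trans (_ : Num.min del t <= _).
      by rewrite ltr_pdivrMr // ltr_pMr // ltr1n.
    by rewrite ge_min lexx.
  have ts : 0 < t + s <= T.
    rewrite (le_trans _ tT) ?gerDl ?ltW // andbT subr_gt0.
    apply: lt_le_trans (_ : Num.min del t <= _).
      by rewrite ltr_pdivrMr // ltr_pMr // ltr1n.
    by rewrite ge_min lexx orbT.
  have := H s (ltr0_neq0 s0) sd; rewrite (z _ ts) (z t) ?t0 // subrr mulr0 subr0.
  by rewrite addr0.
have [C [del [C0 d0 H]]] := IH (fun k => phi k.+1) (fun k => ch k.+1) z1.
exists C, del; split=> // s /andP[s0 sd].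
have [->|sn0] := eqVneq s 0; first by rewrite addr0 (z T) ?T0 ?lexx // normr0 mulr_ge0 // exprn_ge0.
have {}s0 : 0 < s by rewrite lt_def sn0.
have Ts : T < T + s by rewrite ltrDl.
have [x] := @MVT _ (phi 0%N) (phi 1%N) _ _ Ts (fun x _ => ch 0%N x)
  (@derivable_within_continuous _ _ _ _ (fun x _ => @ex_derive _ _ _ _ _ _ _ (ch 0%N x))).
rewrite in_itv /= => /andP[Tx xs]; rewrite (z T) ?T0 ?lexx // subr0 addrAC subrr add0r => ->.
have := H (x - T); rewrite subr_ge0 (ltW Tx) ltrBlDl (lt_trans xs) ?ltrD2l // subrKC => /(_ isT) Hx.
rewrite normrM (gtr0_norm s0) exprSr mulrA ler_wpM2r ?(ltW s0) //.
apply: le_trans Hx _; rewrite ler_wpM2l //; apply: lerXn2r.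
- by rewrite nnegrE subr_ge0 ltW.
- by rewrite nnegrE ltW.
- by rewrite lerBlDl ltW.
Qed.

Lemma smooth_chain (f : 'rV[R]_1 -> R) : smooth f ->
  exists2 phi, chain phi & forall t, phi 0%N t = f (const_mx t).
Proof.
move=> sf; pose D (g : 'rV[R]_1 -> R) (x : 'rV[R]_1) : R := 'D_(const_mx 1) (g : _ -> R^o) x.
have sD k : smooth (iter k D f).
  by elim: k => [//|k IH] j; have [_] := IH j.+1; apply.
exists (fun k t => iter k D f (const_mx t)) => // k t.
have [dv _] := sD k 1%N; have := dv (const_mx t) (const_mx 1).
have E : (fun h : R => h^-1 *: (((iter k D f : _ -> R^o) \o shift (const_mx t)) (h *: const_mx 1) -
     iter k D f (const_mx t))) =
  (fun h : R => h^-1 *: (((fun t => iter k D f (const_mx t) : R^o) \o shift t) (h *: (1 : R)) -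
     iter k D f (const_mx t))).
  apply/funext => h; congr (_ *: (iter k D f _ - _)).
  by apply/rowP => i; rewrite /shift /= !mxE.
move=> dvt; split; first by move: dvt; rewrite /derivable E.
by rewrite /= /D /derive E.
Qed.

Lemma chainB phi psi : chain phi -> chain psi -> chain (fun k t => phi k t - psi k t).
Proof.
move=> ch ch' k t; have H := ch k t; have H' := ch' k t.
exact: (@is_deriveB _ _ _ (phi k : R -> R^o) (psi k : R -> R^o)).
Qed.

Lemma sqr_eq_or (x y : R) : x ^+ 2 = y ^+ 2 -> x - y = 0 \/ x - y = 2 * x.
Proof.
move/eqP; rewrite eqf_sqr => /orP[/eqP -> |/eqP ->]; first by left; rewrite subrr.
by right; ring.
Qed.

(* At a zero of finite order k of phi 0, the difference vanishes on the left,
   hence is O(s ^ (k + 1)) on the right, too small to be 2 phi 0. *)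
Lemma chain_sqrt_extends phi psi T : chain phi -> chain psi ->
  (forall t, phi 0%N t ^+ 2 = psi 0%N t ^+ 2) ->
  (exists c, entire c (fun s => phi 0%N (T + s))) -> phi 0%N 0 != 0 -> 0 <= T ->
  (forall t, 0 <= t <= T -> phi 0%N t = psi 0%N t) ->
  exists2 del : R, 0 < del & forall t, T <= t <= T + del -> phi 0%N t = psi 0%N t.
Proof.
move=> ch ch' sq [c cE] p0 T0 eqT.
suff [k [C [del [C0 d0 dk ck]]]] : exists k (C del : R), [/\ 0 <= C, 0 < del,
    forall s, 0 <= s < del -> `|phi 0%N (T + s) - psi 0%N (T + s)| <= C * s ^+ k.+1 \/
      phi 0%N (T + s) = psi 0%N (T + s) &
    c k != 0 /\ forall i, (i < k)%N -> c i = 0].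
  have [ckn0 c0] := ck; have [M HM] := entire_leading cE c0.
  (* From 2 |phi| <= C s^(k+1) and |phi| >= |c_k| s^k - |M| s^(k+1) one gets 2 |c_k| < M' s, which
     is impossible for s <= |c_k| / M'. *)
  pose M' := C + 2 * `|M| + 1.
  have M'0 : 0 < M' by rewrite ltr_wpDl // addr_ge0 // mulr_ge0.
  have ck0 : 0 < `|c k| by rewrite normr_gt0.
  pose eta := Num.min (del / 2) (Num.min 1 (`|c k| / M')).
  have e0 : 0 < eta by rewrite !lt_min !divr_gt0 // ltr01.
  exists eta => // t /andP[Tt tT]; pose s := t - T.
  have tE : t = T + s by rewrite /s subrKC.
  have s0 : 0 <= s by rewrite subr_ge0.
  have se : s <= eta by rewrite lerBlDl.
  move: se; rewrite !le_min => /and3P[sd s1 sc].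
  have sdel : 0 <= s < del by rewrite s0 (le_lt_trans sd) // ltr_pdivrMr // ltr_pMr // ltr1n.
  have [sz|sn0] := eqVneq s 0; first by rewrite tE sz addr0 eqT // T0 lexx.
  have {}s0 : 0 < s by rewrite lt_def sn0.
  rewrite tE; have [dC|//] := dk s sdel.
  have [/eqP|d2] := sqr_eq_or (sq (T + s)); first by rewrite subr_eq0 => /eqP.
  exfalso; move: dC; rewrite d2 => dC.
  have := HM s; rewrite ger0_norm ?(ltW s0) // => /(_ s1) lead.
  have sk0 : 0 < s ^+ k by rewrite exprn_gt0.
  have L : `|c k| * s ^+ k <= `|phi 0%N (T + s)| + M * s ^+ k.+1.
    rewrite -[X in `|c k| * X](gtr0_norm sk0) -normrM.
    rewrite -{1}[c k * _](subrKC (phi 0%N (T + s))).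
    by apply: le_trans (ler_normD _ _) _; rewrite lerD2l distrC.
  move: dC; rewrite normrM [`|2|]ger0_norm // exprS mulrA => dC.
  move: L; rewrite exprS mulrA => L.
  have ML : M * s * s ^+ k <= `|M| * s * s ^+ k.
    by rewrite !ler_wpM2r ?(ltW s0) ?(ltW sk0) // ler_norm.
  have : `|c k| * 2 <= (C + 2 * `|M|) * s.
    rewrite -(ler_pM2r sk0); move: dC L ML; move: (s ^+ k) `|c k| `|M| (phi _ _) => x y z p.
    lra.
  move=> /le_lt_trans => /(_ (M' * s)); rewrite ltr_pM2r // /M' ltrDl ltr01 => /(_ isT).
  move=> /lt_le_trans => /(_ `|c k|); rewrite -/M' mulrC -ler_pdivlMr // => /(_ sc).
  by rewrite gtr_pMr // ltNge ler1n.
(* Otherwise the expansion at T, valid on the whole line, would give phi(0) = 0 when evaluated at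
   -T. *)
have exk : exists k, c k != 0.
  apply: contrapT => nk; have [_ p0E] := cE (- T).
  rewrite subrr in p0E; case/negP: p0; rewrite -p0E; apply/eqP/asumE.
  suff -> : (fun N => \sum_(k < N) c k * (- T) ^+ k) = fun=> 0 by exact: cvg_cst.
  apply/funext => N; rewrite big1 // => k _.
  by have [->|ck] := eqVneq (c k) 0; [rewrite mul0r|case: nk; exists k].
have [k ck kmin] := ex_minnP exk.
have ckP : c k != 0 /\ forall i, (i < k)%N -> c i = 0.
  split=> // i ik; apply/eqP; apply: contraTT ik => ci.
  by rewrite -leqNgt kmin.
have chd := chainB ch ch'.
have dT : phi 0%N T - psi 0%N T = 0 by rewrite eqT ?subrr // T0 lexx.
exists k; have [pT|pT] := eqVneq (phi 0%N T) 0.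
  have T0' : 0 < T.
    by rewrite lt_def T0 andbT; apply/eqP => Tz; move: pT p0; rewrite Tz => ->; rewrite eqxx.
  have [|C [del [C0 d0 H]]] := chain_flat chd T0' _ k.+1.
    by move=> t /andP[t0 tT]; rewrite eqT ?subrr // (ltW t0).
  by exists C, del; split=> // s sd; left; exact: H.
have e0 : 0 < `|phi 0%N T| by rewrite normr_gt0.
have [del1 d1 H1] := chain_near 0 T chd e0.
have [del2 d2 H2] := chain_near 0 T ch (divr_gt0 e0 (ltr0n R 2)).
exists 0, (Num.min del1 del2); split=> // [|s]; first by rewrite lt_min d1.
rewrite lt_min => /and3P[s0 sd1 sd2]; right.
have [/eqP|dE] := sqr_eq_or (sq (T + s)); first by rewrite subr_eq0 => /eqP.
exfalso; have := H1 (T + s); have := H2 (T + s).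
rewrite addrAC subrr add0r ger0_norm // => /(_ sd2) h2 /(_ sd1).
rewrite dT subr0 dE normrM [`|2|]ger0_norm //.
have : `|phi 0%N T| <= `|phi 0%N (T + s)| + `|phi 0%N (T + s) - phi 0%N T|.
  rewrite -{1}[phi 0%N T](subrKC (phi 0%N (T + s))).
  by apply: le_trans (ler_normD _ _) _; rewrite lerD2l distrC.
lra.
Qed.

(** A connectedness argument on [0, 1]: T is the supremum of the initial segments of agreement,
    continuity includes T itself, and [chain_sqrt_extends] passes beyond it unless T = 1. *)
Lemma chain_sqrt_uniq phi psi : chain phi -> chain psi ->
  (forall t, phi 0%N t ^+ 2 = psi 0%N t ^+ 2) ->
  (forall T, exists c, entire c (fun s => phi 0%N (T + s))) ->
  phi 0%N 0 != 0 -> phi 0%N 0 = psi 0%N 0 -> phi 0%N 1 = psi 0%N 1.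
Proof.
move=> ch ch' sq cE p0 pp.
pose P t := forall u, 0 <= u <= t -> phi 0%N u = psi 0%N u.
suff : P 1 by apply; rewrite ler01 lexx.
apply: contrapT => nP1; pose E := [set t | 0 <= t <= 1 /\ P t].
have E0 : E 0.
  by split=> [|u /andP[u0 u0']]; [rewrite lexx ler01|rewrite (le_anti (introT andP (conj u0' u0)))].
have hE : has_sup E by split; [exists 0|exists 1 => t [/andP[]]].
pose T := sup E.
have T0 : 0 <= T by apply: ub_le_sup => //; exact: hE.2.
have T1 : T <= 1 by apply: ge_sup; [exact: hE.1|move=> t [/andP[]]].
have lT u : 0 <= u < T -> phi 0%N u = psi 0%N u.
  move=> /andP[u0 uT]; have [t [_ Pt] ut] := sup_gt (hE.1) uT.
  by apply: Pt; rewrite u0 ltW.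
have PT : P T.
  move=> u /andP[u0]; rewrite le_eqVlt => /orP[/eqP uT|uT]; last by apply: lT; rewrite u0.
  have [uz|un0] := eqVneq u 0; first by rewrite uz.
  have {un0}u0 : 0 < u by rewrite lt_def un0.
  apply/eqP; rewrite -subr_eq0 -normr_le0; apply/ler_addgt0Pl => eta e0; rewrite addr0.
  have [del d0 H] := chain_near 0 u (chainB ch ch') e0.
  pose s := Num.min del u / 2.
  have s0 : 0 < s by rewrite divr_gt0 // lt_min d0 u0.
  have m2 : s < Num.min del u by rewrite ltr_pdivrMr // ltr_pMr ?ltr1n // lt_min d0 u0.
  move: m2; rewrite lt_min => /andP[sd su].
  have := H (u - s); rewrite addrAC subrr add0r normrN gtr0_norm // => /(_ sd).
  by rewrite (lT (u - s)) ?subrr ?sub0r ?normrN => [/ltW //|]; rewrite subr_ge0 ltW //= -uT gtrBl.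
have [del d0 H] := chain_sqrt_extends ch ch' sq (cE T) p0 T0 PT.
have T1' : T < 1.
  by rewrite lt_def T1 andbT; apply/eqP => T1'; apply: nP1; rewrite T1'.
have : E (Num.min (T + del) 1).
  split=> [|u /andP[u0]]; first by rewrite le_min addr_ge0 ?(ltW d0) // ler01 ge_min lexx orbT.
  rewrite le_min => /andP[uT _]; have [uT'|Tu] := leP u T; first by apply: PT; rewrite u0.
  by apply: H; rewrite (ltW Tu).
move=> /(ub_le_sup hE.2); rewrite -/T leNgt => /negP[].
by rewrite lt_min ltrDl d0.
Qed.

End SmoothChains.

(** Multi-indices in one variable are natural numbers, and the radius [|t| + 1] reaches the given t
    with the same coefficients. *)
Lemma rec_class_entire (R : realType) (g : 'rV[R]_1 -> R) (x : 'rV[R]_1) :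
  rec_class g -> exists c, entire c (fun s => g (x + const_mx s)).
Proof.
move=> /(@rec_class_expansion _ _ _ x)[c H]; exists (fun k => c (fun=> k)) => t.
have r0 : 0 < `|t| + 1 by rewrite ltr_wpDl.
have [[M HM] /(_ (const_mx t)) C] := H _ r0.
have reidx N (F : ('I_1 -> nat) -> R) :
    \sum_(a : {ffun 'I_1 -> 'I_N}) F (fun i => a i) = \sum_(k < N) F (fun=> k).
  rewrite (reindex (fun k : 'I_N => [ffun=> k] : {ffun 'I_1 -> 'I_N})) /=.
    apply: eq_bigr => k _; congr F; apply/funext => i; by rewrite ffunE.
  exists (fun a => a ord0) => [k|a] _; first by rewrite ffunE.
  by apply/ffunP => i; rewrite ffunE (ord1 i).
split.
  exists M => N; apply: le_trans (HM N).
  rewrite (reidx N (fun a => `|c a| * \prod_(i < 1) (`|t| + 1) ^+ a i)).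
  apply: ler_sum => k _; rewrite big_ord1 normrM normrX ler_wpM2l //.
  by apply: lerXn2r; rewrite ?nnegrE ?addr_ge0 // lerDl.
apply: asumE; have {}C := C (fun i => _).
suff -> : (fun N => \sum_(k < N) c (fun=> k) * t ^+ k) =
    (fun N => \sum_(a : {ffun 'I_1 -> 'I_N})
      c (fun i => a i) * \prod_(i < 1) const_mx t (ord0 : 'I_1) i ^+ a i).
  by apply: C => i; rewrite mxE ltrDl.
apply/funext => N.
rewrite (reidx N (fun a => c a * \prod_(i < 1) const_mx t (ord0 : 'I_1) i ^+ a i)).
by apply: eq_bigr => k _; rewrite big_ord1 mxE.
Qed.

(** * Identification of the smooth square root of J *)

Section HalfJacobian.
Variables (R : realType) (V : vectType R) (Q : V -> R).
Hypotheses (HQ : is_qform Q) (Qnd : nondegenerate_qform Q).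
Variables (n : nat) (e e' : n.-tuple V).
Hypothesis ee' : dual_bases Q e e'.
Local Notation h A := (eps (S_fun Q e e' A)).

Lemma eps_S_rec_class (m : nat) (L : {linear 'rV[R]_m -> 'End(V)}) :
  rec_class (fun x => h (L x)).
Proof. exact: (S_coef_coord HQ ee' L).2 (@eps R V). Qed.

Lemma eps_S0 : h 0 = 1.
Proof.
have el : linear (@eps R V : ext V -> R^o) by exact: eps_scalar.
by have := entire_at0 (S_entire HQ ee' 0 el); rewrite scale0r /= eps1.
Qed.

(** [xget] may return any smooth root g. Restricting g and h to the line through 0 and A reduces the
    comparison to one variable, where h is entire and equals 1 at the origin. *)
Lemma J_halfE A : orthogonal_lie Q A -> J_half Q A = h A.
Proof.
move=> oA.
have hP : [/\ smooth_on (orthogonal_lie Q) (fun A => h A),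
    forall A, orthogonal_lie Q A -> h A ^+ 2 = J_fun A & h 0 = 1].
  split; first by move=> m L _; apply: rec_class_smooth; exact: eps_S_rec_class.
    by move=> C oC; exact: (eps_S_sqr HQ Qnd ee' oC).
  exact: eps_S0.
rewrite /J_half; case: xgetP => [g _ [gs gJ g0]|/(_ (fun A => h A))//].
have lL : linear (fun x : 'rV[R]_1 => x ord0 ord0 *: A).
  by move=> c x y; rewrite !mxE scalerDl scalerA.
have [L LE] := linear_pack lL.
have Lc t : L (const_mx t) = t *: A by rewrite LE mxE.
have oL x : orthogonal_lie Q (L x) by rewrite LE; exact: orthogonal_lieZ.
have hrc := eps_S_rec_class L.
have [phi chp phiE] := smooth_chain (rec_class_smooth hrc).
have [psi chps psiE] := smooth_chain (gs 1%N L oL).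
have := chain_sqrt_uniq chp chps _ _ _ _.
rewrite !phiE !psiE /= !Lc scale1r scale0r eps_S0 g0 => ->//.
- by move=> t; have [_ hJ _] := hP; rewrite phiE psiE /= hJ ?gJ.
- move=> T; have [c cE] := rec_class_entire (const_mx T) hrc; exists c => t.
  have := cE t; rewrite phiE; congr (_ /\ _ = h (L _)).
  by apply/rowP => i; rewrite !mxE.
Qed.

End HalfJacobian.

Lemma analytic_on_zero (R : realType) (X U : lmodType R) (D : set X) :
  analytic_on D (fun=> 0 : U).
Proof.
move=> m L _ l x; exists 1, (fun=> 0); split=> //.
  by exists 0 => N; rewrite big1 // => a _; rewrite normr0 mul0r.
move=> v _; rewrite /= linear0.
suff -> : (fun N => \sum_(a : {ffun 'I_m -> 'I_N}) 0 * \prod_(i < m) v ord0 i ^+ a i) =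
  fun=> 0 :> R by exact: cvg_cst.
by apply/funext => N; rewrite big1 // => a _; rewrite mul0r.
Qed.

Theorem theorem2p1 (R : realType) (V : vectType R) (Q : V -> R)
    (HQ : is_qform Q) (Qnd : nondegenerate_qform Q) :
  exists S : 'End(V) -> ext V,
    [/\ forall A, orthogonal_lie Q A -> parity (S A) = S A,
        analytic_on (orthogonal_lie Q) S &
        forall (n : nat) (e e' : n.-tuple V), dual_bases Q e e' ->
          (forall A, orthogonal_lie Q A -> pole_free A ->
             S A = J_half Q A *: Cl_exp (frak_r e e' A)) /\
          (forall (E : lmodType R) (phi : {linear V -> E}) (A : 'End(V)),
             orthogonal_lie Q A ->
             tmap1 (quant Q) (tmap1 (contr Q (S A))
               (gtensor_exp (gtl _ (lambda e e' A) - ephi e e' _ phi))) =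
             gtensor_exp (gtl _ (gamma Q e e' A) - ephi e e' Q phi))].
Proof.
(* S has to be chosen before the bases. One pair of dual bases is fixed if there is any; otherwise
   the clause over bases is vacuous and 0 serves. *)
have [[m [g [g' gg']]]|ng] := pselect (exists m (g g' : m.-tuple V), dual_bases Q g g');
    last first.
  exists (fun=> 0); split=> [A _||n e e' ee']; first exact: linear0.
    exact: analytic_on_zero.
  by case: ng; exists n, e, e'.
exists (S_fun Q g g'); split=> [A _||n e e' ee'].
- exact: S_fun_parity.
- exact: S_fun_analytic.
split=> [A oA pA|E phi A oA]; rewrite (S_coef_change HQ Qnd A gg' ee').
  by rewrite (J_halfE HQ Qnd ee' oA) -S_fun_exp //; exact: pole_free_lker.
exact: quant_contr_exp.
Qed.
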